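(* In the setting described in the context, suppose $(T_{\lambda,\sigma})$ has an anomaly of second order, let $p=\mathbf E(p_{1,\sigma}^2)$ and $q=2\,\mathbf E(p_{K,\sigma})+\mathbf E(p_{1,\sigma}\,\partial_\theta p_{1,\sigma})$, and suppose that $q(\hat\theta)\neq0$ whenever $p(\hat\theta)=0$. Let $\rho$ be the unique non-negative, normalized, continuous groundstate of the Fokker–Planck operator $\mathcal L^*=\partial_\theta(\partial_\theta p-q)$. Let $\tilde K>K$ be the index of the first $k>K$ with $\mathbf E(P_{\eta_k,\sigma})\neq0$ and $\tilde\eta=\min\{\eta_{\tilde K},\eta_1+\eta_2\}$. Then for every $f\in C^2(S^1_\pi)$, $$I_N(f)=\int_0^\pi d\theta\,f(\theta)\rho(\theta)+\mathcal O\big(\lambda^{\tilde\eta-\eta_K},(\lambda^{\eta_K}N)^{-1}\big),$$ where the error is bounded by a constant (independent of $N$) times $\lambda^{\tilde\eta-\eta_K}+(\lambda^{\eta_K}N)^{-1}$ for small $\lambda>0$. If $p$ has no zero, the same holds for every $f\in C^1(S^1_\pi)$.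
   Context: Let $(\Sigma,\mathbf p)$ be a probability space and $(T_{\lambda,\sigma})$ a family in $SL(2,\mathbb R)$ (compactly supported for small $\lambda$, with $\lambda$-dependence a power series with nonnegative exponents) such that for a fixed $M\in SL(2,\mathbb R)$: $MT_{\lambda,\sigma}M^{-1}=\pm\exp\big(\sum_{k\ge1}\lambda^{\eta_k}P_{\eta_k,\sigma}\big)$, $P_{\eta_k,\sigma}\in sl(2,\mathbb R)$, $0<\eta_1<\eta_2<\cdots$, with an index $K$ such that $\eta_K=2\eta_1$, $\eta_{K+1}\le\eta_1+\eta_2$, and $\mathbf p(P_{\eta_k,\sigma}=0)<1$ for $k<K$. Second order anomaly: $\mathbf E(P_{\eta_k,\sigma})=0$ for $k=1,\ldots,K-1$. For $P_{\eta_k,\sigma}=\begin{pmatrix}a&b\\c&-a\end{pmatrix}$ put $p_{k,\sigma}(\theta)=c\cos^2\theta-b\sin^2\theta-a\sin(2\theta)$ on $S^1_\pi=\mathbb R/\pi\mathbb Z$. A groundstate of $\mathcal L^*$ is a $\pi$-periodic solution $\rho$ of $p\rho'+(p'-q)\rho=C$ for some constant $C$, with $\int_0^\pi\rho=1$ (under the hypothesis on zeros it exists and is unique, non-negative, continuous). For $T\in SL(2,\mathbb R)$, $\mathcal S_T$ on $S^1_\pi$ is defined by $e_{\mathcal S_T(\theta)}=\pm Te_\theta/\|Te_\theta\|$, $e_\theta=(\cos\theta,\sin\theta)^T$; $\mathcal S_{\lambda,\sigma}=\mathcal S_{MT_{\lambda,\sigma}M^{-1}}$; with $(\sigma_n)$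 i.i.d. of law $\mathbf p$ and $\theta_0\in S^1_\pi$, $\theta_{n+1}=\mathcal S_{\lambda,\sigma_{n+1}}(\theta_n)$, and $I_N(f)=\frac1N\mathbf E\sum_{n=0}^{N-1}f(\theta_n)$. *)

(* Defs.v *)
From HB Require Import structures.
From mathcomp Require Import all_boot all_order all_algebra.
From mathcomp Require Import all_classical all_reals all_analysis.
Set Implicit Arguments. Unset Strict Implicit. Unset Printing Implicit Defensive.
Import Order.TTheory GRing.Theory Num.Theory.
Import numFieldNormedType.Exports.
Local Open Scope classical_set_scope.
Local Open Scope ring_scope.

Section Defs.
Variable R : realType.

Definition expm (X : 'M[R]_2) : 'M[R]_2 :=
  limn (fun n => \sum_(i < n) ((i`!)%:R^-1 *: X ^+ i)).

Definition e_theta (t : R) : 'cV[R]_2 :=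
  \col_(i < 2) (if i == ord0 then cos t else sin t).

Definition eucl_norm (v : 'cV[R]_2) : R := Num.sqrt (v 0 0 ^+ 2 + v 1 0 ^+ 2).

(* S_T on S^1_pi = R / pi Z, with values chosen in the representative
   interval [0, pi):  e_{S_T(theta)} = +- T e_theta / ||T e_theta|| *)
Definition S_T (T : 'M[R]_2) (t : R) : R :=
  xget 0 [set u | 0 <= u < pi /\ exists s : R, (s = 1 \/ s = -1) /\
      e_theta u = s *: ((eucl_norm (T *m e_theta t))^-1 *: (T *m e_theta t))].

(* p_{k,sigma}(theta) for P = [[a, b], [c, -a]] *)
Definition pk (P : 'M[R]_2) (t : R) : R :=
  P 1 0 * cos t ^+ 2 - P 0 1 * sin t ^+ 2 - P 0 0 * sin (2 * t).

Definition periodic_pi (f : R -> R) := forall x, f (x + pi) = f x.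
Definition C1_pi (f : R -> R) :=
  periodic_pi f /\ (forall x, derivable f x 1) /\ continuous (derive1 f).
Definition C2_pi (f : R -> R) :=
  periodic_pi f /\ (forall x, derivable f x 1) /\
  (forall x, derivable (derive1 f) x 1) /\ continuous (derive1 (derive1 f)).

Definition int0pi (g : R -> R) : R :=
  \int[@lebesgue_measure R]_(x in [set x : R | 0 <= x <= pi]) g x.

(* groundstate of L^* = d/dtheta (d/dtheta p - q):  a non-negative,
   continuous, pi-periodic, normalized rho with  (p rho)' - q rho = C,
   i.e.  p rho' + (p' - q) rho = C. *)
Definition groundstate (p q rho : R -> R) :=
  continuous rho /\ periodic_pi rho /\ (forall x, 0 <= rho x) /\
  int0pi rho = 1 /\
  exists C : R, forall x, derivable (fun t => p t * rho t) x 1 /\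
    derive1 (fun t => p t * rho t) x = q x * rho x + C.

Section Prob.
Context (d : measure_display) (Sig : measurableType d) (Pr : probability Sig R).

Definition Emx (X : Sig -> 'M[R]_2) : 'M[R]_2 :=
  \matrix_(i, j) (\int[Pr]_s X s i j).

Definition pfun (P : nat -> Sig -> 'M[R]_2) (t : R) : R :=
  \int[Pr]_s (pk (P 1%N s) t ^+ 2).

Definition qfun (P : nat -> Sig -> 'M[R]_2) (K : nat) (t : R) : R :=
  2 * (\int[Pr]_s pk (P K s) t) +
  \int[Pr]_s (pk (P 1%N s) t * derive1 (pk (P 1%N s)) t).

Definition psum (eta : nat -> R) (P : nat -> Sig -> 'M[R]_2) (l : R) (s : Sig)
    (n : nat) : 'M[R]_2 :=
  \sum_(1 <= k < n) (powR l (eta k) *: P k s).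

Definition abs_entries (A : 'M[R]_2) : R := \sum_(i < 2) \sum_(j < 2) `|A i j|.

(* eta_tilde = min(eta_{Ktilde}, eta_1 + eta_2), Ktilde the first k > K with
   E(P_k) <> 0; if there is no such k, eta_{Ktilde} = +oo convention *)
Definition is_eta_tilde (eta : nat -> R) (P : nat -> Sig -> 'M[R]_2) (K : nat)
    (et : R) :=
  (exists Kt : nat, (K < Kt)%N /\ Emx (P Kt) != 0 /\
     (forall k, (K < k < Kt)%N -> Emx (P k) = 0) /\
     et = Num.min (eta Kt) (eta 1%N + eta 2%N))
  \/ ((forall k, (K < k)%N -> Emx (P k) = 0) /\ et = eta 1%N + eta 2%N).

Definition Pop (T : R -> Sig -> 'M[R]_2) (M : 'M[R]_2) (l : R) (g : R -> R)
    (t : R) : R :=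
  \int[Pr]_s g (S_T (M *m T l s *m invmx M) t).

(* I_N(f) = (1/N) E sum_{n<N} f(theta_n) ; for (sigma_n) i.i.d. one has
   E f(theta_n) = (Pop^n f)(theta_0) (iterated integrals over sigma_1..sigma_n) *)
Definition I_N (T : R -> Sig -> 'M[R]_2) (M : 'M[R]_2) (l : R) (N : nat)
    (t0 : R) (f : R -> R) : R :=
  N%:R^-1 * \sum_(n < N) iter n (Pop T M l) f t0.

End Prob.
End Defs.

(* Main.v *)
(* Let [L F = (p F'' + q F') / 2], the limiting generator: for [F] of class C^3 the one-step operator
   satisfies [Pop F - F = l^eta_K * L F + O(l^eta_tilde)].  If [L F = f - c], telescoping
   along the orbit gives [I_N f - c = O((l^eta_K N)^-1 + l^(eta_tilde - eta_K))].

   Where [p] vanishes the equation [L F = f - c] is singular, so it is replaced by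
   [(p + e) u' + q u = 2 (f - c)] for [u = F'] with [e = l^(eta_tilde - eta_K)], which only adds
   an error of the admissible size.  The regularised equation has an explicit periodic solution of mean
   zero for exactly one constant [c], and what matters is that [u], [u'], [u''] are bounded uniformly
   in [e].  This follows from barriers: bounds on [u] propagate forwards across zeros of [p] with [q > 0]
   and backwards across zeros with [q < 0]; since [p] has at most two zeros per period, one starting point
   suffices, and there [u] is controlled by its vanishing mean.  The derivatives
   solve equations of the same type with [q + p'] and [q + 2 p'], and [p' = 0] where [p = 0].
   Integrating against the groundstate shows [c = int f rho + O(e)]. *)
Require Import Defs.
From HB Require Import structures.
From mathcomp Require Import all_boot all_order all_algebra.
From mathcomp Require Import all_classical all_reals all_analysis.
From mathcomp Require Import measurable_realfun ring lra.
Set Implicit Arguments. Unset Strict Implicit. Unset Printing Implicit Defensive.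
Import Order.TTheory GRing.Theory Num.Theory.
Import numFieldNormedType.Exports.
Local Open Scope classical_set_scope.
Local Open Scope ring_scope.

(** * Calculus on the real line *)

(** The constant [c] causes a circularity: it sits on the right-hand side of the equation for [u],
    so the bound on [v = u'] has the form [a + b * |c|], while pairing with the groundstate locates
    [c] only up to [e / 2] times that bound. For [e * b < 1] the term in [|c|] is absorbed, and all
    bounds become uniform. The mean-zero condition that fixes a starting value for the barriers has
    to be arranged for [u] through the choice of [c]; for [u'] and [u''] it is automatic, since they
    are derivatives of periodic functions.

    The bound of two zeros per period holds because [p] is the second moment of a random quadratic
    form in [(cos, sin)], and a form that vanishes in three directions is zero. As [eta_K = 2 eta_1]
    forces [K > 1], the case [P_1 = 0] almost surely is excluded.

    The exponent [eta_tilde] collects three errors: terms beyond [K] with nonzero mean cost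
    [eta_Ktilde], replacing second moments of the series by those of [P_1] costs [eta_1 + eta_2],
    and the Taylor remainder costs [3 eta_1], which is at least [eta_1 + eta_2] because
    [eta_2 <= eta_K]. *)

Definition has_deriv {R : realType} (f f' : R -> R) :=
  forall x : R, is_derive x 1 f (f' x).

Section Calculus.
Variable R : realType.
Implicit Types f g u v : R -> R.

Lemma hd_ext f f' g' : has_deriv f f' -> (forall x, f' x = g' x) -> has_deriv f g'.
Proof. by move=> hf e x; rewrite -e; exact: hf. Qed.

Lemma hd_eq f g f' g' : has_deriv f f' -> (forall x, f x = g x) ->
  (forall x, f' x = g' x) -> has_deriv g g'.
Proof. by move=> hf /funext <- e x; rewrite -e; exact: hf. Qed.

Lemma hd_cst (c : R) : has_deriv (fun=> c) (fun=> 0).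
Proof. by move=> x; exact: is_derive_cst. Qed.

Lemma hd_id : has_deriv (fun x : R => x) (fun=> 1).
Proof. by move=> x; exact: is_derive_id. Qed.

Lemma hdD f f' g g' : has_deriv f f' -> has_deriv g g' ->
  has_deriv (fun x => f x + g x) (fun x => f' x + g' x).
Proof. by move=> hf hg x; exact: is_deriveD. Qed.

Lemma hdN f f' : has_deriv f f' -> has_deriv (fun x => - f x) (fun x => - f' x).
Proof. by move=> hf x; exact: is_deriveN. Qed.

Lemma hdB f f' g g' : has_deriv f f' -> has_deriv g g' ->
  has_deriv (fun x => f x - g x) (fun x => f' x - g' x).
Proof. by move=> hf hg x; exact: is_deriveB. Qed.

Lemma hdM f f' g g' : has_deriv f f' -> has_deriv g g' ->
  has_deriv (fun x => f x * g x) (fun x => f' x * g x + f x * g' x).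
Proof.
move=> hf hg x; apply: is_derive_eq; first exact: is_deriveM.
by rewrite /GRing.scale /= addrC; congr (_ + _); rewrite mulrC.
Qed.

Lemma hdZ f f' (c : R) : has_deriv f f' ->
  has_deriv (fun x => c * f x) (fun x => c * f' x).
Proof.
move=> hf; apply: hd_ext; first exact: (hdM (hd_cst c) hf).
by move=> x /=; rewrite mul0r add0r.
Qed.

Lemma hd_comp f f' g g' : has_deriv f f' -> has_deriv g g' ->
  has_deriv (fun x => f (g x)) (fun x => f' (g x) * g' x).
Proof.
move=> hf hg x; apply: is_derive_eq.
  exact: (@is_derive1_comp _ f g x _ _ (hf _) (hg x)).
by rewrite ?/GRing.scale /=.
Qed.

Lemma hdV f f' : has_deriv f f' -> (forall x, f x != 0) ->
  has_deriv (fun x => (f x)^-1) (fun x => - f' x / f x ^+ 2).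
Proof.
move=> hf f0 x; apply: is_derive_eq; first exact: (@realfun.is_deriveV _ f x _ 1 (f0 x) (hf x)).
by rewrite /GRing.scale /= mulrC mulrN mulNr.
Qed.

Lemma hd_sin : has_deriv (@sin R) (@cos R).
Proof. by move=> x; exact: is_derive_sin. Qed.

Lemma hd_cos : has_deriv (@cos R) (fun x => - sin x).
Proof. by move=> x; exact: is_derive_cos. Qed.

Lemma hd_expR : has_deriv (@expR R) (@expR R).
Proof. by move=> x; exact: is_derive_expR. Qed.

Lemma hd_cont f f' : has_deriv f f' -> continuous f.
Proof.
move=> hf x; apply: differentiable_continuous.
by apply/derivable1_diffP; case: (hf x).
Qed.

Lemma hd_derive1 f f' x : has_deriv f f' -> derive1 f x = f' x.
Proof. by move=> hf; rewrite derive1E; have [_ ->] := hf x. Qed.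

Lemma hdP f : (forall x, derivable f x 1) -> has_deriv f (derive1 f).
Proof. by move=> df x; rewrite derive1E; exact: derivableP. Qed.

Lemma hd_MVT f f' (a b : R) : has_deriv f f' -> a <= b ->
  exists2 c, a <= c <= b & f b - f a = f' c * (b - a).
Proof.
move=> hf; rewrite le_eqVlt => /predU1P[<-|ab].
  by exists a; rewrite ?lexx// !subrr mulr0.
have [||c cab ->] := @MVT R f f' a b ab.
- by move=> x _; exact: hf.
- by apply: continuous_subspaceT; exact: hd_cont hf.
by exists c => //; move: cab; rewrite in_itv/= => /andP[? ?]; rewrite !ltW.
Qed.

Lemma hd_lipschitz f f' (V a b : R) : has_deriv f f' ->
  (forall x, `|f' x| <= V) -> `|f b - f a| <= V * `|b - a|.
Proof.
move=> hf fV; wlog ab : a b / a <= b => [H|].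
  have [/H//|/ltW/H] := leP a b.
  by rewrite distrC (distrC a b).
have [c _ ->] := hd_MVT hf ab.
by rewrite normrM ler_wpM2r.
Qed.

Lemma hd0_cst f (a b : R) : has_deriv f (fun=> 0) -> f a = f b.
Proof.
move=> hf; apply/eqP; rewrite -subr_eq0 -normr_le0.
have := @hd_lipschitz f _ 0 b a hf; rewrite mul0r; apply.
by move=> x; rewrite normr0.
Qed.

Lemma hd_pos_ge f f' (a b : R) : has_deriv f f' -> a <= b ->
  (forall x, a <= x <= b -> 0 <= f' x) -> f a <= f b.
Proof.
move=> hf ab H; have [c cab] := hd_MVT hf ab.
by rewrite -subr_ge0 => ->; rewrite mulr_ge0 ?H// subr_ge0.
Qed.

Lemma cts_itv_integrable g (a b : R) : continuous g ->
  (@lebesgue_measure R).-integrable `[a, b] (EFin \o g).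
Proof.
move=> cg; apply: continuous_compact_integrable; first exact: segment_compact.
exact: continuous_subspaceT.
Qed.

(** The integral over [[a, x]] is a primitive only to the right of [a]. Subtracting its value at 0
    makes it independent of [a], so the lower end can move left together with [x]. *)
Lemma antiderivative_exists g : continuous g -> exists G, has_deriv G g.
Proof.
move=> cg.
pose H a x := \int[@lebesgue_measure R]_(t in `[a, x]) g t.
pose G a x := H a x - H a 0.
have Hsplit (a b x : R) : a <= b -> b <= x -> H a x = H a b + H b x.
  move=> ab bx; have ig := cts_itv_integrable a x cg.
  apply/eqP; rewrite addrC -subr_eq; apply/eqP; rewrite /H.
  rewrite Rintegral_itvB//.
  have := @Rintegral_itv_obnd_cbnd R b (BRight x) g; apply.
  by apply: integrableS ig => //; apply: subset_itvr; rewrite bnd_simp.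
have Gind (a b x : R) : a <= b -> b <= x -> b <= 0 -> G a x = G b x.
  by move=> ab bx b0; rewrite /G (Hsplit a b x)// (Hsplit a b 0)//; ring.
have Gab (a b x : R) : a <= x -> b <= x -> a <= 0 -> b <= 0 -> G a x = G b x.
  move=> ax bx a0 b0; have [ab|/ltW ba] := leP a b.
    exact: Gind.
  by apply/esym/Gind.
exists (fun x => G (Num.min x 0 - 1) x) => x.
(* One fixed lower end to the left of all points near [x], which locally replaces the moving one. *)
set a := Num.min x 0 - 2.
have ax : a < x by rewrite /a; case: (leP x 0); lra.
have a0 : a < 0 by rewrite /a; case: (leP x 0); lra.
have dG : is_derive x 1 (G a) (g x).
  have [|//|d1 d2] := @continuous_FTC1_closed R g a x (x + 1) _ _ ax (cg x).
    by rewrite ltrDl.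
  by apply: cts_itv_integrable.
  have dH : is_derive x 1 (H a) (g x).
    by split; [exact: d1|rewrite -derive1E d2].
  have -> : G a = H a - cst (H a 0) by apply/funext.
  by apply: is_derive_eq; rewrite subr0.
apply: near_eq_is_derive dG => /=.
near=> y.
apply: Gab.
- by near: y; exact: (cvgr_ge x cvg_id).
- by case: (leP y 0); lra.
- exact: ltW.
- by case: (leP y 0); lra.
Unshelve. all: by end_near. Qed.

Lemma int0piE g G : continuous g -> has_deriv G g -> int0pi g = G pi - G 0.
Proof.
move=> cg hG; rewrite /int0pi.
have -> : [set x : R | 0 <= x <= pi] = `[0, pi]%classic.
  by apply/seteqP; split => x /=; rewrite in_itv.
rewrite /Rintegral (@continuous_FTC2 R g G 0 pi)//; first exact: pi_gt0.
- exact: continuous_subspaceT.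
- split; first by move=> x _; case: (hG x).
  + by apply: cvg_at_right_filter; exact: hd_cont hG _.
  + by apply: cvg_at_left_filter; exact: hd_cont hG _.
- by move=> x _; exact: hd_derive1.
Qed.

Lemma ctsD f g : continuous f -> continuous g -> continuous (fun x => f x + g x).
Proof. by move=> cf cg x; apply: continuousD; [exact: cf|exact: cg]. Qed.

Lemma ctsN f : continuous f -> continuous (fun x => - f x).
Proof. by move=> cf x; apply: continuousN; exact: cf. Qed.

Lemma ctsB f g : continuous f -> continuous g -> continuous (fun x => f x - g x).
Proof. by move=> cf cg x; apply: continuousB; [exact: cf|exact: cg]. Qed.

Lemma ctsM f g : continuous f -> continuous g -> continuous (fun x => f x * g x).
Proof. by move=> cf cg x; apply: continuousM; [exact: cf|exact: cg]. Qed.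

Lemma ctsC (c : R) : continuous (fun _ : R => c).
Proof. by move=> x; exact: cst_continuous. Qed.

Lemma ctsV f : continuous f -> (forall x, f x != 0) -> continuous (fun x => (f x)^-1).
Proof. by move=> cf f0 x; apply: continuousV; [exact: f0|exact: cf]. Qed.

Lemma cts_comp f g : continuous f -> continuous g -> continuous (fun x => f (g x)).
Proof. by move=> cf cg x; apply: continuous_comp; [exact: cg|exact: cf]. Qed.

Lemma antiderivative0 g : continuous g -> exists2 G, has_deriv G g & G 0 = 0.
Proof.
move=> /antiderivative_exists[G hG]; exists (fun x => G x - G 0); last exact: subrr.
by apply: hd_ext (hdB hG (hd_cst _)) _ => x /=; rewrite subr0.
Qed.

Lemma hd_pos_gt f f' (a b : R) : has_deriv f f' -> a < b ->
  (forall x, a <= x <= b -> 0 < f' x) -> f a < f b.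
Proof.
move=> hf ab H; have [c cab] := hd_MVT hf (ltW ab).
by rewrite -subr_gt0 => ->; rewrite mulr_gt0 ?H// subr_gt0.
Qed.

End Calculus.

(** * The regularised Poisson equation *)

Section ODE.
Variable R : realType.
Implicit Types f g u v : R -> R.

(* Periodicity and vanishing mean of [W * (u0 + 2 Jf - 2 c J1)] as equations for [c] and [u0], where
   [w = W pi], [J = J1 pi], and [A], [B], [D] are the integrals of [W], [W J1], [W Jf]. *)
Lemma periodic_ode_consts (w A B J : R) : 0 < w -> 0 < A -> 0 < J -> 0 <= B ->
  B <= A * J -> forall Jf D, exists c u0 : R,
  w * (u0 + 2 * Jf - 2 * c * J) = u0 /\ u0 * A + 2 * D - 2 * c * B = 0.
Proof.
move=> w0 A0 J0 B0 Ble Jf D.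
(* The determinant of the linear system in [c] and [u0]. For [w > 1] the bound [B <= A * J] leaves
   at most [- A * J]. *)
have Dn : (w - 1) * B - A * w * J < 0.
  have WA : 0 < A * w * J by rewrite !mulr_gt0.
  have AJ : 0 < A * J by rewrite mulr_gt0.
  have [W1|W1] := leP w 1.
    have : (w - 1) * B <= 0 by rewrite mulr_le0_ge0// subr_le0.
    by lra.
  have : (w - 1) * B <= (w - 1) * (A * J) by rewrite ler_wpM2l// subr_ge0 ltW.
  by lra.
have Dn0 : (w - 1) * B - A * w * J != 0 by rewrite lt_eqF.
have A0n : A != 0 by rewrite gt_eqF.
pose c := ((w - 1) * D - A * w * Jf) / ((w - 1) * B - A * w * J).
exists c, ((2 * c * B - 2 * D) / A); split; rewrite /c; field; rewrite ?Dn0 ?A0n//.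
Qed.

(** Variation of constants: [W] solves the homogeneous equation, and [u = W * (u0 + 2 Jf - 2 c J1)]
    with [Jf], [J1] the primitives of [f / (P W)] and [1 / (P W)]. The two free numbers [u0] and [c]
    are spent on periodicity and on vanishing mean. *)
Lemma periodic_ode_exists (P q f : R -> R) :
  continuous P -> continuous q -> continuous f ->
  periodic_pi P -> periodic_pi q -> periodic_pi f -> (forall x, 0 < P x) ->
  exists u U c, [/\ has_deriv u (fun x => (2 * (f x - c) - q x * u x) / P x),
    periodic_pi u, has_deriv U u & U pi = U 0].
Proof.
move=> cP cq cf pP pq pf P0.
have pi0 : (0 : R) < pi := @pi_gt0 R.
have Pn x : P x != 0 by rewrite gt_eqF.
have [Q hQ Q0] := antiderivative0 (ctsM cq (ctsV cP Pn)).
have [W [hW W0 W_0]] : exists W, [/\ has_deriv W (fun x => - (q x / P x) * W x),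
    forall x, 0 < W x & W 0 = 1].
  exists (fun x => expR (- Q x)); split=> [|x|]; last by rewrite Q0 oppr0 expR0.
    by apply: (hd_ext (hd_comp (@hd_expR R) (hdN hQ))) => x; rewrite mulrC.
  exact: expR_gt0.
have Wn x : W x != 0 by rewrite gt_eqF.
have cW := hd_cont hW.
have cPW : continuous (fun x => (P x * W x)^-1).
  by apply: ctsV; [exact: ctsM|move=> x; rewrite mulf_neq0].
have [Jf hJf Jf0] := antiderivative0 (ctsM cf cPW).
have [J1 hJ1 J10] := antiderivative0 cPW.
have [SA hA A0] := antiderivative0 cW.
have [SB hB B0] := antiderivative0 (ctsM cW (hd_cont hJ1)).
have [SD hD D0] := antiderivative0 (ctsM cW (hd_cont hJf)).
have PW0 x : 0 < (P x * W x)^-1 by rewrite invr_gt0 mulr_gt0.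
have Agt : 0 < SA pi by rewrite -A0; apply: hd_pos_gt hA _ _ => // x _.
have J1gt : 0 < J1 pi by rewrite -[X in X < _]J10; apply: hd_pos_gt hJ1 _ _ => // x _.
have Bge : 0 <= SB pi.
  rewrite -[X in X <= _]B0; apply: hd_pos_ge hB _ _ => [|x /andP[x0 _]]; first exact: ltW.
  apply: mulr_ge0; first exact: ltW.
  by rewrite -[X in X <= _]J10; apply: hd_pos_ge hJ1 _ _ => // y _; exact: ltW.
(* [J1] is increasing, so [J1 pi] dominates it inside the integral of [W * J1]. *)
have Ble : SB pi <= SA pi * J1 pi.
  have h : has_deriv (fun x => SA x * J1 pi - SB x) (fun x => W x * (J1 pi - J1 x)).
    by apply: (hd_ext (hdB (hdM hA (hd_cst _)) hB)) => x /=; ring.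
  have := hd_pos_ge h (ltW pi0); rewrite A0 B0 mul0r subr0 subr_ge0; apply.
  move=> x /andP[x0 xp]; apply: mulr_ge0; first exact: ltW.
  by rewrite subr_ge0; apply: hd_pos_ge hJ1 _ _ => // y _; exact: ltW.
have [c [u0 [Eu Ec]]] := periodic_ode_consts (W0 pi) Agt J1gt Bge Ble (Jf pi) (SD pi).
pose u x := W x * (u0 + 2 * Jf x - 2 * c * J1 x).
pose U x := u0 * SA x + 2 * SD x - 2 * c * SB x.
have hu : has_deriv u (fun x => (2 * (f x - c) - q x * u x) / P x).
  have h := hdM hW (hdB (hdD (hd_cst u0) (hdZ 2 hJf)) (hdZ (2 * c) hJ1)).
  by apply: (hd_ext h) => x; rewrite /u /=; field; rewrite Pn Wn.
have uper : u pi = u 0 by rewrite /u W_0 Jf0 J10 Eu; ring.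
exists u, U, c; split => //.
(* The difference [u (x + pi) - u x] solves the homogeneous equation, hence is a constant multiple
   of [W], and it vanishes at 0. *)
- have ps : has_deriv (fun x : R => x + pi) (fun=> 1).
    by apply: (hd_ext (hdD (@hd_id R) (hd_cst _))) => x /=; rewrite addr0.
  have hd := hdM (hdB (hd_comp hu ps) hu) (hdV hW Wn).
  move=> x; apply/eqP; rewrite -subr_eq0.
  rewrite -(mulIr_eq0 _ (@mulIf _ (W x)^-1 _)) ?invr_neq0//.
  have -> : (u (x + pi) - u x) * (W x)^-1 = (u (0 + pi) - u 0) * (W 0)^-1.
    apply: (@hd0_cst _ (fun x => (u (x + pi) - u x) * (W x)^-1)).
    by apply: (hd_ext hd) => y /=; rewrite pP pq pf; field; rewrite Wn Pn.
  by rewrite add0r uper subrr mul0r.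
- have h := hdB (hdD (hdZ u0 hA) (hdZ 2 hD)) (hdZ (2 * c) hB).
  by apply: (hd_ext h) => x; rewrite /u /=; ring.
- by rewrite /U A0 D0 B0 Ec; ring.
Qed.

End ODE.

(** * A priori bounds by barriers, uniform in the regularisation *)

Section Apriori.
Variable R : realType.
Implicit Types f g u v p q h P : R -> R.

Lemma pos_deriv_right w w' (s b : R) : has_deriv w w' -> w s = 0 -> 0 < w' s ->
  s < b -> exists2 y, s < y < b & 0 < w y.
Proof.
move=> hw ws w's sb.
have [dw Dw] := hw s.
have : (t^-1 *: (w (t *: 1 + s) - w s)) @[t --> 0^'] --> w' s.
  by rewrite -Dw; exact: dw.
move=> /cvgr_gt /(_ _ w's) [e /= e0 He].
pose t := Num.min (e / 2) ((b - s) / 2).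
have t0 : 0 < t by rewrite lt_min !divr_gt0// subr_gt0.
have te : t <= e / 2 by rewrite ge_min lexx.
have tb : t <= (b - s) / 2 by rewrite ge_min lexx orbT.
exists (t + s); first by lra.
have := He t; rewrite /ball_ /= sub0r normrN gtr0_norm//.
have te' : t < e by lra.
move=> /(_ te' (lt0r_neq0 t0)); rewrite ws subr0.
by rewrite /GRing.scale /= mulr1 pmulr_rgt0// invr_gt0.
Qed.

(** At the last point [s] before [x1] where [w] is still non-negative, continuity gives [w s = 0];
    the positive derivative there pushes [w] above 0 again, a contradiction. *)
Lemma barrier w w' (a b : R) : has_deriv w w' -> 0 <= w a ->
  (forall x, a <= x <= b -> w x = 0 -> 0 < w' x) ->
  forall x, a <= x <= b -> 0 <= w x.
Proof.
move=> hw wa H x1 /andP[ax1 x1b]; rewrite leNgt; apply/negP => wx1.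
pose S := [set y : R | a <= y <= x1 /\ 0 <= w y].
have Sa : S a by split => //; rewrite lexx.
have ubS : ubound S x1 by move=> y [/andP[]].
have hS : has_sup S by split; [exists a|exists x1].
pose s := sup S.
have as_ : a <= s by apply: ub_le_sup => //; exists x1.
have sx1 : s <= x1 by apply: ge_sup => //; exists a.
have cw := hd_cont hw.
have ws0 : 0 <= w s.
  rewrite leNgt; apply/negP => ws.
  have [e /= e0 He] := cvgr_lt _ (cw s) _ ws.
  have [y Sy sy] := sup_adherent e0 hS.
  have ys : y <= s by apply: ub_le_sup => //; exists x1.
  have := He y; rewrite /ball_ /= ger0_norm ?subr_ge0//.
  move=> /(_ _)/wrap[|]; first by rewrite /s; lra.
  by case: Sy => _; rewrite leNgt => /negbTE ->.
have sltx1 : s < x1.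
  by rewrite lt_neqAle sx1 andbT; apply: contraTneq ws0 => ->; rewrite -ltNge.
have noS y : s < y <= x1 -> w y < 0.
  move=> /andP[sy yx1]; rewrite ltNge; apply/negP => wy.
  have : y <= s.
    by apply: ub_le_sup; [exists x1|split => //; rewrite yx1 (le_trans as_)// ltW].
  by rewrite leNgt sy.
have ws : w s = 0.
  apply/eqP; rewrite eq_le ws0 andbT leNgt; apply/negP => ws.
  have [e /= e0 He] := cvgr_gt _ (cw s) _ ws.
  pose y := Num.min (s + e / 2) x1.
  have sy : s < y by rewrite lt_min sltx1 andbT; lra.
  have yx : y <= x1 by rewrite ge_min lexx orbT.
  have ye : y <= s + e / 2 by rewrite ge_min lexx.
  have := He y; rewrite /ball_ /= distrC gtr0_norm ?subr_gt0//.
  move=> /(_ _)/wrap[|]; first lra.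
  by rewrite ltNge ltW// noS// sy.
have w's : 0 < w' s by apply: H => //; rewrite as_ (le_trans sx1).
have [y /andP[sy yx] wy] := pos_deriv_right hw ws w's sltx1.
by have := noS y; rewrite sy ltW// => /(_ isT); rewrite ltNge ltW.
Qed.

Section Linear.
Variables (m Qs : R).
Hypothesis m0 : 0 < m.
Let kappa := 2 + Qs / m.

(* The barrier [- L exp (kappa (x - a))] is crossed upwards only: where [q >= m] the drift already
   pushes [u] back towards 0, and where [P >= m] the rate [kappa] beats [(|h| + |q| |u|) / P]. *)
Lemma propagate_forward P q h u u' (a b H L : R) :
  has_deriv u u' -> (forall x, 0 < P x) -> (forall x, P x * u' x + q x * u x = h x) ->
  (forall x, `|q x| <= Qs) -> (forall x, `|h x| <= H) -> 0 < L -> H <= m * L ->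
  (forall x, a <= x <= b -> m <= P x \/ m <= q x) -> - L <= u a ->
  forall x, a <= x <= b -> - (L * expR (kappa * (b - a))) <= u x.
Proof.
move=> hu P0 E qQ hH L0 HL Hpq ua x /andP[ax xb].
have Q0 : 0 <= Qs by apply: le_trans (qQ 0).
have k0 : 0 < kappa by rewrite /kappa; have : 0 <= Qs / m := divr_ge0 Q0 (ltW m0); lra.
pose phi x := L * expR (kappa * (x - a)).
have hphi : has_deriv phi (fun x => kappa * phi x).
  have h1 := hdZ kappa (hdB (@hd_id R) (hd_cst a)).
  apply: (hd_ext (hdZ L (hd_comp (@hd_expR R) h1))) => y.
  by rewrite /phi; ring.
have phi_le : phi x <= L * expR (kappa * (b - a)).
  by rewrite ler_pM2l// ler_expR ler_pM2l// lerB.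
have phiL y : a <= y -> L <= phi y.
  move=> ay; rewrite -[leLHS]mulr1 ler_pM2l// -expR0 ler_expR.
  by rewrite mulr_ge0 ?subr_ge0// ltW.
suff : 0 <= u x + phi x by lra.
apply: (@barrier _ _ a b (hdD hu hphi)) => [|y /andP[ay yb] uy|].
- by rewrite /phi subrr mulr0 expR0 mulr1; lra.
- have yphi := phiL y ay.
  have phi0 : 0 < phi y := lt_le_trans L0 yphi.
  have uyE : u y = - phi y by lra.
  have := E y; rewrite uyE => Ey.
  have : 0 < P y * (u' y + kappa * phi y); last by rewrite pmulr_rgt0.
  rewrite mulrDr.
  have := hH y; rewrite ler_norml => /andP[hy _].
  have := qQ y; rewrite ler_norml => /andP[_ qy].
  have kphi : 0 < kappa * phi y by exact: mulr_gt0.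
  have kP : 0 < P y * (kappa * phi y) by exact: mulr_gt0.
  have mphi : m * L <= m * phi y by rewrite ler_pM2l.
  have [Pm|qm] : m <= P y \/ m <= q y by apply: Hpq; rewrite ay.
    have h1 : m * (kappa * phi y) <= P y * (kappa * phi y).
      by rewrite ler_pM2r.
    have h2 : m * (kappa * phi y) = 2 * (m * phi y) + Qs * phi y.
      by rewrite /kappa; field; rewrite gt_eqF.
    have h3 : - q y * phi y <= Qs * phi y.
      rewrite ler_wpM2r//; first exact: ltW.
      by have := qQ y; rewrite ler_norml => /andP[? _]; lra.
    have h4 : 0 < m * phi y by exact: mulr_gt0.
    by lra.
  have h3 : m * phi y <= q y * phi y.
    by rewrite ler_wpM2r// ltW.
  by lra.
- by rewrite ax.
Qed.

Lemma hd_opp_arg u u' : has_deriv u u' -> has_deriv (fun x => u (- x)) (fun x => - u' (- x)).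
Proof. by move=> hu; apply: (hd_ext (hd_comp hu (hdN (@hd_id R)))) => x; ring. Qed.

(** The reflection [x -> - x] preserves the form of the equation and changes the signs of [q] and
    [h]. *)
Lemma propagate_backward P q h u u' (a b H L : R) :
  has_deriv u u' -> (forall x, 0 < P x) -> (forall x, P x * u' x + q x * u x = h x) ->
  (forall x, `|q x| <= Qs) -> (forall x, `|h x| <= H) -> 0 < L -> H <= m * L ->
  (forall x, a <= x <= b -> m <= P x \/ m <= - q x) -> - L <= u b ->
  forall x, a <= x <= b -> - (L * expR (kappa * (b - a))) <= u x.
Proof.
move=> hu P0 E qQ hH L0 HL Hpq ub x axb.
rewrite -[x]opprK; have -> : b - a = - a - - b by ring.
apply: (@propagate_forward (fun x => P (- x)) (fun x => - q (- x)) (fun x => - h (- x))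
  (fun x => u (- x)) _ (- b) (- a) H L (hd_opp_arg hu)) => //.
- by move=> y; rewrite -E; ring.
- by move=> y; rewrite normrN.
- by move=> y; rewrite normrN.
- by move=> y ?; apply: Hpq; lra.
- by rewrite opprK.
- by lra.
Qed.

Variables c1 c2 delta : R.
Hypothesis c21 : c2 <= c1.
Hypothesis c12 : c1 <= c2 + pi.
Hypothesis delta0 : 0 < delta.
Hypothesis deltapi : delta <= pi.
Let E0 := expR (kappa * pi).

(** By periodicity the value at [c2] is known at both ends of [[c2, c2 + pi]]: it is carried
    forwards from [c2] and backwards from [c2 + pi], and both reach [c1]. *)
Lemma propagate_period P q h u u' (H L : R) :
  has_deriv u u' -> (forall x, 0 < P x) -> (forall x, P x * u' x + q x * u x = h x) ->
  (forall x, `|q x| <= Qs) -> (forall x, `|h x| <= H) -> 0 < L -> H <= m * L ->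
  (forall x, c2 <= x <= c1 -> m <= P x \/ m <= q x) ->
  (forall x, c1 <= x <= c2 + pi -> m <= P x \/ m <= - q x) ->
  periodic_pi u -> - L <= u c2 ->
  forall x, c2 <= x <= c2 + pi -> - (L * E0) <= u x.
Proof.
move=> hu P0 E qQ hH L0 HL Hf Hb pu uc x /andP[cx xc].
have [c21' c12'] := conj c21 c12.
have Q0 : 0 <= Qs by apply: le_trans (qQ 0).
have k0 : 0 < kappa by rewrite /kappa; have : 0 <= Qs / m := divr_ge0 Q0 (ltW m0); lra.
have LE (d : R) : d <= pi -> - (L * E0) <= - (L * expR (kappa * d)).
  by move=> d0; rewrite lerN2 ler_pM2l// ler_expR ler_pM2l.
have [xc1|/ltW c1x] := leP x c1.
  apply: le_trans (propagate_forward hu P0 E qQ hH L0 HL Hf uc _); last by rewrite cx.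
- by apply: LE; lra.
apply: le_trans (propagate_backward hu P0 E qQ hH L0 HL Hb _ _).
- by apply: LE; lra.
- by rewrite pu.
- by rewrite c1x.
Qed.

(** A very large [u c2] would keep [u] large on the whole window [[c2, c2 + delta]], where [P >= m];
    since [u >= - L * E0] on the rest of the period, the mean of [u] would be positive. *)
Lemma mean_zero_bound_at P q h u u' U (H L : R) :
  has_deriv u u' -> (forall x, 0 < P x) -> (forall x, P x * u' x + q x * u x = h x) ->
  (forall x, `|q x| <= Qs) -> (forall x, `|h x| <= H) -> 0 < L -> H <= m * L ->
  (forall x, c2 <= x <= c1 -> m <= P x \/ m <= q x) ->
  (forall x, c1 <= x <= c2 + pi -> m <= P x \/ m <= - q x) ->
  (forall x, c2 <= x <= c2 + delta -> m <= P x) ->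
  periodic_pi u -> has_deriv U u -> periodic_pi U ->
  u c2 <= pi / delta * L * E0 ^+ 2.
Proof.
move=> hu P0 E qQ hH L0 HL Hf Hb Hd pu hU pU.
rewrite leNgt; apply/negP => ubig.
have [d0 dpi m0'] := And3 delta0 deltapi m0.
have Q0 : 0 <= Qs by apply: le_trans (qQ 0).
have k0 : 0 < kappa by rewrite /kappa; have : 0 <= Qs / m := divr_ge0 Q0 (ltW m0); lra.
have pi0 : (0 : R) < pi := pi_gt0 R.
have E01 : 1 <= E0 by rewrite -expR0 ler_expR mulr_ge0// ltW.
have E0p : 0 < E0 by exact: expR_gt0.
(* Chosen so that [L2 * delta = L * E0 * pi] outweighs the largest possible negative contribution
   [L * E0 * (pi - delta)]. *)
pose L2 := pi / delta * L * E0.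
have pd : 1 <= pi / delta by rewrite ler_pdivlMr// mul1r.
have LE : L <= L * E0 by rewrite ler_peMr// ltW.
have LL2 : L <= L2.
  apply: (le_trans LE); rewrite /L2 -mulrA ler_peMl// mulr_ge0// ltW//.
have L20 : 0 < L2 by exact: lt_le_trans LL2.
have uL2 : L2 * E0 < u c2 by rewrite /L2 -mulrA -expr2.
have HL2 : H <= m * L2 by apply: (le_trans HL); rewrite ler_pM2l.
have L2E : 0 < L2 * E0 by rewrite mulr_gt0.
have low x : c2 <= x <= c2 + pi -> - (L * E0) <= u x.
  by apply: (propagate_period hu P0 E qQ hH L0 HL Hf Hb pu); lra.
(* If [u] fell below [L2] at [x], carrying this upper bound back to [c2] would give
   [u c2 <= L2 * E0]. Any sign of [q] is allowed here because [P >= m] on the window. *)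
have high x : c2 <= x <= c2 + delta -> L2 <= u x.
  move=> /andP[cx xd]; rewrite leNgt; apply/negP => ux.
  have EN y : P y * (- u' y) + q y * (- u y) = - h y by rewrite -E; ring.
  have hHN y : `|- h y| <= H by rewrite normrN.
  have HbN y : c2 <= y <= x -> m <= P y \/ m <= - q y.
    by move=> /andP[? ?]; left; apply: Hd; lra.
  have uN : - L2 <= - u x by rewrite lerN2 ltW.
  have := @propagate_backward P q _ _ _ c2 x H L2 (hdN hu) P0 EN qQ hHN L20 HL2 HbN uN c2.
  rewrite lexx cx => /(_ isT).
  have : L2 * expR (kappa * (x - c2)) <= L2 * E0.
    by rewrite ler_pM2l// ler_expR ler_pM2l//; lra.
  by lra.
have I1 : L2 * delta <= U (c2 + delta) - U c2.
  have h1 := hdB hU (hdZ L2 (@hd_id R)).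
  have h2 : c2 <= c2 + delta by lra.
  have := hd_pos_ge h1 h2 => /(_ _)/wrap[x /high|]; lra.
have I2 : - (L * E0) * (pi - delta) <= U (c2 + pi) - U (c2 + delta).
  have h1 := hdB hU (hdZ (- (L * E0)) (@hd_id R)).
  have h2 : c2 + delta <= c2 + pi by lra.
  have := hd_pos_ge h1 h2 => /(_ _)/wrap[x xx|].
    by have := low x => /(_ _)/wrap[|]; lra.
  by lra.
have : L2 * delta = L * E0 * pi by rewrite /L2; field; rewrite gt_eqF.
have : 0 < L * E0 * delta by rewrite !mulr_gt0.
by rewrite pU in I2; lra.
Qed.

End Linear.

Lemma periodic_nat f : periodic_pi f -> forall (n : nat) x, f (x + n%:R * pi) = f x.
Proof.
move=> pf; elim=> [|n IH] x; first by rewrite mul0r addr0.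
by rewrite -[RHS]IH -[RHS]pf -natr1; congr (f _); ring.
Qed.

Lemma periodic_int f : periodic_pi f -> forall (n : int) x, f (x + n%:~R * pi) = f x.
Proof.
move=> pf [n|n] x; first exact: periodic_nat.
by rewrite -[LHS](periodic_nat pf n.+1) NegzE mulrNz; congr (f _); ring.
Qed.

Lemma periodic_reduce (a x : R) : exists2 n : int, True & a <= x + n%:~R * pi < a + pi.
Proof.
have pi0 : (0 : R) < pi := pi_gt0 R.
exists (- Num.floor ((x - a) / pi)) => //.
have := real_floor_itv (num_real ((x - a) / pi)).
rewrite mulrNz intrD ler_pdivlMr// ltr_pdivrMr// => /andP[h1 h2].
by rewrite mulrDl mul1r in h2; lra.
Qed.

Lemma periodic_all (Q : R -> Prop) f (a : R) : periodic_pi f ->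
  (forall x, a <= x <= a + pi -> Q (f x)) -> forall x, Q (f x).
Proof.
move=> pf H x; have [n _ /andP[h1 h2]] := periodic_reduce a x.
by rewrite -(periodic_int pf n); apply: H; rewrite h1 ltW.
Qed.

Lemma periodic_primitive U u : has_deriv U u -> periodic_pi u -> U pi = U 0 -> periodic_pi U.
Proof.
move=> hU pu U0 x.
have ps : has_deriv (fun x : R => x + pi) (fun=> 1).
  by apply: (hd_ext (hdD (@hd_id R) (hd_cst _))) => y /=; rewrite addr0.
have hd : has_deriv (fun x => U (x + pi) - U x) (fun=> 0).
  by apply: (hd_ext (hdB (hd_comp hU ps) hU)) => y; rewrite pu; ring.
have := hd0_cst x 0 hd; rewrite add0r U0 subrr => /eqP.
by rewrite subr_eq0 => /eqP.
Qed.

Lemma periodic_deriv u u' : has_deriv u u' -> periodic_pi u -> periodic_pi u'.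
Proof.
move=> hu pu x.
have ps : has_deriv (fun x : R => x + pi) (fun=> 1).
  by apply: (hd_ext (hdD (@hd_id R) (hd_cst _))) => y /=; rewrite addr0.
have h1 : has_deriv u (fun x => u' (x + pi)).
  by apply: (hd_eq (hd_comp hu ps)) => y; [exact: pu|rewrite mulr1].
by rewrite -(hd_derive1 x h1) -(hd_derive1 x hu).
Qed.

Lemma periodic_bounded f : continuous f -> periodic_pi f ->
  exists2 B : R, 0 <= B & forall x, `|f x| <= B.
Proof.
move=> cf pf.
have [|c _ Hc] := @EVT_max R (fun x => `|f x|) 0 pi (ltW (pi_gt0 R)).
  apply: continuous_subspaceT => x.
  by apply: continuous_comp; [exact: cf|exact: norm_continuous].
exists `|f c| => //; apply: (periodic_all (Q := fun y => `|y| <= `|f c|) (a := 0) pf).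
by move=> x; rewrite add0r => x0; apply: Hc; rewrite in_itv.
Qed.

(* No lower bound on [P] is needed near its zeros, so this is uniform in the regularisation. *)
Lemma mean_zero_apriori (m Qs c1 c2 delta : R) : 0 < m -> 0 <= Qs -> c2 <= c1 ->
  c1 <= c2 + pi -> 0 < delta -> delta <= pi ->
  exists2 C : R, 0 <= C & forall P q h u u' U (H : R),
  has_deriv u u' -> (forall x, 0 < P x) -> (forall x, P x * u' x + q x * u x = h x) ->
  (forall x, `|q x| <= Qs) -> 0 <= H -> (forall x, `|h x| <= H) ->
  (forall x, c2 <= x <= c1 -> m <= P x \/ m <= q x) ->
  (forall x, c1 <= x <= c2 + pi -> m <= P x \/ m <= - q x) ->
  (forall x, c2 <= x <= c2 + delta -> m <= P x) ->
  periodic_pi u -> has_deriv U u -> periodic_pi U ->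
  forall x, `|u x| <= C * (H + 1).
Proof.
move=> m0 Q0 c21 c12 d0 dpi.
set E0 := expR ((2 + Qs / m) * pi).
have pi0 : (0 : R) < pi := pi_gt0 R.
have E01 : 1 <= E0.
  by rewrite -expR0 ler_expR mulr_ge0 ?ltW// ltr_wpDr// divr_ge0// ltW.
have E0p : 0 < E0 by exact: expR_gt0.
have pd : 1 <= pi / delta by rewrite ler_pdivlMr// mul1r.
(* Two factors [E0] bound the value at [c2]; the third carries this bound around the period. *)
exists (pi / delta * E0 ^+ 3 / m).
  by rewrite !mulr_ge0 ?exprn_ge0 ?invr_ge0// ltW.
move=> P q h u u' U H hu P0 E qQ H0 hH Hf Hb Hd pu hU pU.
(* The summand 1 keeps [L] positive when [H = 0]; this is why [H + 1] appears in the bound. *)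
pose L := (H + 1) / m.
have L0 : 0 < L by rewrite divr_gt0//; lra.
have HL : H <= m * L by rewrite /L mulrCA divff ?gt_eqF// mulr1; lra.
have b1 := mean_zero_bound_at m0 c21 c12 d0 dpi hu P0 E qQ hH L0 HL Hf Hb Hd pu hU pU.
have EN y : P y * (- u' y) + q y * (- u y) = - h y by rewrite -E; ring.
have hHN y : `|- h y| <= H by rewrite normrN.
have puN : periodic_pi (fun x => - u x) by move=> x; rewrite pu.
have pUN : periodic_pi (fun x => - U x) by move=> x; rewrite pU.
have b2 := mean_zero_bound_at m0 c21 c12 d0 dpi (hdN hu) P0 EN qQ hHN L0 HL Hf Hb Hd puN (hdN hU) pUN.
set L3 := pi / delta * L * _ in b1 b2.
have LL3 : L <= L3.
  have h1 : L <= pi / delta * L by rewrite ler_peMl// ltW.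
  apply: (le_trans h1); rewrite /L3 ler_peMr ?exprn_ege1//.
  exact: le_trans (ltW L0) h1.
have L30 : 0 < L3 := lt_le_trans L0 LL3.
have HL3 : H <= m * L3 by apply: (le_trans HL); rewrite ler_pM2l.
have CE : pi / delta * E0 ^+ 3 / m * (H + 1) = L3 * E0.
  by rewrite /L3 /L -/E0; field; rewrite !gt_eqF.
rewrite CE.
apply: (periodic_all (Q := fun y => `|y| <= L3 * E0) (a := c2) pu) => x cx.
rewrite ler_norml; apply/andP; split.
  by apply: (propagate_period m0 c21 c12 hu P0 E qQ hH L30 HL3 Hf Hb pu) => //; lra.
rewrite -lerN2.
by apply: (propagate_period m0 c21 c12 (hdN hu) P0 EN qQ hHN L30 HL3 Hf Hb puN) => //; lra.
Qed.

End Apriori.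

Section Poisson.
Variable R : realType.
Implicit Types f g u v w p q h U : R -> R.

Lemma max_pos_lower_bound p q (a b : R) : continuous p -> continuous q -> a <= b ->
  (forall x, a <= x <= b -> 0 < p x \/ 0 < q x) ->
  exists2 m : R, 0 < m & forall x, a <= x <= b -> m <= p x \/ m <= q x.
Proof.
move=> cp cq ab H.
have [|c] := @EVT_min R (fun x => Num.max (p x) (q x)) a b ab.
  apply: continuous_subspaceT => x; apply: continuous_max; [exact: cp|exact: cq].
rewrite in_itv/= => cab Hc; exists (Num.max (p c) (q c)).
  by rewrite lt_max; case: (H c cab) => ->; rewrite ?orbT.
move=> x xab; have : Num.max (p c) (q c) <= Num.max (p x) (q x).
  by apply: Hc; rewrite in_itv.
by rewrite le_max => /orP[|]; [left|right].
Qed.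

Lemma cts_pos_right p (a M : R) : continuous p -> 0 < p a -> 0 < M ->
  exists2 d : R, 0 < d <= M & forall x, a <= x <= a + d -> p a / 2 <= p x.
Proof.
move=> cp pa M0; have pa2 : p a / 2 < p a by lra.
have [e /= e0 He] := cvgr_gt _ (cp a) _ pa2.
exists (Num.min (e / 2) M).
  by rewrite lt_min M0 divr_gt0// ge_min lexx orbT.
move=> x /andP[ax xd]; apply: ltW; apply: He; rewrite /ball_ /= distrC ger0_norm ?subr_ge0//.
have : Num.min (e / 2) M <= e / 2 by rewrite ge_min lexx.
lra.
Qed.

(** The lower bounds [m] come from [p] and [q] alone by compactness, and [p + e >= p] only improves
    them, so one constant serves all [e > 0]. *)
Lemma regularized_apriori p q (c1 c2 : R) : continuous p -> continuous q -> periodic_pi q ->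
  (forall x, 0 <= p x) -> c2 <= c1 -> c1 <= c2 + pi -> 0 < p c2 ->
  (forall x, c2 <= x <= c1 -> p x = 0 -> 0 < q x) ->
  (forall x, c1 <= x <= c2 + pi -> p x = 0 -> q x < 0) ->
  exists2 C : R, 0 <= C & forall (e : R) h u u' U (H : R), 0 < e -> has_deriv u u' ->
    (forall x, (p x + e) * u' x + q x * u x = h x) -> 0 <= H ->
    (forall x, `|h x| <= H) -> periodic_pi u -> has_deriv U u -> periodic_pi U ->
    forall x, `|u x| <= C * (H + 1).
Proof.
move=> cp cq pq p0 c21 c12 pc2 Hf Hb.
have [Qs Q0 HQ] := periodic_bounded cq pq.
have pn x : 0 < p x \/ p x = 0.
  by have := p0 x; rewrite le_eqVlt => /predU1P[<-|]; [right|left].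
have [|m1 m10 H1] := max_pos_lower_bound cp cq c21.
  by move=> x /Hf Hx; case: (pn x); [left|right; apply: Hx].
have [|m2 m20 H2] := max_pos_lower_bound cp (ctsN cq) c12.
  by move=> x /Hb Hx; case: (pn x); [left|right; rewrite oppr_gt0; apply: Hx].
have [d /andP[d0 dpi] Hd] := cts_pos_right cp pc2 (pi_gt0 R).
pose m := Num.min (Num.min m1 m2) (p c2 / 2).
have mm1 : m <= m1 by rewrite /m !ge_min lexx.
have mm2 : m <= m2 by rewrite /m !ge_min lexx orbT.
have mmp : m <= p c2 / 2 by rewrite /m !ge_min lexx orbT.
have m0 : 0 < m by rewrite !lt_min m10 m20 divr_gt0.
have [C C0 HC] := mean_zero_apriori m0 Q0 c21 c12 d0 dpi.
exists C => // e h u u' U H e0 hu E H0 hH pu hU pU.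
have pe x : p x <= p x + e by rewrite lerDl ltW.
apply: (HC (fun x => p x + e) q h u u' U H hu) => //.
- by move=> x; apply: ltr_wpDl.
- by move=> x /H1[]; [left|right] => //; [apply: le_trans (pe x)|]; exact: le_trans mm1 _.
- by move=> x /H2[]; [left|right] => //; [apply: le_trans (pe x)|]; exact: le_trans mm2 _.
- by move=> x /Hd h1; apply: le_trans (pe x); exact: le_trans mmp _.
Qed.

Lemma hd_at_min p p1 (x : R) : has_deriv p p1 -> (forall y, 0 <= p y) -> p x = 0 -> p1 x = 0.
Proof.
move=> hp p0 px; apply/eqP; rewrite eq_le !leNgt; apply/andP; split; apply/negP => p1x.
- have h1 := hdN (hd_opp_arg hp).
  have [|||y _] := @pos_deriv_right R _ _ (- x) (- x + 1) h1.
  + by rewrite opprK px oppr0.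
  + by rewrite opprK opprK.
  + by rewrite ltrDl.
  + by rewrite oppr_gt0 ltNge p0.
- have [|||y _] := @pos_deriv_right R _ _ x (x + 1) (hdN hp).
  + by rewrite px oppr0.
  + by rewrite oppr_gt0.
  + by rewrite ltrDl.
  + by rewrite oppr_gt0 ltNge p0.
Qed.

(* Testing against the groundstate: [int (p u' + q u) rho = 0] whenever [u] has mean zero. *)
Lemma groundstate_pairing p q rho f u v U (e c V : R) : continuous f ->
  periodic_pi p -> groundstate p q rho -> has_deriv u v -> continuous v -> periodic_pi u ->
  has_deriv U u -> U pi = U 0 -> 0 <= e ->
  (forall x, (p x + e) * v x + q x * u x = 2 * (f x - c)) ->
  (forall x, `|v x| <= V) ->
  `|c - int0pi (fun x => f x * rho x)| <= e / 2 * V.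
Proof.
move=> cf pp [crho [prho [rho0 [rho1 [C0 Hrho]]]]] hu cv pu hU U0 e0 E HV.
have hpr : has_deriv (fun t => p t * rho t) (fun x => q x * rho x + C0).
  move=> x; have [d1 d2] := Hrho x.
  by rewrite -d2 derive1E; exact: derivableP.
have [A hA] := antiderivative_exists crho.
have [G hG] := antiderivative_exists (ctsM cf crho).
have [S hS] := antiderivative_exists (ctsM cv crho).
rewrite (int0piE (ctsM cf crho) hG).
have A1 : A pi - A 0 = 1 by rewrite -rho1 (int0piE crho hA).
(* The flux [C0] of the groundstate contributes [C0 * u], which is removed by subtracting [C0 * U];
   both [p * rho * u] and [U] return to their initial values after a period. *)
have hPhi := hdB (hdM hpr hu) (hdZ C0 hU).
have hPsi := hdB (hdB (hdZ 2 hG) (hdZ (2 * c) hA)) (hdZ e hS).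
have h0 : has_deriv (fun x => (p x * rho x * u x - C0 * U x) -
    (2 * G x - 2 * c * A x - e * S x)) (fun=> 0).
  apply: (hd_ext (hdB hPhi hPsi)) => x.
  have := E x => /(congr1 (fun t => t * rho x)) Ex.
  by apply/eqP; rewrite subr_eq0; apply/eqP; lra.
have := hd0_cst pi 0 h0.
have -> : p pi = p 0 by rewrite -[pi]add0r pp.
have -> : u pi = u 0 by rewrite -[pi]add0r pu.
have -> : rho pi = rho 0 by rewrite -[pi]add0r prho.
rewrite U0 => Eq.
have pi0 := ltW (pi_gt0 R).
have VA : V * (A pi - A 0) = V by rewrite A1 mulr1.
have S1 : S pi - S 0 <= V.
  have := hd_pos_ge (hdB (hdZ V hA) hS) pi0.
  move=> /(_ _)/wrap[x _|]; last by lra.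
  rewrite -mulrBl mulr_ge0// subr_ge0.
  by have := HV x; rewrite ler_norml => /andP[].
have S2 : - V <= S pi - S 0.
  have := hd_pos_ge (hdD (hdZ V hA) hS) pi0.
  move=> /(_ _)/wrap[x _|]; last by lra.
  rewrite -mulrDl mulr_ge0//.
  by have := HV x; rewrite ler_norml => /andP[]; lra.
have -> : c - (G pi - G 0) = - (e / 2) * (S pi - S 0).
  have cA : c * (A pi - A 0) = c by rewrite A1 mulr1.
  lra.
rewrite normrM normrN (ger0_norm (divr_ge0 e0 (ler0n _ 2))) ler_wpM2l ?divr_ge0//.
by rewrite ler_norml S2.
Qed.

End Poisson.

Ltac nneg := by repeat first [done | apply: addr_ge0 | apply: mulr_ge0].

Section PoissonUniform.
Variable R : realType.
Implicit Types f g u v w p q h U : R -> R.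

Lemma periodicD f g : periodic_pi f -> periodic_pi g -> periodic_pi (fun x => f x + g x).
Proof. by move=> pf pg x; rewrite pf pg. Qed.

(** The equation and its first two derivatives have drifts [q], [q + p'] and [q + 2 p']. These agree
    at the zeros of [p], so the same cut points [c1], [c2] serve all three and each order is bounded
    by the order below it. *)
Lemma poisson_uniform p p1 p2 q q1 q2 rho f f1 (c1 c2 : R) :
  has_deriv p p1 -> has_deriv p1 p2 -> continuous p2 -> periodic_pi p ->
  has_deriv q q1 -> has_deriv q1 q2 -> continuous q2 -> periodic_pi q ->
  (forall x, 0 <= p x) -> c2 <= c1 -> c1 <= c2 + pi -> 0 < p c2 ->
  (forall x, c2 <= x <= c1 -> p x = 0 -> 0 < q x) ->
  (forall x, c1 <= x <= c2 + pi -> p x = 0 -> q x < 0) ->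
  groundstate p q rho ->
  has_deriv f f1 -> continuous f1 -> periodic_pi f ->
  (exists2 f2, has_deriv f1 f2 & continuous f2) \/ (forall x, p x != 0) ->
  exists C e0 : R, [/\ 0 <= C, 0 < e0 & forall e, 0 < e < e0 -> exists F u v w c,
    [/\ has_deriv F u, has_deriv u v, has_deriv v w & periodic_pi F] /\
    [/\ forall x, `|F x| <= C, forall x, `|u x| <= C, forall x, `|v x| <= C &
        forall x, `|w x| <= C] /\
    (forall x, (p x + e) * v x + q x * u x = 2 * (f x - c)) /\
    `|c - int0pi (fun x => f x * rho x)| <= C * e].
Proof.
move=> hp hp1 cp2 pp hq hq1 cq2 pq p0 c21 c12 pc2 Hf Hb grho hf cf1 pf f2p.
have [cp cq] := conj (hd_cont hp) (hd_cont hq).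
have [cp1 cq1] := conj (hd_cont hp1) (hd_cont hq1).
have [pp1 pq1] := conj (periodic_deriv hp pp) (periodic_deriv hq pq).
have [pp2 pq2] := conj (periodic_deriv hp1 pp1) (periodic_deriv hq1 pq1).
have pf1 := periodic_deriv hf pf.
have cf := hd_cont hf.
have p10 x : p x = 0 -> p1 x = 0 := hd_at_min hp p0.
have [C1 C10 HC1] := regularized_apriori cp cq pq p0 c21 c12 pc2 Hf Hb.
have [C2 C20 HC2] : exists2 C : R, 0 <= C & forall (e : R) h u u' U (H : R), 0 < e -> has_deriv u u' ->
    (forall x, (p x + e) * u' x + (q x + p1 x) * u x = h x) -> 0 <= H ->
    (forall x, `|h x| <= H) -> periodic_pi u -> has_deriv U u -> periodic_pi U ->
    forall x, `|u x| <= C * (H + 1).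
  apply: (regularized_apriori cp (ctsD cq cp1) (periodicD pq pp1) p0 c21 c12 pc2).
    by move=> x xx px; rewrite p10// addr0; exact: Hf.
  by move=> x xx px; rewrite p10// addr0; exact: Hb.
have [C3 C30 HC3] : exists2 C : R, 0 <= C & forall (e : R) h u u' U (H : R), 0 < e -> has_deriv u u' ->
    (forall x, (p x + e) * u' x + (q x + p1 x + p1 x) * u x = h x) -> 0 <= H ->
    (forall x, `|h x| <= H) -> periodic_pi u -> has_deriv U u -> periodic_pi U ->
    forall x, `|u x| <= C * (H + 1).
  apply: (regularized_apriori cp (ctsD (ctsD cq cp1) cp1)
    (periodicD (periodicD pq pp1) pp1) p0 c21 c12 pc2).
    by move=> x xx px; rewrite p10// !addr0; exact: Hf.
  by move=> x xx px; rewrite p10// !addr0; exact: Hb.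
have [Bf Bf0 HBf] := periodic_bounded cf pf.
have [Bf1 Bf10 HBf1] := periodic_bounded cf1 pf1.
have [Bq1 Bq10 HBq1] := periodic_bounded cq1 pq1.
have [Bq2 Bq20 HBq2] := periodic_bounded cq2 pq2.
have [Bp2 Bp20 HBp2] := periodic_bounded cp2 pp2.
have [Bqp Bqp0 HBqp] := periodic_bounded (ctsD cq cp1) (periodicD pq pp1).
(* [a + b * |c|] is the bound on [v] before [c] is controlled, [Kc] the eventual bound on [|c|], and
   [Mu], [Mv] the resulting bounds on [u] and [v]. *)
pose b := C2 * (Bq1 * (C1 * 2)).
pose a := C2 * (2 * Bf1 + Bq1 * (C1 * (2 * Bf + 1)) + 1).
have b0 : 0 <= b by rewrite !mulr_ge0.
have a0 : 0 <= a by nneg.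
pose mf := int0pi (fun x => f x * rho x).
pose Kc := 2 * `|mf| + a.
have Kc0 : 0 <= Kc by rewrite addr_ge0// mulr_ge0.
pose Mu := C1 * (2 * Bf + 2 * Kc + 1).
pose Mv := a + b * Kc.
have Mu0 : 0 <= Mu by nneg.
have Mv0 : 0 <= Mv by rewrite addr_ge0// mulr_ge0.
(* The equation controls the third derivative of [F] directly where [p] is bounded below;
   otherwise it is differentiated once more, which costs a second derivative of [f]. *)
have [Mw Mw0 HMw] : exists2 Mw : R, 0 <= Mw & forall (e : R) F u v w, 0 < e ->
    has_deriv F u -> has_deriv u v -> has_deriv v w -> periodic_pi F ->
    (forall x, (p x + e) * w x + (q x + p1 x) * v x = 2 * f1 x - q1 x * u x) ->
    (forall x, `|u x| <= Mu) -> (forall x, `|v x| <= Mv) -> forall x, `|w x| <= Mw.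
  case: f2p => [[f2 hf2 cf2]|pn].
    have [Bf2 Bf20 HBf2] := periodic_bounded cf2 (periodic_deriv hf2 pf1).
    exists (C3 * (2 * Bf2 + Bq2 * Mu + (2 * Bq1 + Bp2) * Mv + 1)).
      nneg.
    move=> e F u v w e0 hF hu hv pF Ew HMu HMv.
    have pw : periodic_pi w := periodic_deriv hv (periodic_deriv hu (periodic_deriv hF pF)).
    have pv : periodic_pi v := periodic_deriv hu (periodic_deriv hF pF).
    have Pn x : p x + e != 0 by rewrite gt_eqF// ltr_wpDl.
    pose h x := 2 * f2 x - (2 * q1 x + p2 x) * v x - q2 x * u x.
    pose w' x := (h x - (q x + p1 x + p1 x) * w x) / (p x + e).
    (* By the equation [w] is a quotient of differentiable functions with denominator [p + e > 0],
       so it has a derivative although none was assumed. *)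
    have hw : has_deriv w w'.
      have hN := hdB (hdB (hdZ 2 hf2) (hdM hq1 hu)) (hdM (hdD hq hp1) hv).
      have hP := hdV (hdD hp (hd_cst e)) Pn.
      apply: (hd_eq (hdM hN hP)) => x.
        by rewrite -(Ew x); field; exact: Pn.
      have -> : 2 * f1 x - q1 x * u x - (q x + p1 x) * v x = (p x + e) * w x.
        by rewrite -(Ew x); ring.
      by rewrite /w' /h; field; exact: Pn.
    apply: (HC3 e h w w' v) => //.
    - by move=> x; rewrite /w'; field; exact: Pn.
    - nneg.
    - move=> x; rewrite /h.
      apply: (le_trans (ler_normB _ _)); rewrite addrAC normrM lerD ?ler_pM//.
      apply: (le_trans (ler_normB _ _)); rewrite normrM lerD//.
        by rewrite ger0_norm// ler_pM2l.
      rewrite normrM ler_pM//.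
      by apply: (le_trans (ler_normD _ _)); rewrite normrM ger0_norm// lerD// ler_pM2l.
  have [|c _ Hc] := @EVT_min R p 0 pi (ltW (pi_gt0 R)); first exact: continuous_subspaceT.
  have pcx x : p c <= p x.
    apply: (periodic_all (Q := fun y => p c <= y) (a := 0) pp) => y; rewrite add0r => yy.
    by apply: Hc; rewrite in_itv.
  have pc0 : 0 < p c by rewrite lt_neqAle eq_sym pn p0.
  exists ((2 * Bf1 + Bq1 * Mu + Bqp * Mv) / p c).
    apply: divr_ge0; [nneg|exact: ltW].
  move=> e F u v w e0 hF hu hv pF Ew HMu HMv x.
  rewrite ler_pdivlMr//.
  have : `|(p x + e) * w x| <= 2 * Bf1 + Bq1 * Mu + Bqp * Mv.
    have -> : (p x + e) * w x = 2 * f1 x - q1 x * u x - (q x + p1 x) * v x.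
      by rewrite -(Ew x); ring.
    apply: (le_trans (ler_normB _ _)); rewrite lerD// ?normrM ?ler_pM//.
    apply: (le_trans (ler_normB _ _)); rewrite !normrM lerD// ?ler_pM//.
    by rewrite ger0_norm// ler_pM2l.
  apply: le_trans; rewrite normrM mulrC ler_wpM2r//.
  rewrite ger0_norm; last by rewrite addr_ge0// ltW.
  by rewrite -[leLHS]addr0 lerD// ltW.
pose C := pi * Mu + Mu + Mv + Mw.
have piMu : 0 <= pi * Mu by rewrite mulr_ge0// pi_ge0.
(* For [e] below this threshold [e * b < 1], which is what the absorption of [|c|] requires. *)
exists C, (b + 1)^-1; split.
- by rewrite /C; nneg.
- by rewrite invr_gt0 ltr_wpDl.
move=> e /andP[e0 eb].
have eb1 : e * (b + 1) < 1 by rewrite -ltr_pdivlMr ?mul1r// ltr_wpDl.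
have Pp x : 0 < p x + e by rewrite ltr_wpDl.
have Pn x : p x + e != 0 by rewrite gt_eqF.
have [u [U [c [hu pu hU U0]]]] := periodic_ode_exists (ctsD cp (@ctsC R e)) cq cf
  (@periodicD p (fun=> e) pp (fun=> erefl)) pq pf Pp.
set v := fun x => _ in hu.
have pU := periodic_primitive hU pu U0.
pose v' x := (2 * f1 x - q1 x * u x - (q x + p1 x) * v x) / (p x + e).
have hv : has_deriv v v'.
  have hN := hdB (hdZ 2 (hdB hf (hd_cst c))) (hdM hq hu).
  have hP := hdV (hdD hp (hd_cst e)) Pn.
  by apply: (hd_ext (hdM hN hP)) => x; rewrite /v' /v; field; exact: Pn.
have pv := periodic_deriv hu pu.
have E x : (p x + e) * v x + q x * u x = 2 * (f x - c) by rewrite /v; field; exact: Pn.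
have Ev x : (p x + e) * v' x + (q x + p1 x) * v x = 2 * f1 x - q1 x * u x.
  by rewrite /v'; field; exact: Pn.
clearbody v'; clearbody v.
have Bu x : `|u x| <= C1 * (2 * Bf + 2 * `|c| + 1).
  apply: (HC1 e _ u v U _ e0 hu E) => //; first nneg.
  move=> y; rewrite normrM ger0_norm// -mulrDr ler_pM2l//.
  by apply: (le_trans (ler_normB _ _)); rewrite lerD.
(* The bound for mean-zero solutions applies to [v] because its primitive [u] is periodic. *)
have Bv x : `|v x| <= a + b * `|c|.
  have -> : a + b * `|c| = C2 * ((2 * Bf1 + Bq1 * (C1 * (2 * Bf + 2 * `|c| + 1))) + 1).
    by rewrite /a /b; ring.
  apply: (HC2 e _ v v' u _ e0 hv Ev) => //.
    nneg.
  move=> y; apply: (le_trans (ler_normB _ _)); rewrite !normrM lerD// ?ler_pM//.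
  by rewrite ger0_norm// ler_pM2l.
have cm := groundstate_pairing cf pp grho hu (hd_cont hv) pu hU U0 (ltW e0) E Bv.
rewrite -/mf in cm.
(* From [|c| <= |mf| + e / 2 * (a + b * |c|)] with [e * b <= 1] and [e <= 1], half of [|c|] moves to
   the left-hand side. *)
have cK : `|c| <= Kc.
  have h1 : `|c| <= `|mf| + `|c - mf| by rewrite -[X in `|X| <= _](subrKC mf) ler_normD.
  have ec : 0 <= `|c| by [].
  have h2 : e * (b * `|c|) <= `|c|.
    have -> : e * (b * `|c|) = e * b * `|c| by ring.
    by rewrite ler_piMl//; clear - eb1 e0; lra.
  have eb0 : 0 <= e * b by rewrite mulr_ge0// ltW.
  have h3 : e * a <= a by rewrite ler_piMl//; clear - eb1 eb0; lra.
  by rewrite /Kc; clear - h1 h2 h3 cm; lra.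
have BU x : `|u x| <= Mu.
  by apply: (le_trans (Bu x)); rewrite ler_wpM2l// lerD// lerD// ler_pM2l.
have BV x : `|v x| <= Mv.
  by apply: (le_trans (Bv x)); rewrite lerD// ler_wpM2l.
have hF : has_deriv (fun x => U x - U 0) u.
  by apply: (hd_ext (hdB hU (hd_cst _))) => x; rewrite subr0.
have pF : periodic_pi (fun x => U x - U 0) by move=> x; rewrite pU.
have [CF CU CV CW] : [/\ pi * Mu <= C, Mu <= C, Mv <= C & Mw <= C].
  by clear - piMu Mu0 Mv0 Mw0 C; split; rewrite /C; lra.
exists (fun x => U x - U 0), u, v, v', c; split; [|split; [|split]] => //.
- split=> x.
  + apply: le_trans CF.
    apply: (periodic_all (Q := fun y => `|y| <= pi * Mu) (a := 0) pF) => y.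
    rewrite add0r => /andP[y0 ypi].
    apply: (le_trans (hd_lipschitz 0 y hU BU)).
    by rewrite subr0 ger0_norm// mulrC ler_wpM2r.
  + exact: le_trans (BU x) CU.
  + exact: le_trans (BV x) CV.
  + exact: le_trans (HMw e _ u v v' e0 hF hu hv pF Ev BU BV x) CW.
- rewrite -/mf; apply: le_trans.
    exact: (groundstate_pairing cf pp grho hu (hd_cont hv) pu hU U0 (ltW e0) E BV).
  have h1 : Mv * e <= C * e by rewrite ler_pM2r.
  have h2 : 0 <= Mv * e by rewrite mulr_ge0// ltW.
  by clear - h1 h2; lra.
Qed.

End PoissonUniform.

(** * Expectations and the functions p and q *)

Section BoundedRV.
Context {R : realType} {d : measure_display} {Sig : measurableType d} (Pr : probability Sig R).
Implicit Types X Y Z : Sig -> R.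

(** A class closed under sums and products in which every member is integrable, so that expectations
    can be manipulated freely. *)
Definition bounded_rv X := measurable_fun setT X /\ exists B : R, forall s, `|X s| <= B.

Lemma brv_cst (c : R) : bounded_rv (fun=> c).
Proof. by split; [exact: measurable_cst|exists `|c|]. Qed.

Lemma brvD X Y : bounded_rv X -> bounded_rv Y -> bounded_rv (fun s => X s + Y s).
Proof.
move=> [mX [B HB]] [mY [C HC]]; split; first exact: measurable_funD.
by exists (B + C) => s; apply: (le_trans (ler_normD _ _)); exact: lerD.
Qed.

Lemma brvM X Y : bounded_rv X -> bounded_rv Y -> bounded_rv (fun s => X s * Y s).
Proof.
move=> [mX [B HB]] [mY [C HC]]; split; first exact: measurable_funM.
by exists (B * C) => s; rewrite normrM ler_pM.
Qed.

Lemma brvZ (c : R) X : bounded_rv X -> bounded_rv (fun s => c * X s).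
Proof. by move=> bX; apply: brvM => //; exact: brv_cst. Qed.

Lemma brvN X : bounded_rv X -> bounded_rv (fun s => - X s).
Proof.
move=> [mX [B HB]]; split; first by apply: measurable_funN.
by exists B => s; rewrite normrN.
Qed.

Lemma brvB X Y : bounded_rv X -> bounded_rv Y -> bounded_rv (fun s => X s - Y s).
Proof. by move=> bX bY; apply: brvD => //; exact: brvN. Qed.

Lemma brv_int X : bounded_rv X -> Pr.-integrable setT (EFin \o X).
Proof.
move=> [mX [B HB]]; apply: measurable_bounded_integrable => //.
  by apply: (le_lt_trans (probability_le1 Pr _)) => //; rewrite ltry.
exists B; split; first exact: num_real.
by move=> M BM s _; apply: (le_trans (HB s)); exact: ltW.
Qed.

Lemma expectD X Y : bounded_rv X -> bounded_rv Y ->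
  \int[Pr]_s (X s + Y s) = \int[Pr]_s X s + \int[Pr]_s Y s.
Proof. by move=> bX bY; rewrite RintegralD//; exact: brv_int. Qed.

Lemma expectB X Y : bounded_rv X -> bounded_rv Y ->
  \int[Pr]_s (X s - Y s) = \int[Pr]_s X s - \int[Pr]_s Y s.
Proof. by move=> bX bY; rewrite RintegralB//; exact: brv_int. Qed.

Lemma expectZ (c : R) X : bounded_rv X -> \int[Pr]_s (c * X s) = c * \int[Pr]_s X s.
Proof. by move=> bX; rewrite RintegralZl//; exact: brv_int. Qed.

Lemma expect_cst (c : R) : \int[Pr]_s c = c.
Proof. rewrite Rintegral_cst//= (_ : Pr setT = 1%E) ?mulr1//; exact: probability_setT. Qed.

Lemma eq_expect X Y : (forall s, X s = Y s) -> \int[Pr]_s X s = \int[Pr]_s Y s.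
Proof. by move=> XY; apply: eq_Rintegral => s _. Qed.

Lemma expect_le X Y : bounded_rv X -> bounded_rv Y -> (forall s, X s <= Y s) ->
  \int[Pr]_s X s <= \int[Pr]_s Y s.
Proof. by move=> bX bY XY; apply: le_Rintegral => //; exact: brv_int. Qed.

Lemma expect_norm_le (B : R) X : bounded_rv X -> (forall s, `|X s| <= B) -> `|\int[Pr]_s X s| <= B.
Proof.
move=> bX HB; rewrite ler_norml -[X in _ && (_ <= X)](expect_cst B) -[- B](expect_cst (- B)).
apply/andP; split; apply: expect_le => //; try exact: brv_cst.
  by move=> s; have := HB s; rewrite ler_norml => /andP[].
by move=> s; have := HB s; rewrite ler_norml => /andP[].
Qed.

Lemma expect0_ae X : bounded_rv X -> (forall s, 0 <= X s) -> \int[Pr]_s X s = 0 ->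
  Pr [set s | X s = 0] = 1%E.
Proof.
move=> bX X0 EX; have [mX _] := bX.
have mS : measurable [set s | X s = 0].
  have -> : [set s | X s = 0] = setT `&` X @^-1` [set 0] by rewrite setTI.
  exact: mX.
have I0 : (\int[Pr]_(x in setT) `|(EFin \o X) x| = 0)%E.
  have -> : (\int[Pr]_(x in setT) `|(EFin \o X) x| = \int[Pr]_(x in setT) (X x)%:E)%E.
    by apply: eq_integral => s _ /=; rewrite ger0_norm.
  rewrite -[LHS]fineK; first by rewrite -/(Rintegral Pr setT X) EX.
  exact: integrable_fin_num (brv_int bX).
have /ae_eq_integral_abs : measurable_fun setT (EFin \o X) by exact/measurable_EFinP.
move=> /(_ Pr measurableT)[/(_ I0) [N [mN N0 HN]] _].
apply/eqP; rewrite eq_le probability_le1//=.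
have : Pr (~` N) = 1%E by rewrite probability_setC// N0 sube0.
move=> <-; apply: le_measure; rewrite ?inE//; first exact: measurableC.
move=> s /= nNs; apply: contrapT => Xs; apply: nNs; apply: HN => /= /(_ Logic.I) [].
exact: Xs.
Qed.

End BoundedRV.

(** * Regularity and periodicity of the coefficients *)

Section Phase.
Variable R : realType.
Implicit Types f g : R -> R.

Lemma sin2t (t : R) : sin (2 * t) = 2 * (sin t * cos t).
Proof. by rewrite mulr_natl mulr2n sinD; ring. Qed.

Lemma cos2t (t : R) : cos (2 * t) = cos t ^+ 2 - sin t ^+ 2.
Proof. by rewrite mulr_natl mulr2n cosD; ring. Qed.

Definition pk' (X : 'M[R]_2) (t : R) : R :=
  - ((X 1 0 + X 0 1) * sin (2 * t)) - 2 * X 0 0 * cos (2 * t).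

Lemma hd_sin2 : has_deriv (fun t : R => sin (2 * t)) (fun t => 2 * cos (2 * t)).
Proof. by apply: (hd_ext (hd_comp (@hd_sin R) (hdZ 2 (@hd_id R)))) => t; ring. Qed.

Lemma hd_cos2 : has_deriv (fun t : R => cos (2 * t)) (fun t => - (2 * sin (2 * t))).
Proof. by apply: (hd_ext (hd_comp (@hd_cos R) (hdZ 2 (@hd_id R)))) => t; ring. Qed.

Lemma hd_cos_sqr : has_deriv (fun t : R => cos t ^+ 2) (fun t => - sin (2 * t)).
Proof.
apply: (hd_eq (hdM (@hd_cos R) (@hd_cos R))) => t; first by rewrite expr2.
by rewrite sin2t; ring.
Qed.

Lemma hd_sin_sqr : has_deriv (fun t : R => sin t ^+ 2) (fun t => sin (2 * t)).
Proof.
apply: (hd_eq (hdM (@hd_sin R) (@hd_sin R))) => t; first by rewrite expr2.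
by rewrite sin2t; ring.
Qed.

Lemma hd_pk X : has_deriv (pk X) (pk' X).
Proof.
apply: (hd_ext (hdB (hdB (hdZ (X 1 0) hd_cos_sqr) (hdZ (X 0 1) hd_sin_sqr))
  (hdZ (X 0 0) hd_sin2))) => t.
by rewrite /pk' /=; ring.
Qed.

Lemma cos_sqr_period (t : R) : cos (t + pi) ^+ 2 = cos t ^+ 2.
Proof. by rewrite cosDpi sqrrN. Qed.

Lemma sin_sqr_period (t : R) : sin (t + pi) ^+ 2 = sin t ^+ 2.
Proof. by rewrite sinDpi sqrrN. Qed.

Lemma sin2_period (t : R) : sin (2 * (t + pi)) = sin (2 * t).
Proof. by rewrite !sin2t sinDpi cosDpi mulrNN. Qed.

Lemma pk_period X : periodic_pi (@pk R X).
Proof. by move=> t; rewrite /pk cos_sqr_period sin_sqr_period sin2_period. Qed.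

Definition C2fun f := exists f1 f2, [/\ has_deriv f f1, has_deriv f1 f2 & continuous f2].

Lemma C2fun_cst (c : R) : C2fun (fun=> c).
Proof. by exists (fun=> 0), (fun=> 0); split; [exact: hd_cst|exact: hd_cst|exact: ctsC]. Qed.

Lemma C2funD f g : C2fun f -> C2fun g -> C2fun (fun x => f x + g x).
Proof.
move=> [f1 [f2 [h1 h2 h3]]] [g1 [g2 [k1 k2 k3]]].
by exists (fun x => f1 x + g1 x), (fun x => f2 x + g2 x); split; [exact: hdD|exact: hdD|exact: ctsD].
Qed.

Lemma C2funM f g : C2fun f -> C2fun g -> C2fun (fun x => f x * g x).
Proof.
move=> [f1 [f2 [h1 h2 h3]]] [g1 [g2 [k1 k2 k3]]].
do 2 eexists; split; [exact: hdM|exact: hdD (hdM _ _) (hdM _ _)|].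
have [c0 c1] := conj (hd_cont h1) (hd_cont h2).
have [e0 e1] := conj (hd_cont k1) (hd_cont k2).
by apply: ctsD; apply: ctsD; exact: ctsM.
Qed.

Lemma C2funN f : C2fun f -> C2fun (fun x => - f x).
Proof.
move=> [f1 [f2 [h1 h2 h3]]].
by exists (fun x => - f1 x), (fun x => - f2 x); split; [exact: hdN|exact: hdN|exact: ctsN].
Qed.

Lemma C2fun_sin2 : C2fun (fun t : R => sin (2 * t)).
Proof.
exists (fun t => 2 * cos (2 * t)), (fun t => 2 * (- (2 * sin (2 * t)))); split.
- exact: hd_sin2.
- exact: hdZ hd_cos2.
- exact: ctsM (@ctsC _ _) (ctsN (ctsM (@ctsC _ _) (hd_cont hd_sin2))).
Qed.

Lemma C2fun_cos2 : C2fun (fun t : R => cos (2 * t)).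
Proof.
exists (fun t => - (2 * sin (2 * t))), (fun t => - (2 * (2 * cos (2 * t)))); split.
- exact: hd_cos2.
- exact: hdN (hdZ 2 hd_sin2).
- exact: ctsN (ctsM (@ctsC _ _) (ctsM (@ctsC _ _) (hd_cont hd_cos2))).
Qed.

Lemma C2fun_cos_sqr : C2fun (fun t : R => cos t ^+ 2).
Proof.
exists (fun t => - sin (2 * t)), (fun t => - (2 * cos (2 * t))); split.
- exact: hd_cos_sqr.
- exact: hdN hd_sin2.
- exact: ctsN (ctsM (@ctsC _ _) (hd_cont hd_cos2)).
Qed.

Lemma C2fun_sin_sqr : C2fun (fun t : R => sin t ^+ 2).
Proof.
exists (fun t => sin (2 * t)), (fun t => 2 * cos (2 * t)); split.
- exact: hd_sin_sqr.
- exact: hd_sin2.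
- exact: ctsM (@ctsC _ _) (hd_cont hd_cos2).
Qed.

End Phase.

Section Coefficients.
Context {R : realType} {d : measure_display} {Sig : measurableType d} (Pr : probability Sig R).
Implicit Types Y Z : Sig -> R.

Definition bounded_rm (X : Sig -> 'M[R]_2) := forall i j, bounded_rv (fun s => X s i j).

Lemma brv_pk X t : bounded_rm X -> bounded_rv (fun s => pk (X s) t).
Proof.
by move=> bX; apply: brvB; [apply: brvB|]; apply: brvM => //; exact: brv_cst.
Qed.

Lemma brv_pk' X t : bounded_rm X -> bounded_rv (fun s => pk' (X s) t).
Proof.
move=> bX; apply: brvB; [apply: brvN|]; apply: brvM; try exact: brv_cst.
  by apply: brvD.
exact: brvZ.
Qed.

Lemma expect_lin3 (x y z : R) (X Y Z : Sig -> R) :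
  bounded_rv X -> bounded_rv Y -> bounded_rv Z ->
  \int[Pr]_s (x * X s + y * Y s + z * Z s) =
  x * \int[Pr]_s X s + y * \int[Pr]_s Y s + z * \int[Pr]_s Z s.
Proof.
move=> bX bY bZ.
rewrite (expectD Pr (X := fun s => x * X s + y * Y s) (Y := fun s => z * Z s)).
- rewrite (expectD Pr (X := fun s => x * X s) (Y := fun s => y * Y s)).
  + by rewrite !expectZ.
  + exact: brvZ.
  + exact: brvZ.
- by apply: brvD; exact: brvZ.
- exact: brvZ.
Qed.

Lemma expect_pkM X Y t : bounded_rm X -> bounded_rv Y ->
  \int[Pr]_s (pk (X s) t * Y s) = \int[Pr]_s (X s 1 0 * Y s) * cos t ^+ 2 -
    \int[Pr]_s (X s 0 1 * Y s) * sin t ^+ 2 - \int[Pr]_s (X s 0 0 * Y s) * sin (2 * t).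
Proof.
move=> bX bY; have bXY i j : bounded_rv (fun s => X s i j * Y s) by exact: brvM.
transitivity (\int[Pr]_s (cos t ^+ 2 * (X s 1 0 * Y s) + - sin t ^+ 2 * (X s 0 1 * Y s)
  + - sin (2 * t) * (X s 0 0 * Y s))).
  by apply: eq_expect => s; rewrite /pk; ring.
by rewrite expect_lin3//; ring.
Qed.

Lemma expect_pk'M X Y t : bounded_rm X -> bounded_rv Y ->
  \int[Pr]_s (pk' (X s) t * Y s) =
  - ((\int[Pr]_s (X s 1 0 * Y s) + \int[Pr]_s (X s 0 1 * Y s)) * sin (2 * t)) -
    2 * \int[Pr]_s (X s 0 0 * Y s) * cos (2 * t).
Proof.
move=> bX bY; have bXY i j : bounded_rv (fun s => X s i j * Y s) by exact: brvM.
transitivity (\int[Pr]_s (- sin (2 * t) * (X s 1 0 * Y s) + - sin (2 * t) * (X s 0 1 * Y s)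
  + - (2 * cos (2 * t)) * (X s 0 0 * Y s))).
  by apply: eq_expect => s; rewrite /pk'; ring.
by rewrite expect_lin3//; ring.
Qed.

Lemma expect_pk X t : bounded_rm X -> \int[Pr]_s pk (X s) t = pk (Emx Pr X) t.
Proof.
move=> bX; transitivity (\int[Pr]_s (pk (X s) t * 1)).
  by apply: eq_expect => s; rewrite mulr1.
rewrite expect_pkM//; last exact: brv_cst.
rewrite /pk /Emx !mxE; congr (_ * _ - _ * _ - _ * _); by apply: eq_expect => s; rewrite mulr1.
Qed.

(** The trigonometric factors of [pk] come out of the expectation, so smoothness needs no
    differentiation under the integral. Letting [Y] depend on [t] allows a second factor to be
    treated the same way. *)
Lemma C2fun_expect_pkM X (Y : R -> Sig -> R) : bounded_rm X ->
  (forall t, bounded_rv (Y t)) ->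
  (forall i j, C2fun (fun t => \int[Pr]_s (X s i j * Y t s))) ->
  C2fun (fun t => \int[Pr]_s (pk (X s) t * Y t s)).
Proof.
move=> bX bY cY.
have -> : (fun t => \int[Pr]_s (pk (X s) t * Y t s)) =
    fun t => \int[Pr]_s (X s 1 0 * Y t s) * cos t ^+ 2 +
      - (\int[Pr]_s (X s 0 1 * Y t s) * sin t ^+ 2) + - (\int[Pr]_s (X s 0 0 * Y t s) * sin (2 * t)).
  by apply/funext => t; rewrite expect_pkM.
apply: C2funD; first apply: C2funD.
- exact: C2funM (cY _ _) (@C2fun_cos_sqr R).
- exact: C2funN (C2funM (cY _ _) (@C2fun_sin_sqr R)).
- exact: C2funN (C2funM (cY _ _) (@C2fun_sin2 R)).
Qed.

Lemma C2fun_expect_pk'M X (Y : R -> Sig -> R) : bounded_rm X ->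
  (forall t, bounded_rv (Y t)) ->
  (forall i j, C2fun (fun t => \int[Pr]_s (X s i j * Y t s))) ->
  C2fun (fun t => \int[Pr]_s (pk' (X s) t * Y t s)).
Proof.
move=> bX bY cY.
have -> : (fun t => \int[Pr]_s (pk' (X s) t * Y t s)) =
    fun t => - ((\int[Pr]_s (X s 1 0 * Y t s) + \int[Pr]_s (X s 0 1 * Y t s)) * sin (2 * t)) +
      - ((2 * \int[Pr]_s (X s 0 0 * Y t s)) * cos (2 * t)).
  by apply/funext => t; rewrite expect_pk'M.
apply: C2funD; apply: C2funN; apply: C2funM.
- exact: C2funD.
- exact: C2fun_sin2.
- exact: C2funM (C2fun_cst _) _.
- exact: C2fun_cos2.
Qed.

Lemma C2fun_eq (f g : R -> R) : C2fun f -> (forall t, f t = g t) -> C2fun g.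
Proof. by move=> cf /funext <-. Qed.

Lemma C2fun_expect_mul_pk X Y : bounded_rm X -> bounded_rv Y ->
  C2fun (fun t => \int[Pr]_s (Y s * pk (X s) t)).
Proof.
move=> bX bY; have h : C2fun (fun t => \int[Pr]_s (pk (X s) t * Y s)).
  by apply: (C2fun_expect_pkM bX (Y := fun=> Y)) => // i j; exact: C2fun_cst.
by apply: (C2fun_eq h) => t; apply: eq_expect => s; rewrite mulrC.
Qed.

Lemma C2fun_expect_pk_pk (X Y : Sig -> 'M[R]_2) : bounded_rm X -> bounded_rm Y ->
  C2fun (fun t => \int[Pr]_s (pk (X s) t * pk (Y s) t)).
Proof.
move=> bX bY; apply: (C2fun_expect_pkM bX (Y := fun t s => pk (Y s) t)).
  by move=> t; exact: brv_pk.
by move=> i j; exact: C2fun_expect_mul_pk.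
Qed.

Lemma C2fun_expect_pk_pk' (X Y : Sig -> 'M[R]_2) : bounded_rm X -> bounded_rm Y ->
  C2fun (fun t => \int[Pr]_s (pk (X s) t * pk' (Y s) t)).
Proof.
move=> bX bY; have h : C2fun (fun t => \int[Pr]_s (pk' (Y s) t * pk (X s) t)).
  apply: (C2fun_expect_pk'M bY (Y := fun t s => pk (X s) t)).
    by move=> t; exact: brv_pk.
  by move=> i j; exact: C2fun_expect_mul_pk.
by apply: (C2fun_eq h) => t; apply: eq_expect => s; rewrite mulrC.
Qed.

Variables (P : nat -> Sig -> 'M[R]_2) (K : nat).

Lemma qfunE t : qfun Pr P K t = 2 * \int[Pr]_s pk (P K s) t +
  \int[Pr]_s (pk (P 1%N s) t * pk' (P 1%N s) t).
Proof.
rewrite /qfun; congr (_ + _); apply: eq_expect => s.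
by rewrite (hd_derive1 t (hd_pk _)).
Qed.

Lemma C2fun_pfun : bounded_rm (P 1%N) -> C2fun (pfun Pr P).
Proof.
move=> bP; apply: (C2fun_eq (C2fun_expect_pk_pk bP bP)) => t.
by apply: eq_expect => s; rewrite expr2.
Qed.

Lemma C2fun_qfun : bounded_rm (P 1%N) -> bounded_rm (P K) -> C2fun (qfun Pr P K).
Proof.
move=> bP bPK; have h : C2fun (fun t => \int[Pr]_s (1 * pk (P K s) t)).
  by apply: C2fun_expect_mul_pk => //; exact: brv_cst.
apply: (C2fun_eq (C2funD (C2funM (C2fun_cst 2) h) (C2fun_expect_pk_pk' bP bP))) => t.
by rewrite qfunE; congr (_ * _ + _); apply: eq_expect => s; rewrite mul1r.
Qed.

Lemma pfun_period : periodic_pi (pfun Pr P).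
Proof. by move=> t; apply: eq_expect => s; rewrite pk_period. Qed.

Lemma qfun_period : periodic_pi (qfun Pr P K).
Proof.
move=> t; rewrite !qfunE; congr (_ * _ + _); apply: eq_expect => s; rewrite pk_period//.
by rewrite (periodic_deriv (hd_pk _) (pk_period _)).
Qed.

Lemma pfun_ge0 t : 0 <= pfun Pr P t.
Proof. by apply: Rintegral_ge0 => s _; exact: sqr_ge0. Qed.

End Coefficients.

(** * Zeros of p and the cut of the circle *)

Section CircleCut.
Variable R : realType.

Lemma sin_neq0 (t : R) : 0 < t < pi -> sin t != 0.
Proof. by move=> t0; rewrite gt_eqF// sin_gt0_pi. Qed.

Lemma sin_neq0N (t : R) : - pi < t < 0 -> sin t != 0.
Proof. by move=> t0; rewrite -oppr_eq0 -sinN sin_neq0//; lra. Qed.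

(* The hypothesis on triples says that [p] has at most two zeros per period. *)
Lemma circle_cut (p q : R -> R) : periodic_pi p -> periodic_pi q -> (forall t, 0 <= p t) ->
  (forall t1 t2 t3, sin (t1 - t2) != 0 -> sin (t1 - t3) != 0 -> sin (t2 - t3) != 0 ->
    p t1 = 0 -> p t2 = 0 -> p t3 = 0 -> False) ->
  (forall t, p t = 0 -> q t != 0) ->
  exists c1 c2, [/\ c2 <= c1, c1 <= c2 + pi, 0 < p c2,
    forall x, c2 <= x <= c1 -> p x = 0 -> 0 < q x &
    forall x, c1 <= x <= c2 + pi -> p x = 0 -> q x < 0].
Proof.
move=> pp pq p0 no3 Hq; have pi0 : (0 : R) < pi := pi_gt0 R.
have ppos t : p t != 0 -> 0 < p t by rewrite lt_neqAle eq_sym p0 andbT.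
(* The angles 0, [pi / 4] and [pi / 2] are distinct modulo [pi], so they cannot all be zeros. *)
have [c0 pc0] : exists c0, 0 < p c0.
  have [p1|/ppos] := eqVneq (p 0) 0; last by exists 0.
  have [p2|/ppos] := eqVneq (p (pi / 4)) 0; last by exists (pi / 4).
  have [p3|/ppos] := eqVneq (p (pi / 2)) 0; last by exists (pi / 2).
  by case: (no3 (pi / 2) (pi / 4) 0) => //; apply: sin_neq0; lra.
(* If [q] has a single sign on the zeros of [p], one of the two stretches fills the period and the
   other shrinks to a translate of [c0], where [p > 0]. *)
have [nneg|/existsNP[z2 /not_implyP[pz2 /negP]]] :=
    pselect (forall z, p z = 0 -> 0 < q z).
  exists (c0 + pi), c0; split => //; first lra.
    by move=> x _; exact: nneg.
  move=> x xc px; have xE : x = c0 + pi by lra.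
  by move: pc0; rewrite -(pp c0) -xE px ltxx.
rewrite -leNgt => qz2; have {qz2} : q z2 < 0 by rewrite lt_neqAle Hq.
have [npos|/existsNP[z1 /not_implyP[pz1 /negP]]] :=
    pselect (forall z, p z = 0 -> q z < 0).
  move=> _; exists c0, c0; split => //; first lra.
    move=> x xc px; have xE : x = c0 by lra.
    by move: pc0; rewrite -xE px ltxx.
  by move=> x _; exact: npos.
rewrite -leNgt => qz1; have {qz1} qz1 : 0 < q z1 by rewrite lt_neqAle eq_sym Hq.
have [n _] := periodic_reduce z1 z2.
rewrite -(periodic_int pq n z2).
move: pz2; rewrite -(periodic_int pp n z2).
move: (z2 + _) => {z2 n} z2 pz2 /andP[z12 z21] qz2.
have {z12} z12 : z1 < z2.
  rewrite lt_neqAle z12 andbT; apply/negP => /eqP e.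
  by have := lt_trans qz2 qz1; rewrite e ltxx.
(* The midpoint between the two zeros and its antipode on the circle of length [pi]: they separate
   [z1], in the forward stretch, from [z2], in the backward one. *)
exists ((z1 + z2) / 2), ((z1 + z2) / 2 - pi / 2); split => //.
- lra.
- lra.
- apply: ppos; apply/eqP => px; apply: (no3 z2 z1 ((z1 + z2) / 2 - pi / 2)) => //.
  + by apply: sin_neq0; lra.
  + by apply: sin_neq0; lra.
  + by apply: sin_neq0; lra.
- move=> x xx px; have [xz1|xz1] := eqVneq x z1; first by rewrite xz1.
  case: (no3 z2 z1 x) => //.
  + by apply: sin_neq0; lra.
  + by apply: sin_neq0; lra.
  + by move: xz1; rewrite neq_lt => /orP[h|h]; [apply: sin_neq0|apply: sin_neq0N]; lra.
- move=> x xx px; have [xz2|xz2] := eqVneq x z2; first by rewrite xz2.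
  case: (no3 z2 z1 x) => //.
  + by apply: sin_neq0; lra.
  + by move: xz2; rewrite neq_lt => /orP[h|h]; [apply: sin_neq0|apply: sin_neq0N]; lra.
  + by apply: sin_neq0N; lra.
Qed.

End CircleCut.

Section Zeros.
Context {R : realType} {d : measure_display} {Sig : measurableType d} (Pr : probability Sig R).
Variables (P : nat -> Sig -> 'M[R]_2).

(* Lagrange interpolation of a binary quadratic form through three non-proportional vectors. *)
Lemma pk_interpolation (X : 'M[R]_2) (t1 t2 t3 t : R) :
  sin (t1 - t2) != 0 -> sin (t1 - t3) != 0 -> sin (t2 - t3) != 0 ->
  pk X t = pk X t1 * (sin (t - t2) * sin (t - t3) / (sin (t1 - t2) * sin (t1 - t3))) -
           pk X t2 * (sin (t - t1) * sin (t - t3) / (sin (t1 - t2) * sin (t2 - t3))) +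
           pk X t3 * (sin (t - t1) * sin (t - t2) / (sin (t1 - t3) * sin (t2 - t3))).
Proof.
rewrite /pk !sin2t !sinB => h12 h13 h23.
by field; rewrite h12 h13 h23.
Qed.

(** By interpolation and [(a - b + c)^2 <= 3 (a^2 + b^2 + c^2)], the second moment at any angle is
    at most a combination of those at [t1], [t2], [t3]. *)
Lemma pfun_eq0 (t1 t2 t3 : R) : bounded_rm (P 1%N) ->
  sin (t1 - t2) != 0 -> sin (t1 - t3) != 0 -> sin (t2 - t3) != 0 ->
  pfun Pr P t1 = 0 -> pfun Pr P t2 = 0 -> pfun Pr P t3 = 0 -> forall t, pfun Pr P t = 0.
Proof.
move=> bP h12 h13 h23 p1 p2 p3 t; apply/eqP; rewrite eq_le pfun_ge0 andbT.
have b2 s : bounded_rv (fun s0 => pk (P 1%N s0) s ^+ 2).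
  by rewrite /bounded_rv; have := brvM (brv_pk s bP) (brv_pk s bP); under eq_fun do rewrite -expr2.
set l1 := sin (t - t2) * sin (t - t3) / (sin (t1 - t2) * sin (t1 - t3)).
set l2 := sin (t - t1) * sin (t - t3) / (sin (t1 - t2) * sin (t2 - t3)).
set l3 := sin (t - t1) * sin (t - t2) / (sin (t1 - t3) * sin (t2 - t3)).
have -> : 0 = 3 * l1 ^+ 2 * pfun Pr P t1 + 3 * l2 ^+ 2 * pfun Pr P t2 + 3 * l3 ^+ 2 * pfun Pr P t3.
  by rewrite p1 p2 p3; ring.
rewrite /pfun -(expect_lin3 Pr (3 * l1 ^+ 2) (3 * l2 ^+ 2) (3 * l3 ^+ 2) (b2 t1) (b2 t2) (b2 t3)).
apply: expect_le => //.
  by apply: brvD; [apply: brvD|]; exact: brvZ.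
move=> s; rewrite (pk_interpolation _ t h12 h13 h23) -/l1 -/l2 -/l3.
set x := pk _ t1; set y := pk _ t2; set z := pk _ t3.
have := sqr_ge0 (x * l1 + y * l2); have := sqr_ge0 (x * l1 - z * l3).
have := sqr_ge0 (y * l2 + z * l3).
by move=> *; nra.
Qed.

(** The entries are recovered from four values of the form: [c = pk 0], [b = - pk (pi / 2)] and
    [2 a = pk (- pi / 4) - pk (pi / 4)]. Hence the expected sum of their squares is bounded by
    values of [p]. *)
Lemma pfun0_degenerate : bounded_rm (P 1%N) -> (forall s, \tr (P 1%N s) = 0) ->
  (forall t, pfun Pr P t = 0) -> Pr [set s | P 1%N s = 0] = 1%E.
Proof.
move=> bP tP p0.
pose Y s := P 1%N s 1 0 ^+ 2 + P 1%N s 0 1 ^+ 2 + P 1%N s 0 0 ^+ 2.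
have bsq i j : bounded_rv (fun s => P 1%N s i j ^+ 2).
  by have := brvM (bP i j) (bP i j); under eq_fun do rewrite -expr2.
have b2 s : bounded_rv (fun s0 => pk (P 1%N s0) s ^+ 2).
  by have := brvM (brv_pk s bP) (brv_pk s bP); under eq_fun do rewrite -expr2.
have bY : bounded_rv Y by apply: brvD; [apply: brvD|].
have Y0 s : 0 <= Y s by rewrite !addr_ge0// sqr_ge0.
have -> : [set s | P 1%N s = 0] = [set s | Y s = 0].
  apply/seteqP; split => s /=; first by rewrite /Y => ->; rewrite !mxE !expr0n/= !addr0.
  move=> /eqP; rewrite /Y paddr_eq0 ?addr_ge0 ?sqr_ge0// paddr_eq0 ?sqr_ge0// !sqrf_eq0.
  move=> /andP[/andP[/eqP c0 /eqP b0] /eqP a0].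
  have := tP s; rewrite /mxtrace big_ord_recl big_ord1.
  have -> : lift ord0 ord0 = 1 :> 'I_2 by apply/val_inj.
  rewrite a0 add0r => d0; apply/matrixP => i j; rewrite mxE.
  case: i => [[|[|//]] hi]; case: j => [[|[|//]] hj].
  - by rewrite -[RHS]a0; congr (P _ _ _ _); apply/val_inj.
  - by rewrite -[RHS]b0; congr (P _ _ _ _); apply/val_inj.
  - by rewrite -[RHS]c0; congr (P _ _ _ _); apply/val_inj.
  - by rewrite -[RHS]d0; congr (P _ _ _ _); apply/val_inj.
apply: expect0_ae => //; apply/eqP; rewrite eq_le Rintegral_ge0 ?andbT//.
(* Four second moments are combined by two nested three-term sums; the last coefficient 0 is
   padding. *)
have -> : 0 = 1 * (1 * pfun Pr P 0 + 1 * pfun Pr P (pi / 2) + 1 * pfun Pr P (pi / 4)) +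
    1 * pfun Pr P (- (pi / 4)) + 0 * pfun Pr P 0 by rewrite !p0; ring.
rewrite /pfun -(expect_lin3 Pr 1 1 1 (b2 0) (b2 (pi / 2)) (b2 (pi / 4))).
have b3 : bounded_rv (fun s => 1 * pk (P 1%N s) 0 ^+ 2 + 1 * pk (P 1%N s) (pi / 2) ^+ 2
    + 1 * pk (P 1%N s) (pi / 4) ^+ 2).
  by apply: brvD; [apply: brvD|]; exact: brvZ.
rewrite -(expect_lin3 Pr 1 1 0 b3 (b2 (- (pi / 4))) (b2 0)).
apply: expect_le => //.
  by apply: brvD; [apply: brvD|]; exact: brvZ.
move=> s; rewrite /Y.
have -> : P 1%N s 1 0 = pk (P 1%N s) 0 by rewrite /pk mulr0 sin0 cos0; ring.
have -> : P 1%N s 0 1 = - pk (P 1%N s) (pi / 2).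
  by rewrite /pk sin2t sin_pihalf cos_pihalf; ring.
have -> : P 1%N s 0 0 = (pk (P 1%N s) (- (pi / 4)) - pk (P 1%N s) (pi / 4)) / 2.
  rewrite /pk cosN sinN mulrN sinN.
  have -> : 2 * (pi / 4) = pi / 2 :> R by field.
  by rewrite sin_pihalf; field.
set x := pk _ (- _); set y := pk _ (pi / 4).
by have := sqr_ge0 (x + y); nra.
Qed.

Lemma zero_structure (K : nat) : bounded_rm (P 1%N) -> (forall s, \tr (P 1%N s) = 0) ->
  (Pr [set s | P 1%N s = 0%R] < 1)%E ->
  (forall th, pfun Pr P th = 0 -> qfun Pr P K th != 0) ->
  exists c1 c2, [/\ c2 <= c1, c1 <= c2 + pi, 0 < pfun Pr P c2,
    forall x, c2 <= x <= c1 -> pfun Pr P x = 0 -> 0 < qfun Pr P K x &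
    forall x, c1 <= x <= c2 + pi -> pfun Pr P x = 0 -> qfun Pr P K x < 0].
Proof.
move=> bP tP ndeg Hq; apply: circle_cut Hq.
- exact: pfun_period.
- exact: qfun_period.
- exact: pfun_ge0.
- move=> t1 t2 t3 h1 h2 h3 p1 p2 p3; have p0 := pfun_eq0 bP h1 h2 h3 p1 p2 p3.
  by move: ndeg; rewrite (pfun0_degenerate bP tP p0) ltxx.
Qed.

End Zeros.

(** * The angle map of a matrix exponential *)

Section Exponential.
Variable R : realType.
Implicit Types X A : 'M[R]_2.

Lemma cvg_coords (u : nat -> 'M[R]_2) (A : 'M[R]_2) :
  (forall i j, (fun n => u n i j) @ \oo --> A i j) -> u @ \oo --> A.
Proof.
move=> H; apply/cvg_ballP => e e0.
have HH : \forall n \near \oo, forall i j, ball (A i j) e (u n i j).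
  apply: filter_forall => i; apply: filter_forall => j.
  by have /cvg_ballP := H i j; apply.
by apply: filterS HH => n Hn; split.
Qed.

Lemma coords_cvg (u : nat -> 'M[R]_2) (A : 'M[R]_2) i j :
  u @ \oo --> A -> (fun n => u n i j) @ \oo --> A i j.
Proof.
move=> uA; exact: (continuous_cvg _ (@coord_continuous R 2 2 i j A) uA).
Qed.

Lemma lim_dist_le (u : nat -> R) (l a K : R) (N : nat) : u @ \oo --> l ->
  (forall n, (N <= n)%N -> `|u n - a| <= K) -> `|l - a| <= K.
Proof.
move=> ul H.
have h : (fun n => `|u n - a|) @ \oo --> `|l - a|.
  by apply: cvg_norm; apply: cvgB => //; exact: cvg_cst.
by apply: (cvgr_to_le h); exists N.
Qed.

Lemma sum_ord2 (f : 'I_2 -> R) : \sum_k f k = f 0 + f 1.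
Proof.
rewrite big_ord_recl big_ord1; congr (f _ + f _); exact/val_inj.
Qed.

Lemma mulmx2E m n (A : 'M[R]_(m, 2)) (B : 'M[R]_(2, n)) i j :
  (A *m B) i j = A i 0 * B 0 j + A i 1 * B 1 j.
Proof. by rewrite mxE sum_ord2. Qed.

Lemma expmx_coord_le X (x : R) : (forall i j, `|X i j| <= x) ->
  forall n i j, `|(X ^+ n) i j| <= (2 * x) ^+ n.
Proof.
move=> HX; have x0 : 0 <= x := le_trans (normr_ge0 _) (HX 0 0).
elim=> [|n IH] i j.
  by rewrite !expr0 mxE; case: (i == j); rewrite ?normr1 ?normr0.
have -> : X ^+ n.+1 = X *m X ^+ n by rewrite exprS.
rewrite mulmx2E; apply: (le_trans (ler_normD _ _)); rewrite !normrM.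
have -> : (2 * x) ^+ n.+1 = x * (2 * x) ^+ n + x * (2 * x) ^+ n by rewrite exprS; ring.
by apply: lerD; apply: ler_pM.
Qed.

(** The slack [2 / n!] makes the induction close: the new term is at most [y^3 / n!], and
    [2 / (n + 1)! <= 1 / n!]. *)
Lemma exp_tail_le (y : R) : 0 <= y <= 1 -> forall n, (3 <= n)%N ->
  \sum_(3 <= i < n) y ^+ i / i`!%:R <= y ^+ 3 * (1 - 2 / n`!%:R).
Proof.
move=> /andP[y0 y1]; elim=> // n IH; rewrite ltnS leq_eqVlt => /predU1P[<-|n3].
  rewrite big_geq// mulr_ge0 ?exprn_ge0// subr_ge0 ler_pdivrMr ?mul1r ?ltr0n//.
  by rewrite ler_nat.
rewrite big_nat_recr //=; apply: (le_trans (lerD (IH n3) (lexx _))).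
have n0 : (0 : R) < n`!%:R by rewrite ltr0n fact_gt0.
have h1 : y ^+ n / n`!%:R <= y ^+ 3 * (1 / n`!%:R).
  by rewrite mul1r ler_pM2r ?invr_gt0//; exact: ler_wiXn2l.
apply: (le_trans (lerD (lexx _) h1)); rewrite -mulrDr ler_wpM2l ?exprn_ge0//.
have : 2 / n.+1`!%:R <= 1 / n`!%:R :> R.
  rewrite factS natrM invfM mulrA ler_pM2r ?invr_gt0//.
  by rewrite ler_pdivrMr ?ltr0n// mul1r ler_nat ltnW// ltnW.
lra.
Qed.

Lemma expm_cvg X :
  (fun n => \sum_(i < n) ((i`!)%:R^-1 *: X ^+ i) : 'M[R]_2) @ \oo --> expm X.
Proof.
set u := fun n : nat => _.
pose x := \sum_i \sum_j `|X i j|.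
have HX i j : `|X i j| <= x.
  rewrite /x (bigD1 i)//= (bigD1 j)//= -addrA lerDl addr_ge0// sumr_ge0// => k _.
  exact: sumr_ge0.
have x0 : 0 <= x := le_trans (normr_ge0 _) (HX 0 0).
have uE n i j : u n i j = series (fun k => (k`!)%:R^-1 * (X ^+ k) i j) n.
  by rewrite /u /series /= summxE big_mkord; apply: eq_bigr => k _; rewrite mxE.
have ucv i j : cvgn (fun n => u n i j).
  rewrite (_ : (fun n => u n i j) = series (fun k => (k`!)%:R^-1 * (X ^+ k) i j)); last first.
    by apply/funext => n; exact: uE.
  apply: normed_cvg; apply: (@series_le_cvg _ _ (exp_coeff (2 * x))) => //.
  - by move=> n /=.
  - by move=> n; rewrite /exp_coeff /= divr_ge0 ?exprn_ge0 ?mulr_ge0.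
  - move=> n; rewrite /exp_coeff /= normrM ger0_norm ?invr_ge0// mulrC ler_wpM2r ?invr_ge0//.
    exact: expmx_coord_le.
  - exact: is_cvg_series_exp_coeff.
suff : cvgn u by [].
apply/cvg_ex; exists (\matrix_(i, j) limn (fun n => u n i j)).
by apply: cvg_coords => i j; rewrite mxE; exact: ucv.
Qed.

(** Entries of [X^n] are at most [(2 x)^n] for 2 by 2 matrices, whence the factor [8 = 2^3]; the
    assumption [x <= 1 / 2] makes [2 x <= 1] for the tail estimate. *)
Lemma expm_approx X (x : R) : x <= 1 / 2 -> (forall i j, `|X i j| <= x) ->
  forall i j, `|expm X i j - (1%:M + X + 2^-1 *: (X *m X)) i j| <= 8 * x ^+ 3.
Proof.
move=> x1 HX; have x0 : 0 <= x := le_trans (normr_ge0 _) (HX 0 0).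
pose u (n : nat) : 'M[R]_2 := \sum_(i < n) ((i`!)%:R^-1 *: X ^+ i).
have uexp : u @ \oo --> expm X := @expm_cvg X.
have uE n i j : u n i j = series (fun k => (k`!)%:R^-1 * (X ^+ k) i j) n.
  by rewrite /u /series /= summxE big_mkord; apply: eq_bigr => k _; rewrite mxE.
move=> i j.
apply: (@lim_dist_le (fun n => u n i j) _ _ _ 3 (coords_cvg uexp)) => n n3.
have -> : u n i j - (1%:M + X + 2^-1 *: (X *m X)) i j =
    \sum_(3 <= k < n) (k`!)%:R^-1 * (X ^+ k) i j.
  rewrite uE /series /= (big_cat_nat (n := 3))//= !big_nat_recl// big_geq//.
  have -> : (X ^+ 0) i j = (1%:M : 'M[R]_2) i j by rewrite expr0.
  have -> : (X ^+ 2) i j = (X *m X) i j by rewrite expr2.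
  have -> : (1%:M + X + 2^-1 *: (X *m X)) i j =
      (1%:M : 'M[R]_2) i j + X i j + 2^-1 * (X *m X) i j by rewrite !mxE.
  rewrite expr1 (_ : 0`! = 1%N)// (_ : 1`! = 1%N)// (_ : 2`! = 2%N)//.
  by rewrite invr1; ring.
have y1 : 0 <= 2 * x <= 1 by lra.
apply: (le_trans (ler_norm_sum _ _ _)).
apply: (@le_trans _ _ (\sum_(3 <= k < n) (2 * x) ^+ k / k`!%:R)).
  apply: ler_sum => k _; rewrite normrM ger0_norm ?invr_ge0// mulrC ler_wpM2r ?invr_ge0//.
  exact: expmx_coord_le.
apply: (le_trans (exp_tail_le y1 n3)).
have -> : 8 * x ^+ 3 = (2 * x) ^+ 3 * 1 by ring.
by rewrite ler_wpM2l ?exprn_ge0 ?mulr_ge0// gerBl divr_ge0.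
Qed.
End Exponential.

(** * The induced map on angles and its second-order expansion *)

Section Angle.
Variable R : realType.
Implicit Types (X A : 'M[R]_2) (g : R -> R).

Lemma trig_int_shift (n : int) (x : R) : exists2 s : R, s = 1 \/ s = -1 &
  cos (x + n%:~R * pi) = s * cos x /\ sin (x + n%:~R * pi) = s * sin x.
Proof.
have hN (m : nat) (y : R) : exists2 s : R, s = 1 \/ s = -1 &
    cos (y + m%:R * pi) = s * cos y /\ sin (y + m%:R * pi) = s * sin y.
  elim: m => [|m [s s1 [hc hs]]]; first by exists 1; [left|rewrite mul0r addr0 !mul1r].
  exists (- s); first by case: s1 => ->; [right|left; rewrite opprK].
  have -> : y + m.+1%:R * pi = y + m%:R * pi + pi by rewrite -natr1; ring.
  by rewrite cosDpi sinDpi hc hs !mulNr.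
case: n => n; first exact: hN.
have [s s1 [hc hs]] := hN n.+1 (x + (Negz n)%:~R * pi).
have e : x + (Negz n)%:~R * pi + n.+1%:R * pi = x by rewrite NegzE mulrNz; ring.
rewrite e in hc hs; exists s => //.
by rewrite hc hs !mulrA; case: s1 => ->; rewrite ?mulrNN ?mul1r.
Qed.

Lemma sin0_periodic g (x y : R) : periodic_pi g -> sin (x - y) = 0 -> g x = g y.
Proof.
move=> pg sxy; have [n _ /andP[h1 h2]] := periodic_reduce 0 (x - y).
have [s s1 [_ hs]] := trig_int_shift n (x - y).
rewrite sxy mulr0 in hs.
have e : x - y + n%:~R * pi = 0.
  apply/eqP; rewrite eq_le h1 andbT leNgt; apply/negP => h.
  have : 0 < sin (x - y + n%:~R * pi) by apply: sin_gt0_pi; rewrite h; lra.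
  by rewrite hs ltxx.
rewrite -(periodic_int pg n x); congr (g _); lra.
Qed.

(** [ang_num] and [ang_den] are the components of [A e_t] orthogonal to and along [e_t], so their
    quotient is the tangent of the angle by which [A] turns [e_t]. *)
Definition ang_num A (t : R) : R :=
  cos t * (A 1 0 * cos t + A 1 1 * sin t) - sin t * (A 0 0 * cos t + A 0 1 * sin t).
Definition ang_den A (t : R) : R :=
  cos t * (A 0 0 * cos t + A 0 1 * sin t) + sin t * (A 1 0 * cos t + A 1 1 * sin t).
Definition ang_shift A (t : R) : R := atan (ang_num A t / ang_den A t).

Lemma polar_atan (N D : R) : 0 < D -> exists2 r, 0 < r &
  D = r * cos (atan (N / D)) /\ N = r * sin (atan (N / D)).
Proof.
move=> D0; have D0n : D != 0 by rewrite gt_eqF.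
have c0 : 0 < cos (atan (N / D)).
  by apply: cos_gt0_pihalf; rewrite atan_gtNpi2 atan_ltpi2.
exists (D / cos (atan (N / D))); first exact: divr_gt0.
split; first by rewrite mulfVK// gt_eqF.
have := atanK (N / D); rewrite /tan => h.
by rewrite mulrAC -mulrA h mulrC mulfVK.
Qed.

Lemma mulmx_e_theta A (t : R) :
  (A *m e_theta t) 0 0 = A 0 0 * cos t + A 0 1 * sin t /\
  (A *m e_theta t) 1 0 = A 1 0 * cos t + A 1 1 * sin t.
Proof. by rewrite !mulmx2E !mxE. Qed.

(** [S_T] jumps at the ends of [[0, pi)], whereas [t + ang_shift A t] does not. Both describe the
    same line, and a [pi]-periodic [g] sees neither the representative nor the sign [sg]. *)
Lemma S_T_shift A (t sg : R) g : periodic_pi g -> sg = 1 \/ sg = -1 -> 0 < ang_den A t ->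
  g (S_T (sg *: A) t) = g (t + ang_shift A t).
Proof.
move=> pg sg1 D0; rewrite /ang_shift; have [r r0 [hD hN]] := polar_atan (ang_num A t) D0.
set w := t + _.
have [v0 v1] := mulmx_e_theta A t.
have cs : cos t ^+ 2 + sin t ^+ 2 = 1 by exact: cos2Dsin2.
have w0 : (A *m e_theta t) 0 0 = r * cos w.
  rewrite /w cosD v0 mulrBr !mulrA -[r * cos t]mulrC -[r * sin t]mulrC -!mulrA -hD -hN.
  rewrite /ang_den /ang_num -[LHS]mul1r -cs; ring.
have w1 : (A *m e_theta t) 1 0 = r * sin w.
  rewrite /w sinD v1 mulrDr !mulrA -[r * cos t]mulrC -[r * sin t]mulrC -!mulrA -hD -hN.
  rewrite /ang_den /ang_num -[LHS]mul1r -cs; ring.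
have sg2 : sg ^+ 2 = 1 by case: sg1 => ->; rewrite ?sqrrN expr1n.
have nE : eucl_norm ((sg *: A) *m e_theta t) = r.
  rewrite /eucl_norm -scalemxAl [X in Num.sqrt (X ^+ 2 + _)]mxE [X in Num.sqrt (_ + X ^+ 2)]mxE.
  rewrite w0 w1 !exprMn sg2 !mul1r -mulrDr cos2Dsin2 mulr1 sqrtr_sqr gtr0_norm//.
(* With [r] the length of [A e_t], the defining condition says that [(cos u, sin u)] equals
   [(cos w, sin w)] up to sign. *)
have eE (u s : R) : e_theta u = s *: ((eucl_norm ((sg *: A) *m e_theta t))^-1 *:
    ((sg *: A) *m e_theta t)) <-> cos u = s * sg * cos w /\ sin u = s * sg * sin w.
  have rn : r != 0 by rewrite gt_eqF.
  rewrite nE -scalemxAl !scalerA; split.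
    move=> e; split.
      have := congr1 (fun v : 'cV[R]_2 => v 0 0) e.
      rewrite [LHS]mxE/= [RHS]mxE w0 => ->; field; exact: rn.
    have := congr1 (fun v : 'cV[R]_2 => v 1 0) e.
    rewrite [LHS]mxE/= [RHS]mxE w1 => ->; field; exact: rn.
  move=> [hc hs]; apply/matrixP => i j; rewrite (ord1 j) [RHS]mxE.
  case: i => [[|[|//]] hi].
    have -> : Ordinal hi = 0 by apply/val_inj.
    by rewrite w0 mxE/= hc; field; exact: rn.
  have -> : Ordinal hi = 1 by apply/val_inj.
  by rewrite w1 mxE/= hs; field; exact: rn.
have : [set u | 0 <= u < pi /\ exists s : R, (s = 1 \/ s = -1) /\
    e_theta u = s *: ((eucl_norm ((sg *: A) *m e_theta t))^-1 *:
      ((sg *: A) *m e_theta t))] (S_T (sg *: A) t).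
  have [n _ hn] := periodic_reduce 0 w; rewrite add0r in hn.
  have [s s1 [hc hs]] := trig_int_shift n w.
  apply: xgetPex; exists (w + n%:~R * pi); split => //.
  exists (s * sg); split; first by case: s1 => ->; case: sg1 => ->; rewrite ?mul1r ?mulN1r ?opprK; auto.
  apply/eE; rewrite hc hs; have -> : s * sg * sg = s by rewrite -mulrA -expr2 sg2 mulr1.
  by [].
move=> [_ [s [_ /eE[hc hs]]]]; apply: sin0_periodic => //.
by rewrite sinB hc hs; ring.
Qed.

(** One mean value step per order. The factorials of Taylor's formula are given up, since only the
    powers of [h] matter. *)
Lemma power_growth (G G' : R -> R) (V : R) (n : nat) : has_deriv G G' -> G 0 = 0 -> 0 <= V ->
  (forall h, `|G' h| <= V * `|h| ^+ n) -> forall h, `|G h| <= V * `|h| ^+ n.+1.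
Proof.
move=> hG G0 V0 HG h.
have [c ch ->] : exists2 c, `|c| <= `|h| & G h = G' c * h.
  have [h0|/ltW h0] := leP 0 h.
    have [c /andP[c0 hc] e] := hd_MVT hG h0; exists c; last by rewrite -[LHS]subr0 -G0 e subr0.
    by rewrite !ger0_norm.
  have [c /andP[c0 hc] e] := hd_MVT hG h0; exists c.
    by rewrite !ler0_norm// lerN2.
  by rewrite G0 in e; lra.
rewrite normrM exprSr mulrA ler_wpM2r//; apply: (le_trans (HG c)).
by rewrite ler_wpM2l// lerXn2r// nnegrE.
Qed.

Lemma atan_sub_le (y : R) : `|atan y - y| <= `|y| ^+ 3.
Proof.
have h : has_deriv (fun y => atan y - y) (fun y : R => (1 + y ^+ 2)^-1 - 1).
  by apply: hdB; [move=> x; exact: is_derive1_atan|exact: hd_id].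
rewrite -[leRHS]mul1r; apply: (power_growth h) => // [|z]; first by rewrite atan0 subrr.
have z2 : 0 <= z ^+ 2 := sqr_ge0 z.
have z1 : 0 < 1 + z ^+ 2 by lra.
rewrite mul1r -normrX (ger0_norm z2).
have -> : (1 + z ^+ 2)^-1 - 1 = - (z ^+ 2 / (1 + z ^+ 2)) by field; rewrite gt_eqF.
rewrite normrN ger0_norm ?divr_ge0 ?(ltW z1)//.
by rewrite ler_pdivrMr// ler_peMr// lerDl.
Qed.

Lemma atan_le (y : R) : `|atan y| <= `|y|.
Proof.
have h : has_deriv (@atan R) (fun y : R => (1 + y ^+ 2)^-1) by move=> x; exact: is_derive1_atan.
rewrite -[leRHS]mul1r; apply: (@power_growth _ _ 1 0 h) => // [|z]; first exact: atan0.
have z2 : 0 <= z ^+ 2 := sqr_ge0 z.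
by rewrite mulr1 ger0_norm ?invr_ge0 ?addr_ge0// invf_le1 ?lerDl// ltr_pwDl.
Qed.

Lemma taylor2 g g1 g2 g3 (V t h : R) : has_deriv g g1 -> has_deriv g1 g2 -> has_deriv g2 g3 ->
  (forall x, `|g3 x| <= V) ->
  `|g (t + h) - g t - g1 t * h - g2 t * (h ^+ 2 / 2)| <= V * `|h| ^+ 3.
Proof.
move=> d0 d1 d2 HV; have V0 : 0 <= V := le_trans (normr_ge0 _) (HV 0).
have ds : has_deriv (fun x => t + x) (fun=> 1).
  by apply: (hd_ext (hdD (hd_cst t) (@hd_id R))) => x; rewrite add0r.
have e2 : has_deriv (fun h => g2 (t + h) - g2 t) (fun h => g3 (t + h)).
  by apply: (hd_ext (hdB (hd_comp d2 ds) (hd_cst _))) => x; rewrite mulr1 subr0.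
have b2 x : `|g2 (t + x) - g2 t| <= V * `|x| ^+ 1.
  by apply: (power_growth e2) => // [|y]; rewrite ?addr0 ?subrr// expr0 mulr1.
have e1 : has_deriv (fun h => g1 (t + h) - g1 t - g2 t * h) (fun h => g2 (t + h) - g2 t).
  by apply: (hd_ext (hdB (hdB (hd_comp d1 ds) (hd_cst _)) (hdZ _ (@hd_id R)))) => x; ring.
have b1 x : `|g1 (t + x) - g1 t - g2 t * x| <= V * `|x| ^+ 2.
  by apply: (power_growth e1) => //; rewrite addr0 subrr mulr0 subrr.
have e0 : has_deriv (fun h => g (t + h) - g t - g1 t * h - g2 t * (h ^+ 2 / 2))
    (fun h => g1 (t + h) - g1 t - g2 t * h).
  have dh : has_deriv (fun x : R => x ^+ 2 / 2) (fun x => x).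
    have := hdZ (2^-1) (hdM (@hd_id R) (@hd_id R)) => hh.
    apply: (hd_eq hh) => x /=; first by rewrite mulrC expr2.
    by field.
  apply: (hd_ext (hdB (hdB (hdB (hd_comp d0 ds) (hd_cst _)) (hdZ _ (@hd_id R))) (hdZ _ dh))) => x.
  by ring.
apply: (power_growth e0) => //.
by rewrite addr0 subrr expr0n/= mul0r !mulr0 !subr0.
Qed.

End Angle.

Section AngleTaylor.
Variable R : realType.
Implicit Types (X A : 'M[R]_2) (g : R -> R).

Lemma normM_le (a b A B : R) : `|a| <= A -> `|b| <= B -> `|a * b| <= A * B.
Proof. by move=> ha hb; rewrite normrM ler_pM. Qed.

Lemma normD_le (a b A B : R) : `|a| <= A -> `|b| <= B -> `|a + b| <= A + B.
Proof. by move=> ha hb; apply: (le_trans (ler_normD _ _)); exact: lerD. Qed.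

Lemma normB_le (a b A B : R) : `|a| <= A -> `|b| <= B -> `|a - b| <= A + B.
Proof. by move=> ha hb; apply: (le_trans (ler_normB _ _)); exact: lerD. Qed.

Lemma norm_cos_le (t : R) : `|cos t| <= 1.
Proof. by rewrite ler_norml cos_le1 cos_geN1. Qed.

Lemma norm_sin_le (t : R) : `|sin t| <= 1.
Proof. by rewrite ler_norml sin_le1 sin_geN1. Qed.

Lemma bilinear_trig_le X (x c s c' s' : R) : (forall i j, `|X i j| <= x) ->
  `|c| <= 1 -> `|s| <= 1 -> `|c'| <= 1 -> `|s'| <= 1 ->
  `|c * (X 0 0 * c' + X 0 1 * s') + s * (X 1 0 * c' + X 1 1 * s')| <= 4 * x.
Proof.
move=> HX hc hs hc' hs'.
have h : `|c * (X 0 0 * c' + X 0 1 * s') + s * (X 1 0 * c' + X 1 1 * s')| <=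
    1 * (x * 1 + x * 1) + 1 * (x * 1 + x * 1).
  by do ![apply: normD_le => // | apply: normM_le => //].
by apply: (le_trans h); lra.
Qed.

Lemma ang_num_le X (x t : R) : (forall i j, `|X i j| <= x) -> `|ang_num X t| <= 4 * x.
Proof.
move=> HX; have := @bilinear_trig_le X x (- sin t) (cos t) (cos t) (sin t) HX.
rewrite normrN; move=> /(_ (norm_sin_le t) (norm_cos_le t) (norm_cos_le t) (norm_sin_le t)).
by rewrite /ang_num mulNr addrC.
Qed.

Lemma ang_den_le X (x t : R) : (forall i j, `|X i j| <= x) -> `|ang_den X t| <= 4 * x.
Proof.
move=> HX.
exact: (bilinear_trig_le HX (norm_cos_le t) (norm_sin_le t) (norm_cos_le t) (norm_sin_le t)).
Qed.

Lemma ang_num_traceless X (t : R) : \tr X = 0 -> ang_num X t = pk X t.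
Proof.
rewrite /mxtrace sum_ord2 => /(canRL (addKr _)); rewrite addr0 => e.
by rewrite /ang_num /pk sin2t e; ring.
Qed.

Lemma ang_den_traceless X (t : R) : \tr X = 0 -> ang_den X t = - (pk' X t / 2).
Proof.
rewrite /mxtrace sum_ord2 => /(canRL (addKr _)); rewrite addr0 => e.
by rewrite /ang_den /pk' sin2t cos2t e; field.
Qed.

(* [X ^ 2 = - det X] for traceless [X]. *)
Lemma traceless_exp2_ang X E (t : R) : \tr X = 0 ->
  let A := 1%:M + X + 2^-1 *: (X *m X) + E in
  ang_num A t = pk X t + ang_num E t /\
  ang_den A t = 1 - pk' X t / 2 + (X 0 0 ^+ 2 + X 0 1 * X 1 0) / 2 + ang_den E t.
Proof.
move=> trX A; have := trX.
rewrite /mxtrace sum_ord2 => /(canRL (addKr _)); rewrite addr0 => e.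
have AE i j : A i j = (i == j)%:R + X i j + (X i 0 * X 0 j + X i 1 * X 1 j) / 2 + E i j.
  by rewrite /A [LHS]mxE -(mulmx2E X X) !mxE; congr (_ + _ + _); exact: mulrC.
have cs : cos t ^+ 2 + sin t ^+ 2 = 1 by exact: cos2Dsin2.
split.
  by rewrite -(ang_num_traceless t trX) /ang_num !AE /= e; field.
have -> : - (pk' X t / 2) = ang_den X t by rewrite ang_den_traceless.
transitivity ((cos t ^+ 2 + sin t ^+ 2) * (1 + (X 0 0 ^+ 2 + X 0 1 * X 1 0) / 2) +
    ang_den X t + ang_den E t); last by rewrite cs; field.
by rewrite /ang_den !AE /= e; field.
Qed.

(** The tangent of the shift is [(p + O(x^3)) / (1 - r + O(x^2))] with [p = pk X t = O(x)] and
    [r = pk' X t / 2 = O(x)], hence [p (1 + r)] up to cubic terms, and [atan] only adds a cubic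
    error. The bound [x <= 1 / 20] keeps the denominator above one half. *)
Lemma ang_shift_estimate X (x t : R) : \tr X = 0 -> x <= 1 / 20 ->
  (forall i j, `|X i j| <= x) ->
  [/\ 2^-1 <= ang_den (expm X) t, `|ang_shift (expm X) t| <= 12 * x &
    `|ang_shift (expm X) t - (pk X t + pk X t * pk' X t / 2)| <= 3000 * x ^+ 3].
Proof.
move=> trX x1 HX; have x0 : 0 <= x := le_trans (normr_ge0 _) (HX 0 0).
pose E := expm X - (1%:M + X + 2^-1 *: (X *m X)).
have HE i j : `|E i j| <= 8 * x ^+ 3.
  have -> : E i j = expm X i j - (1%:M + X + 2^-1 *: (X *m X)) i j by rewrite /E [LHS]mxE [in LHS]mxE.
  by apply: expm_approx => //; lra.
have [hN hD] := traceless_exp2_ang E t trX.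
have eX : expm X = 1%:M + X + 2^-1 *: (X *m X) + E by rewrite /E addrC subrK.
rewrite -eX in hN hD; rewrite /ang_shift.
have nE := ang_num_le t HE; have dE := ang_den_le t HE.
have p4 : `|pk X t| <= 4 * x by rewrite -ang_num_traceless//; exact: ang_num_le.
have r4 : `|pk' X t / 2| <= 4 * x.
  by rewrite -normrN -ang_den_traceless//; exact: ang_den_le.
set p := pk X t in hN p4 *; set r := pk' X t / 2 in hD r4 *.
have -> : p * pk' X t / 2 = p * r by rewrite /r mulrA.
set nu := ang_num E t in hN nE; set de := ang_den E t in hD dE.
set dl := (_ + _) / 2 in hD.
have d1 : `|dl| <= x ^+ 2.
  have h : `|X 0 0 ^+ 2 + X 0 1 * X 1 0| <= x * x + x * x.
    by rewrite expr2; apply: normD_le; exact: normM_le.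
  by rewrite /dl normrM [`|2^-1|]ger0_norm ?invr_ge0//; lra.
have x2 : x ^+ 2 <= x / 20 by rewrite expr2; nra.
have x3 : x ^+ 3 <= x ^+ 2 / 20 by rewrite exprSr; have := sqr_ge0 x; nra.
have x30 : 0 <= x ^+ 3 by rewrite exprn_ge0.
set N := ang_num _ _ in hN *; set D := ang_den _ _ in hD *.
pose eta := dl + de.
have eta5 : `|eta| <= 5 * x ^+ 2 by rewrite /eta; apply: (le_trans (normD_le d1 dE)); lra.
have DE : D = 1 - r + eta by rewrite hD /eta; ring.
have Dge : 2^-1 <= D.
  have := ler_norm r; have : - `|eta| <= eta by rewrite lerNl -normrN ler_norm.
  by rewrite DE; lra.
have D0 : 0 < D by rewrite (lt_le_trans _ Dge)// invr_gt0.
have N6 : `|N| <= 6 * x by rewrite hN; apply: (le_trans (normD_le p4 nE)); lra.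
have Dinv (z B : R) : `|z| <= B -> `|z / D| <= 2 * B.
  move=> zB; rewrite normrM normfV (gtr0_norm D0) ler_pdivrMr//.
  have B0 : 0 <= B := le_trans (normr_ge0 _) zB.
  by apply: (le_trans zB); nra.
have y12 : `|N / D| <= 12 * x by apply: (le_trans (Dinv _ _ N6)); lra.
split=> //; first exact: (le_trans (atan_le _)).
have e1 : `|N / D - (p + p * r)| <=
    2 * (32 * x ^+ 3 + 4 * x * (16 * x ^+ 2) + 4 * x * (2 * (5 * x ^+ 2))).
  (* Since [(1 + r) (1 - r) = 1 - r^2], the first and second order terms cancel and every summand
     left in the numerator is cubic. *)
  have -> : N / D - (p + p * r) = (nu + p * r ^+ 2 - p * ((1 + r) * eta)) / D.
    rewrite hN; have DE' : nu + p * r ^+ 2 - p * ((1 + r) * eta) = p + nu - (p + p * r) * D.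
      by rewrite DE; ring.
    by rewrite DE'; field; rewrite gt_eqF.
  apply: Dinv; apply: normB_le; first apply: normD_le.
  - by apply: (le_trans nE); lra.
  - apply: normM_le => //; rewrite expr2 (_ : 16 * x ^+ 2 = (4 * x) * (4 * x)); last by ring.
    exact: normM_le.
  - apply: normM_le => //; apply: normM_le => //.
    have h := normD_le (lexx `|1 : R|) r4.
    by apply: (le_trans h); rewrite normr1; lra.
have e2 : `|atan (N / D) - N / D| <= (12 * x) ^+ 3.
  apply: (le_trans (atan_sub_le _)).
  by rewrite lerXn2r// nnegrE// mulr_ge0.
have -> : atan (N / D) - (p + p * r) = (atan (N / D) - N / D) + (N / D - (p + p * r)) by ring.
apply: (le_trans (normD_le e2 e1)).
have -> : (12 * x) ^+ 3 = 1728 * x ^+ 3 by ring.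
have -> : 4 * x * (16 * x ^+ 2) = 64 * x ^+ 3 by ring.
have -> : 4 * x * (2 * (5 * x ^+ 2)) = 40 * x ^+ 3 by ring.
lra.
Qed.

(** In Taylor's formula the shift may be replaced by [p + p r] in the linear term and by [p] in the
    quadratic one, each at cubic cost. The product [p r] is the origin of the summand [E (p_1 p_1')]
    in [q]. *)
Lemma angle_taylor X (x t V : R) g g1 g2 g3 : \tr X = 0 -> x <= 1 / 20 ->
  (forall i j, `|X i j| <= x) ->
  has_deriv g g1 -> has_deriv g1 g2 -> has_deriv g2 g3 ->
  (forall y, `|g1 y| <= V) -> (forall y, `|g2 y| <= V) -> (forall y, `|g3 y| <= V) ->
  `|g (t + ang_shift (expm X) t) - g t -
    (g1 t * (pk X t + pk X t * pk' X t / 2) + g2 t * (pk X t ^+ 2 / 2))| <= 7000 * V * x ^+ 3.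
Proof.
move=> trX x1 HX d0 d1 d2 V1 V2 V3.
have x0 : 0 <= x := le_trans (normr_ge0 _) (HX 0 0).
have V0 : 0 <= V := le_trans (normr_ge0 _) (V1 0).
have [_ D12 Dp] := ang_shift_estimate t trX x1 HX.
have p4 : `|pk X t| <= 4 * x by rewrite -ang_num_traceless//; exact: ang_num_le.
have r4 : `|pk' X t / 2| <= 4 * x.
  by rewrite -normrN -ang_den_traceless//; exact: ang_den_le.
have T := taylor2 t (ang_shift (expm X) t) d0 d1 d2 V3.
set D := ang_shift _ _ in D12 Dp T *.
set p := pk X t in Dp p4 *; set r := pk' X t / 2 in r4.
rewrite -mulrA -/r in Dp *.
have x30 : 0 <= x ^+ 3 by rewrite exprn_ge0.
have x20 : 0 <= x ^+ 2 by rewrite exprn_ge0.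
have x3 : x ^+ 3 <= x ^+ 2 / 20 by rewrite exprSr; nra.
(* [166 = 3000 / 20 + 16], using [x^3 <= x^2 / 20]. *)
have Dmp : `|D - p| <= 166 * x ^+ 2.
  have -> : D - p = (D - (p + p * r)) + p * r by ring.
  apply: (le_trans (normD_le Dp (normM_le p4 r4))).
  have -> : 4 * x * (4 * x) = 16 * x ^+ 2 by ring.
  lra.
have Dpp : `|D + p| <= 16 * x by apply: (le_trans (normD_le D12 p4)); lra.
have D3 : `|D| ^+ 3 <= 1728 * x ^+ 3.
  have -> : 1728 * x ^+ 3 = (12 * x) ^+ 3 by ring.
  by rewrite lerXn2r// nnegrE// mulr_ge0.
have -> : g (t + D) - g t - (g1 t * (p + p * r) + g2 t * (p ^+ 2 / 2)) =
  (g (t + D) - g t - g1 t * D - g2 t * (D ^+ 2 / 2)) + g1 t * (D - (p + p * r)) +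
  g2 t * ((D - p) * (D + p)) / 2 by field.
have h1 : V * `|D| ^+ 3 <= V * (1728 * x ^+ 3) by rewrite ler_wpM2l.
have h2 := normM_le (V1 t) Dp.
have h3 := normM_le (V2 t) (normM_le Dmp Dpp).
have h4 := normM_le h3 (lexx `|2^-1 : R|).
apply: (le_trans (normD_le (normD_le T h2) h4)).
rewrite [`|2^-1|]ger0_norm ?invr_ge0//.
have -> : V * (166 * x ^+ 2 * (16 * x)) / 2 = 1328 * (V * x ^+ 3) by field.
have k1 := mulr_ge0 V0 x30.
by clear - h1 k1; lra.
Qed.

End AngleTaylor.

(** * The transfer operator and its generator *)

Section ExpectLimits.
Context {R : realType} {d : measure_display} {Sig : measurableType d} (Pr : probability Sig R).

Lemma powR_small (r e : R) : 0 < r -> 0 < e ->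
  exists2 l1 : R, 0 < l1 & forall l, 0 < l < l1 -> powR l r < e.
Proof.
move=> r0 e0; have /cvgr_lt /(_ _ e0) [l1 /= l10 H] := @powR_cvg0 R r r0.
exists l1 => // l /andP[l0 ll1]; apply: H => //=.
by rewrite sub0r normrN gtr0_norm.
Qed.

Lemma brv_lim (Xn : nat -> Sig -> R) (X : Sig -> R) (B : R) :
  (forall n, measurable_fun setT (Xn n)) -> (forall n s, `|Xn n s| <= B) ->
  (forall s, (fun n => Xn n s) @ \oo --> X s) -> bounded_rv X.
Proof.
move=> mX HB cX; split.
  by apply: (@measurable_fun_cvg _ _ _ setT Xn) => // s _; exact: cX.
exists B => s; rewrite -[X s]subr0; apply: (lim_dist_le (N := 0) (cX s)) => n _.
by rewrite subr0.
Qed.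

Lemma expect_lim (Xn : nat -> Sig -> R) (X : Sig -> R) (B : R) :
  (forall n, measurable_fun setT (Xn n)) -> (forall n s, `|Xn n s| <= B) ->
  (forall s, (fun n => Xn n s) @ \oo --> X s) ->
  (fun n => \int[Pr]_s Xn n s) @ \oo --> \int[Pr]_s X s.
Proof.
move=> mX HB cX.
have bX : bounded_rv X := brv_lim mX HB cX.
have bn n : bounded_rv (Xn n) by split => //; exists B.
have [|||||_ _ H] := @dominated_convergence _ _ _ Pr setT measurableT
  (fun n s => (Xn n s)%:E) (fun s => (X s)%:E) (fun=> B%:E).
- by move=> n; apply/measurable_EFinP.
- by apply/measurable_EFinP; case: bX.
- by apply: aeW => s _; apply: cvg_EFin; [exact: nearW|exact: cX].
- exact: (brv_int Pr (brv_cst B)).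
- by apply: aeW => s n _; rewrite /= lee_fin.
rewrite /Rintegral; apply: fine_cvg; rewrite fineK//.
exact: integrable_fin_num (brv_int Pr bX).
Qed.

Lemma brv_sum (m n : nat) (X : nat -> Sig -> R) :
  (forall k, (m <= k)%N -> bounded_rv (X k)) ->
  bounded_rv (fun s => \sum_(m <= k < n) X k s).
Proof.
move=> bX; elim: n => [|n IH].
  by under eq_fun do rewrite big_geq//; exact: brv_cst.
have [mn|mn] := leqP m n.
  under eq_fun do rewrite big_nat_recr//=.
  by apply: brvD => //; exact: bX.
by under eq_fun do rewrite big_geq//; exact: brv_cst.
Qed.

Lemma expect_sum (m n : nat) (X : nat -> Sig -> R) :
  (forall k, (m <= k)%N -> bounded_rv (X k)) ->
  \int[Pr]_s (\sum_(m <= k < n) X k s) = \sum_(m <= k < n) \int[Pr]_s X k s.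
Proof.
move=> bX; elim: n => [|n IH].
  rewrite big_geq// -[RHS](expect_cst Pr 0); apply: eq_expect => s; exact: big_geq.
have [mn|mn] := leqP m n.
  rewrite big_nat_recr//= -IH -expectD//; [|exact: brv_sum|exact: bX].
  by apply: eq_expect => s; rewrite big_nat_recr.
rewrite big_geq// -[RHS](expect_cst Pr 0); apply: eq_expect => s; exact: big_geq.
Qed.

End ExpectLimits.

(** * Expansion of the exponent in powers of lambda *)

Section PowerSeries.
Context {R : realType} {d : measure_display} {Sig : measurableType d} (Pr : probability Sig R).
Variables (eta : nat -> R) (P : nat -> Sig -> 'M[R]_2) (l0 B : R).
Hypothesis etainc : forall k, (1 <= k)%N -> eta k < eta k.+1.
Hypothesis mP : forall k i j, (1 <= k)%N -> measurable_fun setT (fun s => P k s i j).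
Hypothesis l00 : 0 < l0.
Hypothesis HB : forall s n, \sum_(1 <= k < n) powR l0 (eta k) * abs_entries (P k s) <= B.

Lemma eta_mono m k : (1 <= m)%N -> (m <= k)%N -> eta m <= eta k.
Proof.
move=> m1; elim: k => [|k IH]; first by rewrite leqn0 => /eqP ->.
rewrite leq_eqVlt => /predU1P[->//|]; rewrite ltnS => mk.
by apply: (le_trans (IH mk)); rewrite ltW// etainc// (leq_trans m1).
Qed.

Lemma eta_lt m k : (1 <= m)%N -> (m < k)%N -> eta m < eta k.
Proof. by move=> m1 mk; apply: (lt_le_trans (etainc m1)); exact: eta_mono. Qed.

Lemma abs_entries_ge0 (A : 'M[R]_2) : 0 <= abs_entries A.
Proof. by apply: sumr_ge0 => i _; exact: sumr_ge0. Qed.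

Lemma entry_le_abs_entries (A : 'M[R]_2) i j : `|A i j| <= abs_entries A.
Proof.
rewrite /abs_entries (bigD1 i)//= (bigD1 j)//= -addrA lerDl addr_ge0// sumr_ge0// => k _.
exact: sumr_ge0.
Qed.

Lemma weight_term_ge0 k s : 0 <= powR l0 (eta k) * abs_entries (P k s).
Proof. by rewrite mulr_ge0 ?powR_ge0 ?abs_entries_ge0. Qed.

Lemma tail_weight_le m n s : (1 <= m)%N ->
  \sum_(m <= k < n) powR l0 (eta k) * abs_entries (P k s) <= B.
Proof.
move=> m1; apply: le_trans (HB s n).
have [mn|nm] := leqP m n.
  rewrite (big_cat_nat m1 mn) /= lerDr.
  by apply: sumr_ge0 => k _; exact: weight_term_ge0.
rewrite (big_geq (ltnW nm)).
by apply: sumr_ge0 => k _; exact: weight_term_ge0.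
Qed.

Lemma brm_P k : (1 <= k)%N -> bounded_rm (P k).
Proof.
move=> k1 i j; split; first exact: mP.
exists (B / powR l0 (eta k)) => s; rewrite ler_pdivlMr ?powR_gt0// mulrC.
apply: le_trans (tail_weight_le k.+1 s k1); rewrite big_nat1.
by rewrite ler_wpM2l ?powR_ge0// entry_le_abs_entries.
Qed.

Lemma powR_tail_le (l a b : R) : 0 < l <= l0 -> a <= b ->
  powR l b <= powR l0 b * (powR l a / powR l0 a).
Proof.
move=> /andP[l0' ll0] ab.
have e c : powR l c = powR l0 c * powR (l / l0) c.
  by rewrite -powRM ?divr_ge0 ?(ltW l0') ?(ltW l00)// mulrCA divff ?mulr1// gt_eqF.
rewrite (e b) (e a) ler_wpM2l ?powR_ge0// mulrAC divff ?mul1r ?gt_eqF ?powR_gt0//.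
by apply: ger_powR => //; rewrite divr_gt0//= ler_pdivrMr ?mul1r.
Qed.

(** Comparison with the absolutely convergent series at [l0]: for [k >= m] the ratio
    [(l / l0)^(eta k)] is at most [(l / l0)^(eta m)], so a tail is as small as its first power. *)
Lemma partial_tail_le (l : R) m n s i j : 0 < l <= l0 -> (1 <= m)%N ->
  `|\sum_(m <= k < n) powR l (eta k) * P k s i j| <= B / powR l0 (eta m) * powR l (eta m).
Proof.
move=> ll0 m1; apply: (le_trans (ler_norm_sum _ _ _)).
apply: (@le_trans _ _ (\sum_(m <= k < n)
    (powR l0 (eta k) * abs_entries (P k s)) * (powR l (eta m) / powR l0 (eta m)))).
  rewrite !big_seq; apply: ler_sum => k; rewrite mem_index_iota => /andP[mk _].
  rewrite normrM ger0_norm ?powR_ge0// mulrAC.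
  by rewrite ler_pM ?powR_ge0 ?entry_le_abs_entries// powR_tail_le// eta_mono.
rewrite -mulr_suml -mulrA [X in _ <= B * X]mulrC ler_wpM2r ?tail_weight_le//.
by rewrite divr_ge0 ?powR_ge0.
Qed.

Lemma psum_entryE (l : R) s n i j :
  psum eta P l s n i j = \sum_(1 <= k < n) powR l (eta k) * P k s i j.
Proof. by rewrite /psum summxE; apply: eq_bigr => k _; rewrite mxE. Qed.

Section FixedL.
Variable l : R.
Hypothesis ll0 : 0 < l <= l0.
Hypothesis cvgP : forall s, cvgn (psum eta P l s).
Let X s := limn (psum eta P l s).

Lemma lim_psum_entry s i j : (fun n => psum eta P l s n i j) @ \oo --> X s i j.
Proof. exact: coords_cvg (@cvgP s). Qed.

Lemma psum_measurable n i j : measurable_fun setT (fun s => psum eta P l s n i j).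
Proof.
under eq_fun do rewrite psum_entryE.
have h : bounded_rv (fun s => \sum_(1 <= k < n) powR l (eta k) * P k s i j).
  apply: (@brv_sum _ _ _ 1 n (fun k s => powR l (eta k) * P k s i j)) => k k1.
  by apply: brvZ; exact: brm_P.
by case: h.
Qed.

Lemma psum_bound n s i j : `|psum eta P l s n i j| <= B / powR l0 (eta 1%N) * powR l (eta 1%N).
Proof. by rewrite psum_entryE; exact: partial_tail_le. Qed.

Lemma brm_X : bounded_rm X.
Proof.
move=> i j; apply: (@brv_lim _ _ _ (fun n s => psum eta P l s n i j) (fun s => X s i j)
  (B / powR l0 (eta 1%N) * powR l (eta 1%N))) => [n|n s|s].
- exact: psum_measurable.
- exact: psum_bound.
- exact: lim_psum_entry.
Qed.

Lemma X_bound s i j : `|X s i j| <= B / powR l0 (eta 1%N) * powR l (eta 1%N).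
Proof.
have h := @lim_dist_le R _ (X s i j) 0 (B / powR l0 (eta 1%N) * powR l (eta 1%N)) 0
  (@lim_psum_entry s i j).
rewrite subr0 in h; apply: h => n _; rewrite subr0; exact: psum_bound.
Qed.

Lemma X_sub_first_bound s i j :
  `|X s i j - powR l (eta 1%N) * P 1%N s i j| <= B / powR l0 (eta 2%N) * powR l (eta 2%N).
Proof.
apply: (@lim_dist_le R _ (X s i j) _ _ 2 (@lim_psum_entry s i j)) => n n2.
rewrite psum_entryE big_ltn// addrC addKr.
exact: partial_tail_le.
Qed.

Lemma X_traceless s : (forall k, (1 <= k)%N -> \tr (P k s) = 0) -> \tr (X s) = 0.
Proof.
move=> trP; rewrite /mxtrace sum_ord2.
have h : (fun n => psum eta P l s n 0 0 + psum eta P l s n 1 1) @ \oo --> X s 0 0 + X s 1 1.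
  by apply: cvgD; exact: lim_psum_entry.
have e : (fun n => psum eta P l s n 0 0 + psum eta P l s n 1 1) = fun=> 0.
  apply/funext => n; rewrite !psum_entryE -big_split/= big_nat big1// => k /andP[k1 _].
  by rewrite -mulrDr; have := trP k k1; rewrite /mxtrace sum_ord2 => ->; rewrite mulr0.
rewrite e in h; have h0 : (fun=> 0 : R) @ \oo --> (0 : R) by exact: cvg_cst.
exact: (cvg_unique _ h h0).
Qed.

Lemma sum_only_nat (K n : nat) (a : nat -> R) : (1 <= K < n)%N ->
  (forall k, (1 <= k < n)%N -> k != K -> a k = 0) -> \sum_(1 <= k < n) a k = a K.
Proof.
move=> Kn a0; rewrite (bigD1_seq K) ?mem_index_iota ?iota_uniq//=.
rewrite big_seq_cond big1 ?addr0// => k /andP[]; rewrite mem_index_iota => kn kK.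
exact: a0.
Qed.

End FixedL.

(** After averaging, the terms below [K] and those strictly between [K] and [Ktilde] vanish; what
    remains besides the term of index [K] is the tail from [Ktilde] on, if there is one. *)
Lemma expect_X_estimate (K : nat) (et : R) : (1 <= K)%N ->
  (forall k, (1 <= k < K)%N -> Emx Pr (P k) = 0) -> is_eta_tilde Pr eta P K et ->
  exists2 C : R, 0 <= C & forall l : R, 0 < l <= l0 -> l <= 1 ->
    (forall s, cvgn (psum eta P l s)) -> forall i j,
    `|Emx Pr (fun s => limn (psum eta P l s)) i j - powR l (eta K) * Emx Pr (P K) i j|
      <= C * powR l et.
Proof.
move=> K1 EP Het.
have B0 : 0 <= B.
  by rewrite -(expect_cst Pr B) -(expect_cst Pr 0); apply: expect_le;
    [exact: brv_cst|exact: brv_cst|move=> s; have := HB s 0; rewrite big_geq].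
have EPij k i j : Emx Pr (P k) = 0 -> \int[Pr]_s P k s i j = 0.
  by move=> /matrixP /(_ i j); rewrite !mxE.
(* The estimate is established for all partial sums from some index [N] on, with [N] and [C]
   independent of [l]; dominated convergence then passes to the limit. *)
have [[N C] /= [C0 HN]] : exists NC : nat * R, 0 <= NC.2 /\ forall l n i j, (NC.1 <= n)%N ->
    0 < l <= l0 -> l <= 1 ->
    `|\int[Pr]_s psum eta P l s n i j - powR l (eta K) * Emx Pr (P K) i j| <= NC.2 * powR l et.
  have Epsum l n i j : \int[Pr]_s psum eta P l s n i j =
      \sum_(1 <= k < n) powR l (eta k) * \int[Pr]_s P k s i j.
    rewrite (eq_expect Pr (fun s => psum_entryE l s n i j)).
    rewrite (expect_sum Pr (m := 1) n (X := fun k s => powR l (eta k) * P k s i j)); last first.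
      by move=> k k1; apply: brvZ; exact: brm_P.
    rewrite !big_nat; apply: eq_bigr => k /andP[k1 _]; rewrite expectZ//; exact: brm_P.
  case: Het => [[Kt [KKt [_ [Ebetween etE]]]]|[Eafter _]]; last first.
    exists (K.+1, 0) => /=; split=> // l n i j Kn _ _.
    rewrite mul0r Epsum (@sum_only_nat K)//.
    - by rewrite [Emx _ _ _ _]mxE subrr normr0.
    - by rewrite K1.
    - move=> k /andP[k1 _] kK; rewrite EPij ?mulr0//.
      by move: kK; rewrite neq_ltn => /orP[h|h]; [apply: EP; rewrite k1|exact: Eafter].
  exists (Kt, B / powR l0 (eta Kt)) => /=; split; first by rewrite divr_ge0 ?powR_ge0.
  move=> l n i j Ktn ll0 l1.
  have Kt1 : (1 <= Kt)%N by rewrite (leq_trans K1)// ltnW.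
  have -> : \int[Pr]_s psum eta P l s n i j - powR l (eta K) * Emx Pr (P K) i j =
      \int[Pr]_s (\sum_(Kt <= k < n) powR l (eta k) * P k s i j).
    rewrite Epsum (big_cat_nat Kt1 Ktn) /= (@sum_only_nat K) ?K1//; last first.
      move=> k /andP[k1 kKt] kK; rewrite EPij ?mulr0//.
      by move: kK; rewrite neq_ltn => /orP[h|h]; [apply: EP; rewrite k1|apply: Ebetween; rewrite h].
    rewrite [Emx _ _ _ _]mxE addrAC subrr add0r.
    rewrite (expect_sum Pr n (X := fun k s => powR l (eta k) * P k s i j)); last first.
      by move=> k k1; apply: brvZ; apply: brm_P; exact: leq_trans k1.
    rewrite !big_nat; apply: eq_bigr => k /andP[k1 _]; rewrite expectZ//.
    by apply: brm_P; exact: leq_trans k1.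
  apply: (@le_trans _ _ (B / powR l0 (eta Kt) * powR l (eta Kt))).
    apply: expect_norm_le.
      apply: brv_sum => k k1; apply: brvZ; apply: brm_P; exact: leq_trans k1.
    by move=> s; exact: partial_tail_le.
  rewrite ler_wpM2l ?divr_ge0 ?powR_ge0//; apply: ger_powR.
    by rewrite l1 andbT; case/andP: ll0.
  by rewrite etE ge_min lexx.
exists C => // l ll0 l1 cP i j; rewrite [Emx _ _ _ _]mxE.
apply: (@lim_dist_le _ (fun n => \int[Pr]_s psum eta P l s n i j) _ _ _ N); last first.
  by move=> n Nn; exact: HN.
apply: (@expect_lim _ _ _ Pr (fun n s => psum eta P l s n i j)
  (fun s => limn (psum eta P l s) i j) (B / powR l0 (eta 1%N) * powR l (eta 1%N))).
- by move=> n; exact: psum_measurable.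
- by move=> n s; exact: psum_bound.
- by move=> s; exact: lim_psum_entry.
Qed.

End PowerSeries.

(** * The transfer operator on continuous periodic functions *)

Section Operator.
Context {R : realType} {d : measure_display} {Sig : measurableType d} (Pr : probability Sig R).
Variables (X : Sig -> 'M[R]_2) (x : R).
Hypothesis bX : bounded_rm X.
Hypothesis trX : forall s, \tr (X s) = 0.
Hypothesis x20 : x <= 1 / 20.
Hypothesis HX : forall s i j, `|X s i j| <= x.
Implicit Types g h : R -> R.

Lemma measurable_expmx n i j : measurable_fun setT (fun s => (X s ^+ n) i j).
Proof.
elim: n i j => [|n IH] i j.
  by under eq_fun do rewrite expr0; exact: measurable_cst.
have -> : (fun s => (X s ^+ n.+1) i j) =
    fun s => X s i 0 * (X s ^+ n) 0 j + X s i 1 * (X s ^+ n) 1 j.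
  apply/funext => s; have -> : X s ^+ n.+1 = X s *m X s ^+ n by rewrite exprS.
  exact: mulmx2E.
by apply: measurable_funD; apply: measurable_funM => //; [case: (bX i 0)|case: (bX i 1)].
Qed.

Lemma measurable_expm i j : measurable_fun setT (fun s => expm (X s) i j).
Proof.
apply: (@measurable_fun_cvg _ _ _ setT
  (fun n s => (\sum_(k < n) ((k`!)%:R^-1 *: X s ^+ k) : 'M[R]_2) i j)) => //.
- move=> n; elim: n => [|n IH].
    by under eq_fun do rewrite big_ord0; under eq_fun do rewrite mxE; exact: measurable_cst.
  under eq_fun do rewrite big_ord_recr/= mxE [X in _ + X]mxE.
  by apply: measurable_funD => //; apply: measurable_funM => //; exact: measurable_expmx.
- by move=> s _; exact: coords_cvg (@expm_cvg _ (X s)).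
Qed.

(** A lift of the angle map to the real line, continuous in [t] and commuting with the shift by
    [pi]. *)
Definition circ_move s t := t + ang_shift (expm (X s)) t.

Definition transfer g t := \int[Pr]_s g (circ_move s t).

Lemma den_ge s t : 2^-1 <= ang_den (expm (X s)) t.
Proof. by case: (ang_shift_estimate t (trX s) x20 (HX s)). Qed.

Lemma measurable_circ_move t : measurable_fun setT (circ_move ^~ t).
Proof.
have mE := measurable_expm.
have mN : measurable_fun setT (fun s => ang_num (expm (X s)) t).
  apply: measurable_funB; apply: measurable_funM => //;
    apply: measurable_funD; apply: measurable_funM => //.
have mD : measurable_fun setT (fun s => ang_den (expm (X s)) t).
  apply: measurable_funD; apply: measurable_funM => //;
    apply: measurable_funD; apply: measurable_funM => //.
(* Truncating the denominator at one half makes the inverse continuous on the whole line and changes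
   nothing, as the denominator never falls below that value. *)
have mV : measurable_fun setT (fun y : R => (Num.max y 2^-1)^-1).
  apply: continuous_measurable_fun; apply: ctsV.
    move=> y; apply: (@continuous_max _ _ (fun z : R => z) (fun=> 2^-1)).
      exact: cvg_id.
    exact: cst_continuous.
  by move=> y; rewrite gt_eqF// lt_max invr_gt0 ltr0n orbT.
have -> : circ_move ^~ t = fun s =>
    t + atan (ang_num (expm (X s)) t * (Num.max (ang_den (expm (X s)) t) 2^-1)^-1).
  by apply/funext => s; rewrite /circ_move /ang_shift max_l// den_ge.
apply: measurable_funD => //.
apply: (measurableT_comp (f := @atan R)).
  by apply: continuous_measurable_fun => y; exact: continuous_atan.
apply: measurable_funM => //.
exact: (measurableT_comp mV mD).
Qed.

Lemma cts_circ_move s : continuous (circ_move s).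
Proof.
apply: ctsD; first by move=> y; exact: cvg_id.
have [cc cs] := conj (@continuous_cos R) (@continuous_sin R).
apply: (cts_comp (f := @atan R)); first by move=> y; exact: continuous_atan.
apply: ctsM.
  by apply: ctsB; apply: ctsM => //; apply: ctsD; apply: ctsM => //; exact: ctsC.
apply: ctsV.
  by apply: ctsD; apply: ctsM => //; apply: ctsD; apply: ctsM => //; exact: ctsC.
by move=> y; rewrite gt_eqF// (lt_le_trans _ (den_ge s y))// invr_gt0.
Qed.

Lemma circ_move_period s t : circ_move s (t + pi) = circ_move s t + pi.
Proof.
rewrite /circ_move /ang_shift.
have -> : ang_num (expm (X s)) (t + pi) = ang_num (expm (X s)) t.
  by rewrite /ang_num cosDpi sinDpi; ring.
have -> : ang_den (expm (X s)) (t + pi) = ang_den (expm (X s)) t.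
  by rewrite /ang_den cosDpi sinDpi; ring.
by ring.
Qed.

Definition circ_fun g := continuous g /\ periodic_pi g.

Lemma brv_circ_move g t : circ_fun g -> bounded_rv (fun s => g (circ_move s t)).
Proof.
move=> [cg pg]; split; last by have [B _ HB] := periodic_bounded cg pg; exists B.
apply: (measurableT_comp (f := g)); first exact: continuous_measurable_fun.
exact: measurable_circ_move.
Qed.

(** Invariance of the class under one step gives every iterate the measurability and boundedness
    that the next expectation needs. *)
Lemma transfer_circ g : circ_fun g -> circ_fun (transfer g).
Proof.
move=> cpg; have [cg pg] := cpg; split; last first.
  by move=> t; apply: eq_expect => s; rewrite circ_move_period pg.
have [B _ HB] := periodic_bounded cg pg => t.
apply: (@continuity_under_integral _ _ _ Pr (fun t s => g (circ_move s t)) setT measurableT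
  (t - 1) (t + 1) _ _ (fun=> B) _ _ t).
- by move=> y _; apply: brv_int; exact: brv_circ_move.
- apply: aeW => s _ y _; exact: (cts_comp cg (@cts_circ_move s)).
- exact: (brv_int Pr (brv_cst B)).
- by move=> y _; apply: aeW => s _; exact: HB.
- by rewrite inE/= in_itv/=; lra.
Qed.

Lemma transferD g h t : circ_fun g -> circ_fun h ->
  transfer (fun t => g t + h t) t = transfer g t + transfer h t.
Proof. by move=> cg ch; rewrite /transfer expectD//; exact: brv_circ_move. Qed.

Lemma transferZ (c : R) g t : circ_fun g -> transfer (fun t => c * g t) t = c * transfer g t.
Proof. by move=> cg; rewrite /transfer expectZ//; exact: brv_circ_move. Qed.

Lemma transfer_cst (c : R) t : transfer (fun=> c) t = c.
Proof. exact: expect_cst. Qed.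

Lemma transfer_norm_le (B : R) g t : circ_fun g -> (forall y, `|g y| <= B) -> `|transfer g t| <= B.
Proof. by move=> cg HB; apply: expect_norm_le => //; exact: brv_circ_move. Qed.

Lemma circ_funD g h : circ_fun g -> circ_fun h -> circ_fun (fun t => g t + h t).
Proof. by move=> [cg pg] [ch ph]; split; [exact: ctsD|move=> t; rewrite pg ph]. Qed.

Lemma circ_funZ (c : R) g : circ_fun g -> circ_fun (fun t => c * g t).
Proof. by move=> [cg pg]; split; [exact: ctsM (@ctsC _ c) cg|move=> t; rewrite pg]. Qed.

Lemma circ_fun_cst (c : R) : circ_fun (fun=> c).
Proof. by split; [exact: ctsC|]. Qed.

Lemma iter_transfer_circ n g : circ_fun g -> circ_fun (iter n transfer g).
Proof. by move=> cg; elim: n => //= n IH; exact: transfer_circ. Qed.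

Lemma iter_transfer_norm_le n (B : R) g t : circ_fun g -> (forall y, `|g y| <= B) ->
  `|iter n transfer g t| <= B.
Proof.
move=> cg HB; elim: n t => //= n IH t.
by apply: transfer_norm_le => //; exact: iter_transfer_circ.
Qed.

Lemma iter_transferD n g h t : circ_fun g -> circ_fun h ->
  iter n transfer (fun t => g t + h t) t = iter n transfer g t + iter n transfer h t.
Proof.
move=> cg ch; elim: n t => //= n IH t.
have -> : iter n transfer (fun t => g t + h t) =
    fun t => iter n transfer g t + iter n transfer h t by apply/funext.
by rewrite transferD//; exact: iter_transfer_circ.
Qed.

Lemma iter_transferZ n (c : R) g t : circ_fun g ->
  iter n transfer (fun t => c * g t) t = c * iter n transfer g t.
Proof.
move=> cg; elim: n t => //= n IH t.
have -> : iter n transfer (fun t => c * g t) = fun t => c * iter n transfer g t by apply/funext.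
by rewrite transferZ//; exact: iter_transfer_circ.
Qed.

Lemma iter_transfer_cst n (c : R) t : iter n transfer (fun=> c) t = c.
Proof.
elim: n t => //= n IH t.
have -> : iter n transfer (fun=> c) = fun=> c by apply/funext.
exact: transfer_cst.
Qed.

(* The coboundary part of [g - c = a (transfer F - F) + r] telescopes along the orbit. *)
Lemma ergodic_average_le (N : nat) (g F : R -> R) (c a CF rho t : R) : (0 < N)%N ->
  circ_fun g -> circ_fun F -> 0 <= a -> (forall y, `|F y| <= CF) ->
  (forall y, `|g y - c - a * (transfer F y - F y)| <= rho) ->
  `|N%:R^-1 * \sum_(n < N) iter n transfer g t - c| <= 2 * a * CF / N%:R + rho.
Proof.
move=> N0 cg cF a0 HF Hr; have N0' : (0 : R) < N%:R by rewrite ltr0n.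
pose co y := a * (transfer F y + -1 * F y).
pose r y := (g y + - c) + -1 * co y.
have cco : circ_fun co.
  by apply/circ_funZ/circ_funD; [exact: transfer_circ|exact: circ_funZ].
have cr : circ_fun r.
  by apply: circ_funD; [apply: circ_funD => //; exact: circ_fun_cst|exact: circ_funZ].
have gE : g = fun y => (r y + co y) + c by apply/funext => y; rewrite /r; ring.
(* By linearity the coboundary part of the [n]-th term is a difference of consecutive iterates of
   [F]. *)
have itE n : iter n transfer g t =
    iter n transfer r t + a * (iter n.+1 transfer F t - iter n transfer F t) + c.
  rewrite {1}gE iter_transferD; [|exact: circ_funD|exact: circ_fun_cst].
  rewrite iter_transfer_cst iter_transferD// /co iter_transferZ; last first.
    by apply: circ_funD; [exact: transfer_circ|exact: circ_funZ].
  rewrite (iter_transferD n t (transfer_circ cF) (circ_funZ (-1) cF)).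
  by rewrite iter_transferZ// -iterSr mulN1r.
have -> : \sum_(n < N) iter n transfer g t =
    \sum_(n < N) iter n transfer r t + a * (iter N transfer F t - F t) + N%:R * c.
  rewrite (eq_bigr _ (fun n _ => itE (val n))) !big_split/= -mulr_sumr.
  have -> : \sum_(i < N) (transfer (iter i transfer F) t - iter i transfer F t) =
      iter N transfer F t - F t.
    by rewrite -(big_mkord xpredT (fun i => iter i.+1 transfer F t - iter i transfer F t))
      (telescope_sumr (fun n => iter n transfer F t)).
  by rewrite sumr_const card_ord mulr_natl.
have -> : N%:R^-1 * (\sum_(n < N) iter n transfer r t + a * (iter N transfer F t - F t) +
    N%:R * c) - c = a * (iter N transfer F t - F t) / N%:R +
    (\sum_(n < N) iter n transfer r t) / N%:R by field; rewrite gt_eqF.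
apply: normD_le.
  rewrite normrM normfV (gtr0_norm N0') ler_pM2r ?invr_gt0// normrM ger0_norm//.
  have -> : 2 * a * CF = a * (CF + CF) by ring.
  by rewrite ler_wpM2l//; apply: normB_le => //; exact: iter_transfer_norm_le.
rewrite normrM normfV (gtr0_norm N0') ler_pdivrMr//.
apply: (le_trans (ler_norm_sum _ _ _)).
apply: (@le_trans _ _ (\sum_(n < N) rho)).
  apply: ler_sum => n _; apply: iter_transfer_norm_le => // y.
  by have := Hr y; congr (`|_| <= _); rewrite /r /co; ring.
by rewrite sumr_const card_ord mulr_natr.
Qed.

(** The linear term sees only the mean of [X]; when the low-order means vanish, it becomes
    comparable with the second moments. *)
Lemma transfer_taylor g g1 g2 g3 (V t : R) : periodic_pi g ->
  has_deriv g g1 -> has_deriv g1 g2 -> has_deriv g2 g3 ->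
  (forall y, `|g1 y| <= V) -> (forall y, `|g2 y| <= V) -> (forall y, `|g3 y| <= V) ->
  `|transfer g t - g t - (g1 t * (pk (Emx Pr X) t + 2^-1 * \int[Pr]_s (pk (X s) t * pk' (X s) t)) +
     g2 t / 2 * \int[Pr]_s (pk (X s) t ^+ 2))| <= 7000 * V * x ^+ 3.
Proof.
move=> pg d0 d1 d2 V1 V2 V3.
have cg : circ_fun g by split => //; exact: hd_cont d0.
have bp := brv_pk t bX.
have bpp := brvM bp (brv_pk' t bX).
have bp2 : bounded_rv (fun s => pk (X s) t ^+ 2).
  by have := brvM bp bp; under eq_fun do rewrite -expr2.
have b3 : bounded_rv (fun s => g1 t * pk (X s) t + (g1 t / 2) * (pk (X s) t * pk' (X s) t) +
    (g2 t / 2) * (pk (X s) t ^+ 2)).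
  by apply: brvD; [apply: brvD|]; exact: brvZ.
have -> : transfer g t - g t - (g1 t * (pk (Emx Pr X) t + 2^-1 *
     \int[Pr]_s (pk (X s) t * pk' (X s) t)) + g2 t / 2 * \int[Pr]_s (pk (X s) t ^+ 2)) =
   \int[Pr]_s (g (circ_move s t) - g t - (g1 t * pk (X s) t +
      (g1 t / 2) * (pk (X s) t * pk' (X s) t) + (g2 t / 2) * (pk (X s) t ^+ 2))).
  have bm := brv_circ_move t cg.
  rewrite (expectB Pr (brvB bm (brv_cst (g t))) b3) (expectB Pr bm (brv_cst (g t))).
  rewrite expect_cst expect_lin3// -(expect_pk _ _ bX) /transfer.
  by field.
apply: expect_norm_le.
  by apply: brvB => //; apply: brvB; [exact: brv_circ_move|exact: brv_cst].
move=> s; have := angle_taylor t (trX s) x20 (HX s) d0 d1 d2 V1 V2 V3.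
by congr (`|_| <= _); rewrite /circ_move; field.
Qed.

End Operator.

(** * Comparison with the limiting generator *)

Section Generator.
Context {R : realType} {d : measure_display} {Sig : measurableType d} (Pr : probability Sig R).

Lemma pk_lin_le (A B : 'M[R]_2) (c e t : R) : (forall i j, `|A i j - c * B i j| <= e) ->
  `|pk A t - c * pk B t| <= 3 * e.
Proof.
move=> H; have -> : pk A t - c * pk B t = (A 1 0 - c * B 1 0) * cos t ^+ 2 -
    (A 0 1 - c * B 0 1) * sin t ^+ 2 - (A 0 0 - c * B 0 0) * sin (2 * t) by rewrite /pk; ring.
have h : `|(A 1 0 - c * B 1 0) * cos t ^+ 2 -
    (A 0 1 - c * B 0 1) * sin t ^+ 2 - (A 0 0 - c * B 0 0) * sin (2 * t)| <=
    e * 1 + e * 1 + e * 1.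
  apply: normB_le; first apply: normB_le; apply: normM_le => //.
  - by rewrite normrX exprn_ile1// norm_cos_le.
  - by rewrite normrX exprn_ile1// norm_sin_le.
  - exact: norm_sin_le.
by apply: (le_trans h); lra.
Qed.

Lemma pk'_lin_le (A B : 'M[R]_2) (c e t : R) : (forall i j, `|A i j - c * B i j| <= e) ->
  `|pk' A t - c * pk' B t| <= 4 * e.
Proof.
move=> H; have -> : pk' A t - c * pk' B t =
    - ((A 1 0 - c * B 1 0) + (A 0 1 - c * B 0 1)) * sin (2 * t) -
    2 * (A 0 0 - c * B 0 0) * cos (2 * t) by rewrite /pk'; ring.
have h : `|- ((A 1 0 - c * B 1 0) + (A 0 1 - c * B 0 1)) * sin (2 * t) -
    2 * (A 0 0 - c * B 0 0) * cos (2 * t)| <= (e + e) * 1 + 2 * e * 1.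
  apply: normB_le; apply: normM_le.
  - by rewrite normrN; exact: normD_le.
  - exact: norm_sin_le.
  - by apply: normM_le => //; rewrite ger0_norm.
  - exact: norm_cos_le.
by apply: (le_trans h); lra.
Qed.

Lemma pk_le (A : 'M[R]_2) (e t : R) : (forall i j, `|A i j| <= e) -> `|pk A t| <= 3 * e.
Proof.
move=> H; have := @pk_lin_le A 0 0 e t; rewrite mul0r subr0; apply => i j.
by rewrite mul0r subr0.
Qed.

Lemma pk'_le (A : 'M[R]_2) (e t : R) : (forall i j, `|A i j| <= e) -> `|pk' A t| <= 4 * e.
Proof.
move=> H; have := @pk'_lin_le A 0 0 e t; rewrite mul0r subr0; apply => i j.
by rewrite mul0r subr0.
Qed.

Lemma mul_approx_le (a a0 b b0 ea eb A B : R) : `|a - a0| <= ea -> `|b - b0| <= eb ->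
  `|a| <= A -> `|b0| <= B -> `|a * b - a0 * b0| <= A * eb + ea * B.
Proof.
move=> h1 h2 h3 h4; have -> : a * b - a0 * b0 = a * (b - b0) + (a - a0) * b0 by ring.
by apply: normD_le; exact: normM_le.
Qed.

(** Replacing one factor at a time costs size times error. With [c * Y] the first term of the
    series, [x] is of order [l^(eta 1)] and [e] of order [l^(eta 2)], which produces the exponent
    [eta 1 + eta 2]. *)
Lemma second_moment_le (X Y : Sig -> 'M[R]_2) (c x e t : R) : bounded_rm X -> bounded_rm Y ->
  (forall s i j, `|X s i j| <= x) -> (forall s i j, `|c * Y s i j| <= x) ->
  (forall s i j, `|X s i j - c * Y s i j| <= e) ->
  `|\int[Pr]_s (pk (X s) t * pk' (X s) t) - c ^+ 2 * \int[Pr]_s (pk (Y s) t * pk' (Y s) t)|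
     <= 24 * (x * e) /\
  `|\int[Pr]_s (pk (X s) t ^+ 2) - c ^+ 2 * \int[Pr]_s (pk (Y s) t ^+ 2)| <= 18 * (x * e).
Proof.
move=> bX bY HX HY HXY.
have cp s : c * pk (Y s) t = pk (c *: Y s) t by rewrite /pk !mxE; ring.
have cp' s : c * pk' (Y s) t = pk' (c *: Y s) t by rewrite /pk' !mxE; ring.
have HcY s i j : `|(c *: Y s) i j| <= x by rewrite mxE.
have b1 := brvM (brv_pk t bX) (brv_pk' t bX).
have b2 := brvM (brv_pk t bY) (brv_pk' t bY).
have b3 : bounded_rv (fun s => pk (X s) t ^+ 2).
  by have := brvM (brv_pk t bX) (brv_pk t bX); under eq_fun do rewrite -expr2.
have b4 : bounded_rv (fun s => pk (Y s) t ^+ 2).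
  by have := brvM (brv_pk t bY) (brv_pk t bY); under eq_fun do rewrite -expr2.
split.
  rewrite -(expectZ Pr (c ^+ 2) b2) -(expectB Pr b1 (brvZ (c ^+ 2) b2)).
  apply: expect_norm_le; first by apply: brvB => //; exact: brvZ.
  move=> s; have -> : c ^+ 2 * (pk (Y s) t * pk' (Y s) t) = (c * pk (Y s) t) * (c * pk' (Y s) t) by ring.
  apply: le_trans (mul_approx_le (pk_lin_le t (HXY s)) (pk'_lin_le t (HXY s))
    (pk_le t (HX s)) (B := 4 * x) _) _; first by rewrite cp' pk'_le.
  by rewrite le_eqVlt; apply/orP; left; apply/eqP; ring.
rewrite -(expectZ Pr (c ^+ 2) b4) -(expectB Pr b3 (brvZ (c ^+ 2) b4)).
apply: expect_norm_le; first by apply: brvB => //; exact: brvZ.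
move=> s; have -> : pk (X s) t ^+ 2 - c ^+ 2 * pk (Y s) t ^+ 2 =
  pk (X s) t * pk (X s) t - (c * pk (Y s) t) * (c * pk (Y s) t) by ring.
apply: le_trans (mul_approx_le (pk_lin_le t (HXY s)) (pk_lin_le t (HXY s))
  (pk_le t (HX s)) (B := 3 * x) _) _; first by rewrite cp pk_le.
by rewrite le_eqVlt; apply/orP; left; apply/eqP; ring.
Qed.

Lemma is_eta_tilde_bounds (eta : nat -> R) (P : nat -> Sig -> 'M[R]_2) (K : nat) (et : R) :
  (forall k, (1 <= k)%N -> eta k < eta k.+1) -> (1 <= K)%N ->
  eta K = 2 * eta 1%N -> is_eta_tilde Pr eta P K et ->
  eta K < et /\ et <= eta 1%N + eta 2%N.
Proof.
move=> inc K1 eK; have := inc 1%N isT => e12.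
have h : eta K < eta 1%N + eta 2%N by lra.
case=> [[Kt [KKt [_ [_ ->]]]]|[_ ->]] //.
split; last by rewrite ge_min lexx orbT.
by rewrite lt_min h andbT; exact: eta_lt.
Qed.

Lemma generator_estimate (eta : nat -> R) (P : nat -> Sig -> 'M[R]_2) (K : nat) (l0 B et : R) :
  (forall k, (1 <= k)%N -> 0 < eta k) -> (forall k, (1 <= k)%N -> eta k < eta k.+1) ->
  (forall k s, (1 <= k)%N -> \tr (P k s) = 0) ->
  (forall k i j, (1 <= k)%N -> measurable_fun setT (fun s => P k s i j)) ->
  0 < l0 -> (forall s n, \sum_(1 <= k < n) powR l0 (eta k) * abs_entries (P k s) <= B) ->
  (1 <= K)%N -> eta K = 2 * eta 1%N ->
  (forall k, (1 <= k < K)%N -> Emx Pr (P k) = 0) -> is_eta_tilde Pr eta P K et ->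
  exists C l1 : R, [/\ 0 <= C, 0 < l1, l1 <= l0, l1 <= 1 &
    forall l : R, 0 < l < l1 -> (forall s, cvgn (psum eta P l s)) ->
    exists x : R, let X s := limn (psum eta P l s) in
    [/\ bounded_rm X, forall s, \tr (X s) = 0, x <= 1 / 20, forall s i j, `|X s i j| <= x &
    forall g g1 g2 g3 (V t : R), periodic_pi g ->
      has_deriv g g1 -> has_deriv g1 g2 -> has_deriv g2 g3 ->
      (forall y, `|g1 y| <= V) -> (forall y, `|g2 y| <= V) -> (forall y, `|g3 y| <= V) ->
      `|transfer Pr X g t - g t - powR l (eta K) *
        ((qfun Pr P K t * g1 t + pfun Pr P t * g2 t) / 2)| <= C * V * powR l et]].
Proof.
move=> eta0 inc trP mP l00 HB K1 eK EP Het.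
have [Ket et12] := is_eta_tilde_bounds inc K1 eK Het.
have e10 : 0 < eta 1%N by exact: eta0.
have K2 : (2 <= K)%N.
  rewrite ltn_neqAle K1 andbT; apply/eqP => e; move: eK; rewrite -e; lra.
have e2K : eta 2%N <= eta K by exact: (eta_mono inc).
(* From [eta 2 <= eta K = 2 * eta 1]; thus the cubic Taylor remainder is within the admissible
   error. *)
have et3 : et <= eta 1%N + eta 1%N + eta 1%N by lra.
have [C3 C30 HC3] := expect_X_estimate inc mP l00 HB K1 EP Het.
have [C1 eC1] : exists C, C = B / powR l0 (eta 1%N) by eexists.
have [C2 eC2] : exists C, C = B / powR l0 (eta 2%N) by eexists.
have B0 : 0 <= B.
  by rewrite -(expect_cst Pr B) -(expect_cst Pr 0); apply: expect_le;
    [exact: brv_cst|exact: brv_cst|move=> s; have := HB s 0%N; rewrite big_geq].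
have C10 : 0 <= C1 by rewrite eC1 divr_ge0 ?powR_ge0.
have C20 : 0 <= C2 by rewrite eC2 divr_ge0 ?powR_ge0.
(* A threshold for [l^(eta 1)] below which the entries of [X] stay under [1 / 20]. *)
have c0 : 0 < 1 / (20 * (C1 + 1)) by rewrite divr_gt0// mulr_gt0// ltr_wpDl.
have [l2 l20 Hl2] := powR_small e10 c0.
pose l1 := Num.min (Num.min l0 1) l2.
(* The contributions of the mean, of the second moments with [21 = (24 + 18) / 2], and of the Taylor
   remainder. *)
exists (3 * C3 + 21 * (C1 * C2) + 7000 * C1 ^+ 3), l1; split.
- apply: addr_ge0; first apply: addr_ge0.
  + by rewrite mulr_ge0.
  + by rewrite mulr_ge0// mulr_ge0.
  + by apply: mulr_ge0; [exact: ler0n|exact: exprn_ge0].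
- by rewrite /l1 !lt_min l00 l20 ltr01.
- by rewrite /l1 !ge_min lexx.
- by rewrite /l1 !ge_min lexx orbT.
move=> l; rewrite /l1 !lt_min => /andP[lpos /andP[/andP[ll0 ll1] ll2]] cP.
have ll0' : 0 < l <= l0 by rewrite lpos ltW.
pose X s := limn (psum eta P l s).
have bX : bounded_rm X := brm_X inc mP l00 HB ll0' cP.
have bP1 : bounded_rm (P 1%N) by apply: (brm_P mP l00 HB).
have bPK : bounded_rm (P K) by apply: (brm_P mP l00 HB).
have HX s i j : `|X s i j| <= C1 * powR l (eta 1%N).
  by rewrite eC1; exact: (X_bound inc l00 HB ll0' cP s i j).
have HX1 s i j : `|X s i j - powR l (eta 1%N) * P 1%N s i j| <= C2 * powR l (eta 2%N).
  by rewrite eC2; exact: (X_sub_first_bound inc l00 HB ll0' cP s i j).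
have HP1 s i j : `|powR l (eta 1%N) * P 1%N s i j| <= C1 * powR l (eta 1%N).
  rewrite eC1; have := partial_tail_le inc l00 HB 2 s i j ll0' (leqnn 1).
  by rewrite big_nat1.
have trX s : \tr (X s) = 0 := X_traceless cP (fun k => @trP k s).
have p1 : 0 < powR l (eta 1%N) by exact: powR_gt0.
have x20 : C1 * powR l (eta 1%N) <= 1 / 20.
  have := Hl2 l; rewrite lpos ll2 => /(_ isT); rewrite ltr_pdivlMr; last first.
    by rewrite mulr_gt0// ltr_wpDl.
  by lra.
exists (C1 * powR l (eta 1%N)); split => // g g1 g2 g3 V t pg d0 d1 d2 V1 V2 V3.
have V0 : 0 <= V := le_trans (normr_ge0 _) (V1 0).
have T := transfer_taylor Pr bX trX x20 HX t pg d0 d1 d2 V1 V2 V3.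
have [M1 M2] := second_moment_le t bX bP1 HX HP1 HX1.
have lt1 : 0 < l <= 1 by rewrite lpos ltW.
have powle (a : R) : et <= a -> powR l a <= powR l et by move=> h; exact: ger_powR.
have pD (a b : R) : powR l (a + b) = powR l a * powR l b.
  by rewrite powRD// (gt_eqF lpos) implybT.
have hx3 : (C1 * powR l (eta 1%N)) ^+ 3 <= C1 ^+ 3 * powR l et.
  rewrite exprMn ler_wpM2l ?exprn_ge0//.
  have -> : powR l (eta 1%N) ^+ 3 = powR l (eta 1%N + eta 1%N + eta 1%N) by rewrite !pD; ring.
  exact: powle.
have hxe : C1 * powR l (eta 1%N) * (C2 * powR l (eta 2%N)) <= C1 * C2 * powR l et.
  have -> : C1 * powR l (eta 1%N) * (C2 * powR l (eta 2%N)) = C1 * C2 * powR l (eta 1%N + eta 2%N).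
    by rewrite pD; ring.
  by rewrite ler_wpM2l ?mulr_ge0//; exact: powle.
have lK : powR l (eta K) = powR l (eta 1%N) ^+ 2.
  have -> : eta K = eta 1%N + eta 1%N by rewrite eK; ring.
  by rewrite pD expr2.
have hE := pk_lin_le t (HC3 l ll0' (ltW ll1) cP).
rewrite -/X in hE.
move: M1 M2; rewrite -lK => M1 M2.
rewrite qfunE (expect_pk Pr t bPK) /pfun.
set pX := pk (Emx Pr X) t in T hE.
set pK := pk (Emx Pr (P K)) t in hE *.
set IX := Rintegral Pr setT (fun s => pk (X s) t * pk' (X s) t) in T M1.
set I1 := Rintegral Pr setT (fun s => pk (P 1%N s) t * pk' (P 1%N s) t) in M1 *.
set JX := Rintegral Pr setT (fun s => pk (X s) t ^+ 2) in T M2.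
set J1 := Rintegral Pr setT (fun s => pk (P 1%N s) t ^+ 2) in M2 *.
set LK := powR l (eta K) in hE M1 M2 *.
set tg := transfer _ _ _ _ in T *.
have -> : tg - g t - LK * (((2 * pK + I1) * g1 t + J1 * g2 t) / 2) =
  (tg - g t - (g1 t * (pX + 2^-1 * IX) + g2 t / 2 * JX)) +
  (g1 t * (pX - LK * pK) + (g1 t * (IX - LK * I1)) / 2 + (g2 t * (JX - LK * J1)) / 2) by field.
have h1 := normM_le (V1 t) hE.
have n2 : `|2^-1 : R| <= 2^-1 by rewrite ger0_norm ?invr_ge0.
have h2 := normM_le (normM_le (V1 t) M1) n2.
have h3 := normM_le (normM_le (V2 t) M2) n2.
apply: (le_trans (normD_le T (normD_le (normD_le h1 h2) h3))).
set LE := powR l et in hx3 hxe *.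
set xe := C1 * powR l (eta 1%N) * (C2 * powR l (eta 2%N)) in hxe *.
set x3 := (C1 * powR l (eta 1%N)) ^+ 3 in hx3 *.
have k1 : V * x3 <= V * (C1 ^+ 3 * LE) by rewrite ler_wpM2l.
have k2 : V * xe <= V * (C1 * C2 * LE) by rewrite ler_wpM2l.
have -> : 7000 * V * x3 + (V * (3 * (C3 * LE)) + V * (24 * xe) / 2 + V * (18 * xe) / 2) =
  7000 * (V * x3) + 3 * (V * (C3 * LE)) + 21 * (V * xe) by field.
have -> : (3 * C3 + 21 * (C1 * C2) + 7000 * C1 ^+ 3) * V * LE =
  7000 * (V * (C1 ^+ 3 * LE)) + 3 * (V * (C3 * LE)) + 21 * (V * (C1 * C2 * LE)) by ring.
clear - k1 k2; lra.
Qed.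

End Generator.

(** * The error bound for the Birkhoff averages *)

Unset Implicit Arguments.
Theorem theorem3 (R : realType) (d : measure_display) (Sig : measurableType d)
    (Pr : probability Sig R)
    (T : R -> Sig -> 'M[R]_2) (M : 'M[R]_2)
    (eta : nat -> R) (P : nat -> Sig -> 'M[R]_2) (K : nat) :
  (* T_{lambda,sigma}, M in SL(2,R) *)
  \det M = 1 ->
  (forall l s, \det (T l s) = 1) ->
  (* 0 < eta_1 < eta_2 < ... *)
  (forall k, (1 <= k)%N -> 0 < eta k) ->
  (forall k, (1 <= k)%N -> eta k < eta k.+1) ->
  (* P_{eta_k,sigma} in sl(2,R), measurable in sigma *)
  (forall k s, (1 <= k)%N -> \tr (P k s) = 0) ->
  (forall k i j, (1 <= k)%N -> measurable_fun setT (fun s => P k s i j)) ->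
  (* compact support / power series: uniform absolute convergence for small lambda *)
  (exists l0 : R, 0 < l0 /\ exists B : R, forall s n,
     \sum_(1 <= k < n) powR l0 (eta k) * abs_entries (P k s) <= B) ->
  (exists l0 : R, 0 < l0 /\ exists B : R, forall l s i j,
     0 < l <= l0 -> `|T l s i j| <= B) ->
  (* M T M^{-1} = +- exp(sum_k lambda^{eta_k} P_{eta_k,sigma}) for small lambda *)
  (exists l0 : R, 0 < l0 /\ forall l s, 0 < l <= l0 ->
     cvgn (psum eta P l s) /\
     exists sg : R, (sg = 1 \/ sg = -1) /\
       M *m T l s *m invmx M = sg *: expm (limn (psum eta P l s))) ->
  (* the index K *)
  (1 <= K)%N ->
  eta K = 2 * eta 1%N ->
  eta K.+1 <= eta 1%N + eta 2%N ->
  (forall k, (1 <= k < K)%N -> (Pr [set s | P k s = 0%R] < 1)%E) ->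
  (* anomaly of second order *)
  (forall k, (1 <= k < K)%N -> Emx Pr (P k) = 0) ->
  (* hypothesis on the zeros of p *)
  (forall th, pfun Pr P th = 0 -> qfun Pr P K th != 0) ->
  forall rho : R -> R, groundstate (pfun Pr P) (qfun Pr P K) rho ->
  forall et : R, is_eta_tilde Pr eta P K et ->
  forall f : R -> R,
  (C2_pi f \/ ((forall th, pfun Pr P th != 0) /\ C1_pi f)) ->
  forall th0 : R,
  exists l1 : R, exists C : R, 0 < l1 /\
    forall (l : R) (N : nat), 0 < l < l1 -> (0 < N)%N ->
      `| I_N Pr T M l N th0 f - int0pi (fun x => f x * rho x) |
        <= C * (powR l (et - eta K) + (powR l (eta K) * N%:R)^-1).
Proof.
move=> detM detT eta0 inc trP mP [l0 [l00 [B HB]]] _ [lc [lc0 Hc]] K1 eK _ ndeg EP Hq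
  rho grho et Het f Hf th0.
have [Ket et12] := is_eta_tilde_bounds inc K1 eK Het.
have e10 : 0 < eta 1%N by exact: eta0.
(* [K = 1] would give [eta 1 = 2 * eta 1]. Hence the nondegeneracy hypothesis covers [P 1], as the
   count of the zeros of [p] requires. *)
have K2 : (1 <= 1 < K)%N.
  rewrite /= ltn_neqAle K1 andbT; apply/eqP => e; move: eK; rewrite -e; lra.
have bP k : (1 <= k)%N -> bounded_rm (P k) by move=> k1; apply: (brm_P mP l00 HB).
have [p1 [p2 [hp hp1 cp2]]] := C2fun_pfun Pr (bP 1%N isT).
have [q1 [q2 [hq hq1 cq2]]] := C2fun_qfun Pr (bP 1%N isT) (bP K K1).
have [c1 [c2 [c21 c12 pc2 Hfw Hbw]]] :=
  zero_structure (bP 1%N isT) (fun s => trP 1%N s isT) (ndeg 1%N K2) Hq.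
have [pp pq] := conj (pfun_period Pr P) (qfun_period Pr P K).
have p0 := @pfun_ge0 _ _ _ Pr P.
have [pf hf cf1 f2p] : [/\ periodic_pi f, has_deriv f (derive1 f), continuous (derive1 f) &
    (exists2 f2, has_deriv (derive1 f) f2 & continuous f2) \/ (forall x, pfun Pr P x != 0)].
  case: Hf => [[pf [df [ddf cddf]]]|[pn [pf [df cdf]]]]; split.
  - exact: pf.
  - exact: (hdP df).
  - exact: hd_cont (hdP ddf).
  - by left; exists (derive1 (derive1 f)); [exact: (hdP ddf)|exact: cddf].
  - exact: pf.
  - exact: (hdP df).
  - exact: cdf.
  - by right.
have [Cp [e0 [Cp0 e00 Hpoisson]]] := poisson_uniform hp hp1 cp2 pp hq hq1 cq2 pq p0 c21 c12 pc2
  Hfw Hbw grho hf cf1 pf f2p.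
have [Cg [l1 [Cg0 l10 l1l0 l11 Hgen]]] := generator_estimate eta0 inc trP mP l00 HB K1 eK EP
  Het.
have eK0 : 0 < et - eta K by lra.
have [l2 l20 Hl2] := powR_small eK0 e00.
set mf := int0pi _.
have cfun : circ_fun f by split => //; exact: hd_cont hf.
(* [2 * Cp] pays for the telescoped boundary terms, [Cg * Cp] for the generator estimate, and the
   last [2 * Cp] for the regularisation and for the distance of [c] from the groundstate mean. *)
exists (Num.min (Num.min l1 l2) lc), (2 * Cp + Cg * Cp + 2 * Cp); split.
  by rewrite !lt_min l10 l20 lc0.
move=> l N; rewrite !lt_min => /andP[lpos /andP[/andP[ll1 ll2] llc]] N0.
have llc' : 0 < l <= lc by rewrite lpos ltW.
have cP s : cvgn (psum eta P l s) by case: (Hc l s llc').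
have [|x] := Hgen l _ cP; first by rewrite lpos.
set X := fun s => limn (psum eta P l s) => -[bX trX x20 HX Hgenl].
(* The two operators agree on periodic functions only, so identifying their iterates uses that
   [transfer] preserves this class. *)
have PopE g : circ_fun g -> Pop Pr T M l g = transfer Pr X g.
  move=> [_ pg]; apply/funext => t; apply: eq_expect => s.
  have [_ [sg [sg1 ->]]] := Hc l s llc'.
  apply: S_T_shift => //.
  by apply: (lt_le_trans _ (den_ge trX x20 HX s t)); rewrite invr_gt0.
have iterE n : iter n (Pop Pr T M l) f = iter n (transfer Pr X) f.
  elim: n => //= n ->; apply: PopE.
  exact: (iter_transfer_circ Pr bX trX x20 HX n cfun).
pose e := powR l (et - eta K).
have ep : 0 < e by exact: powR_gt0.
have LK0 : 0 < powR l (eta K) by exact: powR_gt0.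
have [|F [u [v [w [c [[hF hu hv pF] [[bF bu bv bw] [E cmf]]]]]]]] := Hpoisson e.
  by rewrite ep Hl2// lpos.
have eE : powR l et = powR l (eta K) * e.
  by rewrite /e -powRD ?(gt_eqF lpos) ?implybT//; congr (powR l _); ring.
have cF : circ_fun F by split => //; exact: hd_cont hF.
have avg := @ergodic_average_le _ _ _ Pr X x bX trX x20 HX N f F c (powR l (eta K))^-1 Cp
  ((Cg * Cp + Cp) * e) th0 N0 cfun cF.
rewrite /I_N (eq_bigr (fun n : 'I_N => iter n (transfer Pr X) f th0)); last first.
  by move=> n _; rewrite iterE.
set IN := N%:R^-1 * _ in avg *.
have {avg} avg : `|IN - c| <= 2 * (powR l (eta K))^-1 * Cp / N%:R + (Cg * Cp + Cp) * e.
  apply: avg => //; first by rewrite invr_ge0 ltW.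
  move=> y; have G := Hgenl F u v w Cp y pF hF hu hv bu bv bw.
  have Ey := E y.
  set D := transfer Pr X F y - F y in G *.
  set L := (qfun Pr P K y * u y + pfun Pr P y * v y) / 2 in G.
  (* The residual has two sources: the generator error divided by [l^(eta K)], and the term
     [e / 2 * v] added by the regularisation. The choice of [e] makes both of order [e]. *)
  have -> : f y - c - (powR l (eta K))^-1 * D =
      - ((powR l (eta K))^-1 * (D - powR l (eta K) * L)) + e / 2 * v y.
    have -> : f y - c = L + e / 2 * v y by rewrite /L; clear - Ey; lra.
    by field; rewrite gt_eqF.
  have hG : `|- ((powR l (eta K))^-1 * (D - powR l (eta K) * L))| <= Cg * Cp * e.
    rewrite normrN normrM ger0_norm ?invr_ge0 ?(ltW LK0)//.
    rewrite mulrC ler_pdivrMr//; apply: (le_trans G); rewrite eE.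
    by rewrite le_eqVlt; apply/orP; left; apply/eqP; ring.
  have hv' : `|e / 2 * v y| <= Cp * e.
    rewrite normrM ger0_norm ?divr_ge0 ?(ltW ep)// mulrC.
    apply: ler_pM => //; first by rewrite divr_ge0// ltW.
    by rewrite ler_pdivrMr// ler_peMr ?(ltW ep)// ler1n.
  by apply: (le_trans (normD_le hG hv')); rewrite mulrDl.
have -> : IN - mf = (IN - c) + (c - mf) by ring.
apply: (le_trans (normD_le avg cmf)); rewrite -/e.
have N0' : (0 : R) < N%:R by rewrite ltr0n.
have -> : 2 * (powR l (eta K))^-1 * Cp / N%:R = 2 * Cp * (powR l (eta K) * N%:R)^-1.
  by field; rewrite !gt_eqF.
set iN := (powR l (eta K) * N%:R)^-1.
have iN0 : 0 <= iN by rewrite invr_ge0 mulr_ge0// ltW.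
have k1 : 0 <= Cp * e by rewrite mulr_ge0// ltW.
have k2 : 0 <= Cg * Cp * e by rewrite !mulr_ge0// ltW.
have k3 : 0 <= Cp * iN by rewrite mulr_ge0.
have k4 : 0 <= Cg * Cp * iN by rewrite !mulr_ge0.
clear - k1 k2 k3 k4; lra.
Qed.
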